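(* Let $E$ be a countable Borel equivalence relation on a standard Borel space $X$ and let $G$ be a multi-ended Borel graphing of $E$. Let $\mathcal{C}\subseteq\mathcal{C}_G$ be a Borel collection of cuts that is $G$-complete, self-dual, nested and chain-vanishing. Then there exist a treeable Borel equivalence relation $E_T\subseteq E$ and a Borel equivalence relation $E_{\mathcal C}\subseteq E$ with $E_{\mathcal C}\le_B\,\sim_{\mathcal C}$ such that $E=E_T\ast E_{\mathcal C}$.
   Context: A countable Borel equivalence relation is a Borel equivalence relation all of whose classes are countable. A Borel graphing of $E$ is a Borel irreflexive symmetric set $G\subseteq X^2$ whose connected components are exactly the $E$-classes. For a set $C$ contained in a single connected component $Y$ of $G$, write $C^*:=Y\setminus C$. A cut of $G$ is a set $C$ contained in a single connected component $Y$ such that $C$ and $C^*$ are infinite and only finitely many edges of $G$ join $C$ to $C^*$. $G$ is multi-ended if every connected component contains a cut. Each cut $C$ is identified with the finite set $\{(x,y)\in G: x\in C,\ y\in C^*\}$, so the set $\mathcal C_G$ of all cuts is a Borel subset of the standard Borel space of finite subsets of $G$; ''Borel collection'' refers to this structure. A collection $\mathcal C\subseteq\mathcal C_G$ is: $G$-complete if it contains a cut from every connected component; self-dual if $C\in\mathcal C\Rightarrow C^*\in\mathcal C$; nested if for any $A,B\in\mathcal C$ in the same component, one of $A\cap B$, $A\cap B^*$, $A^*\cap B$, $A^*\cap B^*$ is empty; chain-vanishing if for every strictly $\subsetneq$-decreasing (resp. increasing) sequence $(A_n)_{n\in\mathbb N}$ in $\mathcal C$ there is no $B\in\mathcal C$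 in the same component with $B\subseteq A_n$ (resp. $B\cap A_n=\emptyset$) for all $n$. For $A,B$ in the same component, $A\perp B$ means $A\cap B=\emptyset$ and $A\neq B^*$. For $A,B\in\mathcal C$, $A\sim_{\mathcal C}B$ iff $A,B$ lie in the same component and either $A=B$, or $A\perp B$ and there is no $D\in\mathcal C$ with $D\supsetneq A$ and $D\perp B$. $E_{\mathcal C}\le_B\,\sim_{\mathcal C}$ means there is a Borel map $\pi:X\to\mathcal C$ with $x\,E_{\mathcal C}\,y\iff\pi(x)\sim_{\mathcal C}\pi(y)$. An equivalence relation is treeable if it admits an acyclic Borel graphing. $E=E_1\ast E_2$ (free product) means $E$ is the smallest equivalence relation containing $E_1\cup E_2$, and there are no $n\ge1$ and points $x_0,\dots,x_{2n-1}$, with $x_{2n}:=x_0$, such that $x_i\ne x_{i+1}$ for all $i<2n$, $x_i\,E_1\,x_{i+1}$ for even $i$ and $x_i\,E_2\,x_{i+1}$ for odd $i$. *)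

(* Defs.v *)
From Stdlib Require Import Relations.
From mathcomp Require Import all_boot all_algebra.
From mathcomp Require Import all_classical all_reals all_analysis.
From mathcomp Require Import Rstruct Rstruct_topology.

Set Implicit Arguments.
Unset Strict Implicit.
Unset Printing Implicit Defensive.

Local Open Scope classical_set_scope.

Section Defs.
Context {d : measure_display} {X : measurableType d}.

(** Standard Borel space: Borel isomorphic to a Borel subset of the reals
    (equivalently, by Kuratowski, of some Polish space). *)
Definition standard_borel : Prop :=
  exists f : X -> measurableTypeR Rdefinitions.R,
    injective f /\ measurable_fun setT f /\ measurable (range f) /\
    (forall A : set X, measurable A -> measurable (f @` A)).

Definition equiv_rel (E : set (X * X)) : Prop :=
  (forall x, E (x, x)) /\ (forall x y, E (x, y) -> E (y, x)) /\
  (forall x y z, E (x, y) -> E (y, z) -> E (x, z)).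

Definition borel_equiv (E : set (X * X)) : Prop :=
  measurable E /\ equiv_rel E.

Definition countable_borel_equiv (E : set (X * X)) : Prop :=
  borel_equiv E /\ forall x, countable [set y | E (x, y)].

Definition conn (G : set (X * X)) : X -> X -> Prop :=
  clos_refl_trans X (fun a b => G (a, b)).

Definition borel_graphing (E G : set (X * X)) : Prop :=
  measurable G /\ (forall x, ~ G (x, x)) /\
  (forall x y, G (x, y) -> G (y, x)) /\
  (forall x y, E (x, y) <-> conn G x y).

Definition acyclic (G : set (X * X)) : Prop :=
  forall (n : nat) (p : nat -> X), (3 <= n)%N ->
    (forall i j, (i < n)%N -> (j < n)%N -> p i = p j -> i = j) ->
    ~ (forall i, (i < n)%N -> G (p i, p (i.+1 %% n)%N)).

Definition treeable (E : set (X * X)) : Prop :=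
  exists T : set (X * X), borel_graphing E T /\ acyclic T.

Definition comp (G : set (X * X)) (x : X) : set X := [set y | conn G x y].

Definition cstar (G : set (X * X)) (C : set X) : set X :=
  [set y | exists2 x, C x & conn G x y] `\` C.

(** Edge boundary of C: the finite set identified with the cut C. *)
Definition bdry (G : set (X * X)) (C : set X) : set (X * X) :=
  [set p | G p /\ C p.1 /\ cstar G C p.2].

Definition is_cut (G : set (X * X)) (C : set X) : Prop :=
  (exists x, C `<=` comp G x) /\
  infinite_set C /\ infinite_set (cstar G C) /\ finite_set (bdry G C).

Definition multi_ended (G : set (X * X)) : Prop :=
  forall x, exists C, is_cut G C /\ C `<=` comp G x.

(** Standard Borel structure on finite subsets of X * X: a family S of finite
    subsets is Borel iff for each n the set of injective n-tuples whose
    underlying set lies in S is Borel in the product sigma-algebra on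
    ('I_n -> X * X), generated by the coordinate cylinders. *)
Definition tuple_measurable (n : nat) (A : set ('I_n -> X * X)) : Prop :=
  <<s [set [set t : 'I_n -> X * X | B (t i)] | i in [set: 'I_n] &
        B in [set B : set (X * X) | measurable B]] >> A.

Definition borel_fin (S : set (set (X * X))) : Prop :=
  forall n : nat,
    tuple_measurable [set t : 'I_n -> X * X | injective t /\ S (range t)].

(** A collection of cuts (each cut identified with its edge boundary). *)
Definition borel_cut_collection (G : set (X * X)) (CC : set (set X)) : Prop :=
  CC `<=` is_cut G /\ borel_fin (bdry G @` CC).

Definition same_comp (G : set (X * X)) (A B : set X) : Prop :=
  exists a b, A a /\ B b /\ conn G a b.

Definition G_complete (G : set (X * X)) (CC : set (set X)) : Prop :=
  forall x, exists C, CC C /\ C `<=` comp G x.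

Definition self_dual (G : set (X * X)) (CC : set (set X)) : Prop :=
  forall C, CC C -> CC (cstar G C).

Definition nested (G : set (X * X)) (CC : set (set X)) : Prop :=
  forall A B, CC A -> CC B -> same_comp G A B ->
    A `&` B = set0 \/ A `&` cstar G B = set0 \/
    cstar G A `&` B = set0 \/ cstar G A `&` cstar G B = set0.

Definition chain_vanishing (G : set (X * X)) (CC : set (set X)) : Prop :=
  (forall A : nat -> set X, (forall n, CC (A n)) ->
     (forall n, A n.+1 `<` A n) ->
     ~ exists B, CC B /\ same_comp G B (A 0%N) /\ forall n, B `<=` A n) /\
  (forall A : nat -> set X, (forall n, CC (A n)) ->
     (forall n, A n `<` A n.+1) ->
     ~ exists B, CC B /\ same_comp G B (A 0%N) /\ forall n, B `&` A n = set0).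

Definition perp (G : set (X * X)) (A B : set X) : Prop :=
  A `&` B = set0 /\ A <> cstar G B.

Definition cut_sim (G : set (X * X)) (CC : set (set X)) (A B : set X) : Prop :=
  CC A /\ CC B /\ same_comp G A B /\
  (A = B \/ (perp G A B /\ ~ exists D, CC D /\ A `<` D /\ perp G D B)).

Definition borel_reducible_to_sim (G : set (X * X)) (CC : set (set X))
    (E' : set (X * X)) : Prop :=
  exists pi : X -> set X,
    (forall x, CC (pi x)) /\
    (forall S, borel_fin S -> measurable [set x | S (bdry G (pi x))]) /\
    (forall x y, E' (x, y) <-> cut_sim G CC (pi x) (pi y)).

Definition generated_equiv (E R : set (X * X)) : Prop :=
  equiv_rel E /\ R `<=` E /\
  forall F, equiv_rel F -> R `<=` F -> E `<=` F.

Definition free_product (E E1 E2 : set (X * X)) : Prop :=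
  generated_equiv E (E1 `|` E2) /\
  ~ exists (n : nat) (x : nat -> X), (1 <= n)%N /\ x (2 * n)%N = x 0%N /\
      (forall i, (i < 2 * n)%N -> x i <> x i.+1) /\
      (forall i, (i < 2 * n)%N -> ~~ odd i -> E1 (x i, x i.+1)) /\
      (forall i, (i < 2 * n)%N -> odd i -> E2 (x i, x i.+1)).

End Defs.

(* Main.v *)
From Stdlib Require Import Relations.
Require Import Defs.
From mathcomp Require Import all_boot all_order all_algebra.
From mathcomp Require Import all_classical all_reals all_analysis.
From mathcomp Require Import Rstruct Rstruct_topology.
From mathcomp Require Import measurable_realfun zify.

(** The cuts of one component are the oriented edges of a tree: nestedness makes [cut_sim]
    an equivalence relation, whose classes are the vertices, and chain-vanishing makes
    intervals of cuts finite, so that the tree is connected.  Using a Lusin--Novikov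
    enumeration of the classes of [E], a cut [pi x] is attached to every point [x] in a
    Borel way so that every vertex is either the class of some [pi x] or carries a
    Borel-selected base point.  Vertices of the second kind are merged, along a selected
    edge, with a neighbour closer to the range of [pi]; the remaining edges form a tree
    on the range of [pi], and each of them is lifted to a single pair of points of [X].
    These pairs generate [ET], and [EC] is the pull-back of [cut_sim] by [pi].  Each lifted
    edge is crossed by a wall, namely the side of its cut, which no other lifted edge and
    no [EC]-step crosses; this yields both acyclicity and freeness of the product. *)

Set Implicit Arguments.
Unset Strict Implicit.
Unset Printing Implicit Defensive.

Import Order.TTheory GRing.Theory Num.Theory.
Local Open Scope classical_set_scope.

(** * Analytic sets *)

(** The free product lives on [X] while the tree lives on [CC], and nothing ties points to vertices:
    a vertex may own no point, and no Borel choice of an edge at it need exist. The dichotomy behind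
    the construction comes from counting names. A cut is named by a finite code read at a base
    point; for each vertex and each code one looks at the base points from which that code names a
    cut at the vertex. If for some code this set is finite and nonempty, its least element is a
    canonical base point, from which an edge can be chosen in a Borel way. Otherwise some code has
    an infinite set of such base points, which is room enough for [pi] to hit the vertex. The
    difficulty is to serve countably many codes at once with a single map on [X]; a matching
    argument inside the [E]-classes resolves it. Borelness throughout rests on turning quantifiers
    over points or cuts of a class into quantifiers over countable types, which is why an
    enumeration of the classes is established before any combinatorics. *)

Definition agree (n : nat) (a b : nat -> nat) := forall i, (i < n)%N -> a i = b i.

Definition bclosed (F : set (nat -> nat)) :=
  forall a, (forall n, exists2 b, F b & agree n a b) -> F a.

Lemma agreeW n m a b : (n <= m)%N -> agree m a b -> agree n a b.
Proof. by move=> nm ab i /leq_trans-/(_ _ nm)/ab. Qed.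

Lemma agree_sym n a b : agree n a b -> agree n b a.
Proof. by move=> ab i /ab. Qed.

(** One sequence carries countably many through the coding of pairs: [sub] extracts them and [join]
    merges them, so that a single code can stand for a sequence of codes. *)
Definition sub (a : nat -> nat) (n : nat) : nat -> nat := fun i => a (pickle (n, i)).

Definition join (f : nat -> nat -> nat) : nat -> nat :=
  fun k => if unpickle k is Some (n, i) then f n i else 0%N.

Lemma sub_join f n : sub (join f) n = f n.
Proof. by apply/funext => i; rewrite /sub /join pickleK. Qed.

Lemma agree_sub n m : exists M, forall a b, agree M a b -> agree m (sub a n) (sub b n).
Proof.
exists (\max_(i < m) pickle (n, val i)).+1 => a b ab i im.
apply: ab; rewrite ltnS.
exact: (@leq_bigmax _ (fun i : 'I_m => pickle (n, val i)) (Ordinal im)).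
Qed.

Definition cyl (s : seq nat) : set (nat -> nat) := [set b | mkseq b (size s) = s].

Lemma cyl_agree s a b : cyl s a -> agree (size s) a b -> cyl s b.
Proof.
rewrite /cyl /= => sa ab; rewrite -[RHS]sa; apply/eq_in_map => i.
by rewrite mem_iota add0n => /andP[_ /ab].
Qed.

Lemma cyl_mkseq a n : cyl (mkseq a n) a.
Proof. by rewrite /cyl /= size_mkseq. Qed.

Lemma cyl_mkseq_agree a n b : cyl (mkseq a n) b -> agree n a b.
Proof.
rewrite /cyl /= size_mkseq => ab i ni.
by rewrite -(nth_mkseq 0%N a ni) -ab nth_mkseq.
Qed.

Lemma prefix_mkseq s a n : cyl s a -> (size s <= n)%N -> prefix s (mkseq a n).
Proof.
rewrite /cyl /= => sa sn; apply/prefixP.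
exists (map a (iota (size s) (n - size s))).
by rewrite -[X in X ++ _]sa /mkseq -map_cat -iotaD subnKC.
Qed.

Lemma prefix_cyl s t a : prefix s t -> cyl t a -> cyl s a.
Proof.
move=> /prefixP[u ->]; rewrite /cyl /= size_cat /mkseq iotaD map_cat.
by move/eqP; rewrite eqseq_cat ?size_map ?size_iota// => /andP[/eqP].
Qed.

Lemma cyl_chain (s : nat -> seq nat) :
  (forall n, prefix (s n) (s n.+1)) -> (forall n, (n <= size (s n))%N) ->
  exists a, forall n, cyl (s n) a.
Proof.
move=> ps ss; exists (fun i => nth 0%N (s i.+1) i) => n.
have pre m k : prefix (s m) (s (k + m)%N).
  elim: k => [|k ih]; first exact: prefix_refl.
  by rewrite addSn; apply: prefix_trans ih (ps _).
have nthe m k i : (i < size (s m))%N -> (i < size (s k))%N ->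
    nth 0%N (s m) i = nth 0%N (s k) i.
  wlog mk : m k / (m <= k)%N => [hw im ik|im ik].
    by have [mk|/ltnW mk] := leqP m k; [exact: hw|symmetry; exact: hw].
  have /prefixP[u e] := pre m (k - m)%N.
  by rewrite subnK // in e; rewrite e nth_cat im.
rewrite /cyl /=; apply: (@eq_from_nth _ 0%N); rewrite size_mkseq // => i isn.
by rewrite nth_mkseq //; apply: nthe => //; exact: ss.
Qed.

Lemma bclosed_cyl F (s : nat -> seq nat) a : bclosed F ->
  (forall n, (n <= size (s n))%N) -> (forall n, cyl (s n) a) ->
  (forall n, exists2 b, F b & cyl (s n) b) -> F a.
Proof.
move=> cF ss sa Fs; apply: cF => n; have [b Fb sb] := Fs n; exists b => //.
apply: agreeW (ss n) _.
have := sa n; rewrite /cyl /= => ea i.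
by apply: cyl_mkseq_agree; rewrite ea.
Qed.

Section Analytic.
Context {P I : Type} (U : I -> set P).

(** Continuity for the topology in which every [U i] is clopen. Working with the family [U] in place
    of a topology on [P] lets the same definition serve the reals, [X] and [X * X]. *)
Definition lcont (F : set (nat -> nat)) (g : (nat -> nat) -> P) :=
  forall a i, F a -> exists m, forall b, F b -> agree m a b -> (U i (g a) <-> U i (g b)).

Definition analytic (A : set P) :=
  exists F g, [/\ bclosed F, lcont F g & A = g @` F].

Definition separating := forall x y, (forall i, U i x <-> U i y) -> x = y.

Lemma analytic_clopen (W : set P) A :
  (forall F g a, lcont F g -> F a ->
    exists m, forall b, F b -> agree m a b -> (W (g a) <-> W (g b))) ->
  analytic A -> analytic (A `&` W).
Proof.
move=> hW [F [g [cF lg ->]]]; exists (F `&` (g @^-1` W)), g; split.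
- move=> a ha.
  have Fa : F a by apply: cF => n; have [b [Fb _] ab] := ha n; exists b.
  split=> //=.
  have [m hm] := hW F g a lg Fa.
  by have [b [Fb Wb] ab] := ha m; apply/(hm b).
- move=> a i [Fa _]; have [m hm] := lg a i Fa.
  by exists m => b [Fb _]; exact: hm.
- apply/seteqP; split=> [_ [[a Fa <-] Wa]|_ [a [Fa Wa] <-]].
    by exists a.
  by split=> //; exists a.
Qed.

Lemma analytic_pos A i : analytic A -> analytic (A `&` U i).
Proof. by apply: analytic_clopen => F g a lg Fa; exact: lg. Qed.

Lemma analytic_neg A i : analytic A -> analytic (A `&` ~` U i).
Proof.
apply: analytic_clopen => F g a lg Fa; have [m hm] := lg a i Fa.
by exists m => b Fb ab; split; apply: contra_not; apply hm.
Qed.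

Lemma analytic_bigcup (A : nat -> set P) :
  (forall n, analytic (A n)) -> analytic (\bigcup_n A n).
Proof.
move=> /choice[F] /choice[g] h.
have hc n : bclosed (F n) by have [] := h n.
have hl n : lcont (F n) (g n) by have [] := h n.
have he n : A n = g n @` F n by have [] := h n.
pose sh (a : nat -> nat) i := a i.+1.
exists [set a | F (a 0%N) (sh a)], (fun a => g (a 0%N) (sh a)); split.
- move=> a ha /=; apply: hc => n; have [b Fb ab] := ha n.+1.
  exists (sh b); last by move=> i ni; exact: ab.
  by rewrite (ab 0%N).
- move=> a i Fa; have [m hm] := hl _ _ i Fa.
  exists m.+1 => b Fb ab; rewrite -(ab 0%N)//; apply: hm.
    by rewrite (ab 0%N).
  by move=> j jm; exact: ab.
- apply/seteqP; split=> [p [n _]|_ [a Fa <-]].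
    rewrite he => -[a Fa <-].
    by exists (fun i => if i is j.+1 then a j else n).
  by exists (a 0%N) => //; rewrite he; exists (sh a).
Qed.

Hypothesis sepU : separating.

(** A point of the intersection is coded by a sequence of codes, one for each [A n], with equal
    values. Equality of values is a closed condition because [U] separates points and each [U i] is
    decided by finitely many terms of a code. *)
Lemma analytic_bigcap (A : nat -> set P) :
  (forall n, analytic (A n)) -> analytic (\bigcap_n A n).
Proof.
move=> /choice[F] /choice[g] h.
have hc n : bclosed (F n) by have [] := h n.
have hl n : lcont (F n) (g n) by have [] := h n.
have he n : A n = g n @` F n by have [] := h n.
exists [set a | forall n, F n (sub a n) /\ g n (sub a n) = g 0%N (sub a 0%N)].
exists (fun a => g 0%N (sub a 0%N)); split.
- move=> a ha n.
  have Fa k : F k (sub a k).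
    apply: hc => m; have [M hM] := agree_sub k m.
    have [b hb ab] := ha M; exists (sub b k); first by have [] := hb k.
    exact: hM.
  split=> //; apply: sepU => i.
  have [m hm] := hl n _ i (Fa n).
  have [m0 hm0] := hl 0%N _ i (Fa 0%N).
  have [M hM] := agree_sub n m; have [M0 hM0] := agree_sub 0%N m0.
  have [b hb ab] := ha (maxn M M0).
  have [Fb eb] := hb n; have [F0 _] := hb 0%N.
  rewrite (hm _ Fb); last by apply: hM; apply: agreeW ab; exact: leq_maxl.
  rewrite (hm0 _ F0); last by apply: hM0; apply: agreeW ab; exact: leq_maxr.
  by rewrite eb.
- move=> a i ha; have [F0 _] := ha 0%N; have [m hm] := hl _ _ i F0.
  have [M hM] := agree_sub 0%N m; exists M => b hb ab; apply: hm; last exact: hM.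
  by have [] := hb 0%N.
- apply/seteqP; split=> [p hp|_ [a ha <-] n _].
    have {}hp n : exists a, F n a /\ g n a = p.
      by have := hp n Logic.I; rewrite he => -[a Fa <-]; exists a.
    have [f hf] := choice hp.
    exists (join f) => [n|]; rewrite ?sub_join; last by have [] := hf 0%N.
    by have [? ->] := hf n; have [_ ->] := hf 0%N.
  by rewrite he; have [Fa <-] := ha n; exists (sub a n).
Qed.

Lemma analyticI A B : analytic A -> analytic B -> analytic (A `&` B).
Proof.
move=> hA hB; rewrite (_ : _ `&` _ = \bigcap_n (if n is 0%N then A else B)).
  by apply: analytic_bigcap => -[|n].
apply/seteqP; split=> [p [Ap Bp] [|n] _ //|p h].
by split; [exact: (h 0%N)|exact: (h 1%N)].
Qed.

Definition bianalytic (A : set P) := analytic A /\ analytic (~` A).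

Lemma bianalytic_U i : analytic setT -> bianalytic (U i).
Proof.
by move=> hT; split; [rewrite -[U i]setTI; exact: analytic_pos
  |rewrite -[~` _]setTI; exact: analytic_neg].
Qed.

(** Complements exchange the two halves, and countable unions and intersections preserve
    analyticity. This is how Borel sets are shown to be analytic. *)
Lemma bianalytic_sigma : analytic set0 -> analytic setT ->
  sigma_algebra setT bianalytic.
Proof.
move=> h0 hT; split.
- by split=> //; rewrite setC0.
- by move=> A [hA hA']; rewrite setTD; split=> //; rewrite setCK.
- move=> A hA; split; first by apply: analytic_bigcup => n; have [] := hA n.
  by rewrite setC_bigcup; apply: analytic_bigcap => n; have [] := hA n.
Qed.

Lemma analytic0 : analytic setT -> analytic set0.
Proof.
move=> [F [g [_ _ _]]]; exists set0, g; split=> //; last by rewrite image_set0.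
by move=> a /(_ 0%N)[b].
Qed.

Lemma analytic_cyl F g s : bclosed F -> lcont F g -> analytic (g @` (F `&` cyl s)).
Proof.
move=> cF lg; exists (F `&` cyl s), g; split=> //.
- move=> a ha; split.
    by apply: cF => n; have [b [Fb _] ab] := ha n; exists b.
  by have [b [_ sb] ab] := ha (size s); apply: cyl_agree sb (agree_sym ab).
- move=> a i [Fa _]; have [m hm] := lg a i Fa.
  by exists m => b [Fb _]; exact: hm.
Qed.

End Analytic.

(** * Lusin separation of disjoint analytic sets *)

Section Separation.
Context d (X : measurableType d) (I : Type) (U : I -> set X).
Hypothesis sepU : separating U.
Hypothesis mU : forall i, measurable (U i).

Definition msep (A B : set X) :=
  exists S, [/\ measurable S, A `<=` S & B `&` S = set0].

Lemma msep_bigcup (A B : nat -> set X) :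
  (forall i j, msep (A i) (B j)) -> msep (\bigcup_i A i) (\bigcup_j B j).
Proof.
move=> h; have /choice[S hS] : forall ij : nat * nat, exists S : set X,
    [/\ measurable S, A ij.1 `<=` S & B ij.2 `&` S = set0].
  by move=> -[i j]; exact: h.
exists (\bigcup_i \bigcap_j S (i, j)); split.
- apply: bigcupT_measurable => i; apply: bigcapT_measurable => j.
  by have [] := hS (i, j).
- move=> x [i _ Ax]; exists i => // j _; have [_ + _] := hS (i, j); exact.
- apply/seteqP; split=> // x [[j _ Bx] [i _ /(_ j Logic.I) Sx]].
  by have [_ _ <-] := hS (i, j).
Qed.

(** If no Borel set separates, [msep_bigcup] lets both sides be refined forever to longer cylinders
    that are still not separated. The limit codes have distinct values, some [U i] tells them apart,
    and by continuity that [U i] or its complement separates the images of all deep enough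
    cylinders. *)
Lemma lusin_separation A B : analytic U A -> analytic U B -> A `&` B = set0 -> msep A B.
Proof.
move=> [F [g [cF lg ->]]] [H [h [cH lh ->]]] dAB.
pose FA s := g @` (F `&` cyl s); pose HB s := h @` (H `&` cyl s).
apply: contrapT => nsep.
pose Q (st : seq nat * seq nat) := ~ msep (FA st.1) (HB st.2).
have unf F' (g' : _ -> X) s :
    g' @` (F' `&` cyl s) = \bigcup_i (g' @` (F' `&` cyl (rcons s i))).
  apply/seteqP; split=> [_ [a [Fa sa] <-]|_ [i _ [a [Fa sa] <-]]].
    exists (a (size s)) => //; exists a => //; split=> //.
    by rewrite /cyl /= size_rcons mkseqS sa.
  by exists a => //; split=> //; apply: prefix_cyl sa; exact: prefix_rcons.
have step (x : {st | Q st}) : {y : {st | Q st} | exists ij,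
    sval y = (rcons (sval x).1 ij.1, rcons (sval x).2 ij.2)}.
  apply: cid; case: x => -[s t] /= nst; apply: contrapT => hn; apply: nst.
  rewrite /FA /HB (unf F) (unf H); apply: msep_bigcup => i j.
  apply: contrapT => hij; apply: hn.
  have q : Q (rcons s i, rcons t j) by [].
  by exists (exist _ _ q), (i, j).
have Q0 : Q ([::], [::]).
  move=> ss; apply: nsep; move: ss; rewrite /FA /HB /=.
  by rewrite (_ : cyl [::] = setT) ?setIT //; apply/seteqP; split.
have [f [f0 fS]] := dependent_choice step (exist _ _ Q0).
pose s n := (sval (f n)).1; pose t n := (sval (f n)).2.
have sS n : exists i, s n.+1 = rcons (s n) i.
  by have [ij e] := fS n; exists ij.1; rewrite /s e.
have tS n : exists i, t n.+1 = rcons (t n) i.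
  by have [ij e] := fS n; exists ij.2; rewrite /t e.
have ss n : size (s n) = n.
  by elim: n => [|n ih]; rewrite /s ?f0//; have [i e] := sS n; rewrite /s in e ih *; rewrite e size_rcons ih.
have st n : size (t n) = n.
  by elim: n => [|n ih]; rewrite /t ?f0//; have [i e] := tS n; rewrite /t in e ih *; rewrite e size_rcons ih.
have [a sa] : exists a, forall n, cyl (s n) a.
  apply: cyl_chain => n; last by rewrite ss.
  by have [i ->] := sS n; exact: prefix_rcons.
have [b tb] : exists a, forall n, cyl (t n) a.
  apply: cyl_chain => n; last by rewrite st.
  by have [i ->] := tS n; exact: prefix_rcons.
have nsn n : ~ msep (FA (s n)) (HB (t n)) by exact: (svalP (f n)).
have Fa : F a.
  apply: (bclosed_cyl cF _ sa) => n; first by rewrite ss.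
  apply: contrapT => hn; apply: (nsn n); exists set0; split=> //; last by rewrite setI0.
  by move=> x [c [Fc sc] _]; case: hn; exists c.
have Hb : H b.
  apply: (bclosed_cyl cH _ tb) => n; first by rewrite st.
  apply: contrapT => hn; apply: (nsn n); exists setT; split=> //.
  by apply/seteqP; split=> // x [[c [Fc sc] _] _]; case: hn; exists c.
have agr (u : nat -> seq nat) c n e : (forall n, size (u n) = n) ->
   (forall n, cyl (u n) c) -> cyl (u n) e -> agree n c e.
  move=> su uc ue i ni; have := uc n; rewrite /cyl /= su => ec.
  by apply: cyl_mkseq_agree ni; rewrite ec.
have : g a <> h b.
  by move=> e; have : set0 (g a) by rewrite -dAB; split; [exists a|rewrite e; exists b].
apply; apply: sepU => i.
have [m hm] := lg a i Fa; have [m' hm'] := lh b i Hb.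
pose M := maxn m m'.
have gM c : F c -> cyl (s M) c -> (U i (g a) <-> U i (g c)).
  by move=> Fc sc; apply: hm => //; apply: agreeW (leq_maxl m m') _; exact: agr sc.
have hM c : H c -> cyl (t M) c -> (U i (h b) <-> U i (h c)).
  by move=> Fc sc; apply: hm' => //; apply: agreeW (leq_maxr m m') _; exact: agr sc.
split=> [ua|ub]; apply: contrapT => nu; apply: (nsn M).
  exists (U i); split=> //.
    by move=> _ [c [Fc sc] <-]; apply/gM.
  by apply/seteqP; split=> // _ [[c [Hc tc] <-] uc]; apply: nu; apply/hM; eauto.
exists (~` U i); split=> //; first exact: measurableC.
  by move=> _ [c [Fc sc] <-] /gM; auto.
apply/seteqP; split=> // _ [[c [Hc tc] <-] uc]; apply: uc.
by apply/(hM _ Hc tc).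
Qed.

End Separation.

(** * The Lusin--Novikov theorem *)

Section MeasurablePred.
Context d (T : measurableType d).
Implicit Types P Q : T -> Prop.

Definition mp P := measurable [set x | P x].

Lemma mp_ext P Q : (forall x, P x <-> Q x) -> mp P -> mp Q.
Proof.
by move=> PQ; rewrite /mp (_ : [set x | P x] = [set x | Q x])//; apply/seteqP;
  split=> x /PQ.
Qed.

Lemma mp_const (p : Prop) : mp (fun=> p).
Proof.
have [hp|hp] := pselect p; rewrite /mp.
  by rewrite (_ : mkset _ = setT)//; apply/seteqP; split.
by rewrite (_ : mkset _ = set0)//; apply/seteqP; split.
Qed.

Lemma mp_and P Q : mp P -> mp Q -> mp (fun x => P x /\ Q x).
Proof. exact: measurableI. Qed.

Lemma mp_or P Q : mp P -> mp Q -> mp (fun x => P x \/ Q x).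
Proof. exact: measurableU. Qed.

Lemma mp_not P : mp P -> mp (fun x => ~ P x).
Proof. exact: measurableC. Qed.

Lemma mp_imp P Q : mp P -> mp Q -> mp (fun x => P x -> Q x).
Proof.
move=> hP hQ; apply: mp_ext (mp_or (mp_not hP) hQ) => x; split.
  by case=> // ? /[swap].
by move=> h; have [/h|] := pselect (P x); [right|left].
Qed.

Lemma mp_iff P Q : mp P -> mp Q -> mp (fun x => P x <-> Q x).
Proof. by move=> hP hQ; apply: mp_and; exact: mp_imp. Qed.

Lemma mp_ex (K : countType) (P : K -> T -> Prop) :
  (forall k, mp (P k)) -> mp (fun x => exists k, P k x).
Proof.
move=> hP; rewrite /mp (_ : mkset _ = \bigcup_k [set x | P k x]).
  by apply: countable_bigcupT_measurable => //; exact: countableP.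
by apply/seteqP; split=> x [k]; [move=> h; exists k|move=> _ h; exists k].
Qed.

Lemma mp_all (K : countType) (P : K -> T -> Prop) :
  (forall k, mp (P k)) -> mp (fun x => forall k, P k x).
Proof.
move=> hP; apply: (@mp_ext (fun x => ~ exists k, ~ P k x)).
  move=> x; split; last by move=> h [k]; apply.
  by move=> h k; apply: contrapT => n; apply: h; exists k.
by apply: mp_not; apply: mp_ex => k; exact: mp_not.
Qed.

End MeasurablePred.

Lemma mp_pre d d' (T : measurableType d) (T' : measurableType d') (f : T' -> T)
  (P : T -> Prop) : measurable_fun setT f -> mp P -> mp (fun x => P (f x)).
Proof. by move=> mf hP; rewrite /mp -[X in measurable X]setTI; exact: mf. Qed.

Section LusinNovikov.
Context d (X : measurableType d) (U : nat -> set X).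
Hypothesis sepU : separating U.
Hypothesis mU : forall n, measurable (U n).
Hypothesis UT : analytic U setT.
Hypothesis Um : forall A, measurable A -> analytic U A.

Definition UU (i : nat + nat) : set (X * X) :=
  match i with inl n => [set p | U n p.1] | inr n => [set p | U n p.2] end.

Lemma sepUU : separating UU.
Proof.
move=> [x y] [x' y'] h; congr pair; apply: sepU => n.
  exact: (h (inl n)).
exact: (h (inr n)).
Qed.

Lemma analytic_setX (A B : set X) : analytic U A -> analytic U B -> analytic UU (A `*` B).
Proof.
move=> [F [g [cF lg ->]]] [H [h [cH lh ->]]].
exists [set a | F (sub a 0%N) /\ H (sub a 1%N)].
exists (fun a => (g (sub a 0%N), h (sub a 1%N))); split.
- move=> a ha; split.
    apply: cF => m; have [M hM] := agree_sub 0 m.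
    have [b [Fb _] ab] := ha M; exists (sub b 0%N) => //; exact: hM.
  apply: cH => m; have [M hM] := agree_sub 1 m.
  have [b [_ Fb] ab] := ha M; exists (sub b 1%N) => //; exact: hM.
- move=> a [] i [Fa Ha].
    have [m hm] := lg _ i Fa; have [M hM] := agree_sub 0 m.
    by exists M => b [Fb Hb] ab; apply: hm => //; exact: hM.
  have [m hm] := lh _ i Ha; have [M hM] := agree_sub 1 m.
  by exists M => b [Fb Hb] ab; apply: hm => //; exact: hM.
- apply/seteqP; split=> [[_ _] /= [[a Fa <-] [b Hb <-]]|_ [a [Fa Ha] <-]].
    by exists (join (fun i => if i is 0%N then a else b)); rewrite ?sub_join.
  by split=> /=; [exists (sub a 0%N)|exists (sub a 1%N)].
Qed.

Lemma analytic_fst A : analytic UU A -> analytic U (fst @` A).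
Proof.
move=> [F [g [cF lg ->]]]; exists F, (fst \o g); split=> //.
- by move=> a n Fa; exact: (lg a (inl n) Fa).
- by rewrite image_comp.
Qed.

Lemma analytic_measurable2 (A : set (X * X)) : measurable A -> analytic UU A.
Proof.
have T2 : analytic UU setT by rewrite -setXTT; exact: analytic_setX.
rewrite measurable_prod_measurableType => mA.
suff : bianalytic UU A by case.
move: A mA; apply: smallest_sub; last first.
  move=> _ [A mA [B mB <-]].
  rewrite (_ : A `*` B = (A `*` setT) `&` (setT `*` B)); last first.
    by apply/seteqP; split=> -[x y] /=; tauto.
  split.
    by apply: (analyticI sepUU) => //; apply: analytic_setX => //; exact: Um.
  rewrite setCI (_ : _ `|` _ = \bigcup_n (if n is 0%N then (~` A) `*` setT else
    setT `*` (~` B))); last first.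
    apply/seteqP; split=> -[x y] /=.
      by move=> [h|h]; [exists 0%N|exists 1%N] => //=; split=> //; move: h; tauto.
    by move=> [[|n] _ /=]; tauto.
  by apply: analytic_bigcup => -[|n]; apply: analytic_setX => //; apply: Um;
    exact: measurableC.
by apply: bianalytic_sigma => //; [exact: sepUU|exact: analytic0].
Qed.

(** Graph of the partial function sending [x] to the point whose membership in each [U n] is
    dictated by [Q n]; it is single-valued because [U] separates points. *)
Definition bgraph (Q : nat -> set X) : set (X * X) :=
  [set p | forall n, Q n p.1 <-> U n p.2].

Lemma measurable_bgraph Q : (forall n, measurable (Q n)) -> measurable (bgraph Q).
Proof.
move=> mQ; rewrite -/(mp (fun p : X * X => forall n, Q n p.1 <-> U n p.2)).
apply: mp_all => n; apply: mp_iff.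
  exact: (mp_pre (P := Q n) measurable_fst (mQ n)).
exact: (mp_pre (P := U n) measurable_snd (mU n)).
Qed.

(* Separating, for each n, the points whose section lies in U n from those whose
   section avoids it encodes the partial function by its coordinates. *)
Lemma analytic_partial_function A : analytic UU A ->
  (forall x y y', A (x, y) -> A (x, y') -> y = y') ->
  exists Q, (forall n, measurable (Q n)) /\ A `<=` bgraph Q.
Proof.
move=> aA fA.
have /choice[Q hQ] : forall n, exists Q, [/\ measurable Q,
    fst @` (A `&` UU (inr n)) `<=` Q & fst @` (A `&` ~` UU (inr n)) `&` Q = set0].
  move=> n; apply: (lusin_separation sepU mU).
  - by apply: analytic_fst; exact: analytic_pos.
  - by apply: analytic_fst; exact: analytic_neg.
  - apply/seteqP; split=> // x [[[x1 y] [/= Ay Uy] /= <-] [[x2 y'] [/= Ay' Uy'] /= e]].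
    by rewrite e in Ay'; apply: Uy'; rewrite -(fA _ _ _ Ay Ay').
exists Q; split=> [n|[x y] Axy n /=]; have [mQ hp hn] := hQ n => //.
split=> [Qx|Uy]; last by apply: hp; exists (x, y).
apply: contrapT => nUy; suff : set0 x by [].
by rewrite -hn; split=> //; exists (x, y).
Qed.

Definition covered (Q : nat -> nat -> set X) : set (X * X) := \bigcup_m bgraph (Q m).

Definition mfam (Q : nat -> nat -> set X) := forall m n, measurable (Q m n).

Lemma measurable_covered Q : mfam Q -> measurable (covered Q).
Proof. by move=> mQ; apply: bigcupT_measurable => m; exact: measurable_bgraph. Qed.

Lemma covered_bigcup (K : countType) (Q : K -> nat -> nat -> set X) :
  (forall k, mfam (Q k)) ->
  exists Q', mfam Q' /\ forall k, covered (Q k) `<=` covered Q'.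
Proof.
move=> mQ; exists (fun m => if (unpickle m : option (K * nat)) is Some (k, m') then Q k m'
  else fun=> set0); split.
  by move=> m n; case: (unpickle m) => // -[k m']; exact: mQ.
by move=> k p [m _ h]; exists (pickle (k, m)) => //; rewrite pickleK.
Qed.

(** * A perfect-set argument for analytic sets not covered by countably many Borel graphs *)

Section Cover.
Variable F : set (nat -> nat).
Variable g : (nat -> nat) -> X * X.
Hypothesis cF : bclosed F.
Hypothesis lg : lcont UU F g.

Let piece (Q : nat -> nat -> set X) s : set (X * X) :=
  (g @` (F `&` cyl s)) `&` ~` covered Q.

Let base Q (l : seq (seq nat)) : set X :=
  [set x | forall s, s \in l -> exists y, piece Q s (x, y)].

(** Largeness of a finite list of nodes: after the removal of any countable family of Borel graphs,
    some [x] still has a remaining point over it coming from every node. Having one [x] common to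
    all nodes is what later forces the limit points into a single section. *)
Let good (l : seq (seq nat)) := forall Q, mfam Q -> base Q l !=set0.

Let split_by s0 s1 := exists n,
  (forall a, F a -> cyl s0 a -> U n (g a).2) /\ (forall a, F a -> cyl s1 a -> ~ U n (g a).2).

Let splits s s0 s1 := [/\ prefix s s0, prefix s s1, (size s < size s0)%N,
  (size s < size s1)%N & split_by s0 s1 \/ split_by s1 s0].

Lemma analytic_piece Q s : mfam Q -> analytic UU (piece Q s).
Proof.
move=> mQ; apply: (analyticI sepUU); first exact: analytic_cyl.
by apply: analytic_measurable2; apply: measurableC; exact: measurable_covered.
Qed.

Lemma analytic_base Q l : mfam Q -> analytic U (base Q l).
Proof.
move=> mQ; elim: l => [|s l ih].
  by rewrite (_ : base Q [::] = setT)//; apply/seteqP; split.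
rewrite (_ : base Q (s :: l) = fst @` piece Q s `&` base Q l).
  by apply: (analyticI sepU) ih; apply: analytic_fst; exact: analytic_piece.
apply/seteqP; split=> [x h|x [[[x1 y] h /= <-] h'] t].
  split; last by move=> t tl; apply: h; rewrite inE tl orbT.
  by have [|y hy] := h s; [rewrite mem_head|exists (x, y)].
by rewrite inE => /orP[/eqP->|/h'//]; exists y.
Qed.

(** Otherwise every pair of nodes splitting [s] is defeated by some countable family of graphs, and
    the union of these families defeats all pairs. What then remains over [s] is single-valued,
    since two points over one [x] would be told apart by some [U n] and produce a splitting pair. By
    separation it lies in one more Borel graph, against the largeness of [s :: l]. *)
Lemma good_split s l : good (s :: l) ->
  exists s0 s1, splits s s0 s1 /\ good [:: s0, s1 & l].
Proof.
move=> gl; apply: contrapT => hn.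
have /choice[Q hQ] : forall st : seq nat * seq nat, exists Q, mfam Q /\
    (splits s st.1 st.2 -> base Q [:: st.1, st.2 & l] = set0).
  move=> [s0 s1] /=; have [sp|nsp] := pselect (splits s s0 s1); last first.
    by exists (fun _ _ => set0); split=> // ? ?.
  apply: contrapT => h; apply: hn; exists s0, s1; split=> // Q mQ.
  apply: contrapT => /set0P/negP; rewrite negbK => /eqP e; apply: h.
  by exists Q.
have [Q' [mQ' cQ']] := @covered_bigcup _ Q (fun st => (hQ st).1).
have bQ' s0 s1 x : splits s s0 s1 -> ~ base Q' [:: s0, s1 & l] x.
  move=> sp bx; suff : set0 x by [].
  rewrite -((hQ (s0, s1)).2 sp) => t tl; have [y [h nc]] := bx t tl; exists y; split=> //.
  by move=> c; apply: nc; apply: cQ' c.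
pose A := piece Q' s `&` (base Q' l `*` setT).
have aA : analytic UU A.
  apply: (analyticI sepUU); first exact: analytic_piece.
  by apply: analytic_setX => //; exact: analytic_base.
have fA x y y' : A (x, y) -> A (x, y') -> y = y'.
  move=> [[[a [Fa sa] ea] nc] [/= bx _]] [[[a' [Fa' sa'] ea'] nc'] _].
  apply: contrapT => yy'.
  have [n hn'] : exists n, ~ (U n y <-> U n y').
    apply: contrapT => h; apply: yy'; apply: sepU => n; apply: contrapT => h'.
    by apply: h; exists n.
  have [m hm] := lg (inr n) Fa; have [m' hm'] := lg (inr n) Fa'.
  pose M := maxn (maxn m m') (size s).+1.
  have sM : (size s < M)%N by rewrite leq_max ltnSn orbT.
  have mM : (m <= M)%N by rewrite !leq_max leqnn.
  have mM' : (m' <= M)%N by rewrite !leq_max leqnn orbT.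
  have hc b : F b -> cyl (mkseq a M) b -> (U n y <-> U n (g b).2).
    move=> Fb /cyl_mkseq_agree ab; have := hm b Fb (agreeW mM ab).
    by rewrite ea.
  have hc' b : F b -> cyl (mkseq a' M) b -> (U n y' <-> U n (g b).2).
    move=> Fb /cyl_mkseq_agree ab; have := hm' b Fb (agreeW mM' ab).
    by rewrite ea'.
  apply: (@bQ' (mkseq a M) (mkseq a' M) x).
    split; rewrite ?size_mkseq //; try (by apply: prefix_mkseq => //; exact: ltnW).
    have [uy|nuy] := pselect (U n y).
      have nuy' : ~ U n y' by move=> h; apply: hn'.
      by left; exists n; split=> b Fb sb; [apply/(hc b)|move/(hc' b Fb sb)].
    have uy' : U n y' by apply: contrapT => h; apply: hn'.
    by right; exists n; split=> b Fb sb; [apply/(hc' b)|move/(hc b Fb sb)].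
  move=> t; rewrite !inE => /or3P[/eqP->|/eqP->|/bx//].
    by exists y; split=> //; exists a => //; split=> //; exact: cyl_mkseq.
  by exists y'; split=> //; exists a' => //; split=> //; exact: cyl_mkseq.
have [R [mR AR]] := analytic_partial_function aA fA.
have [Q'' [mQ'' cQ'']] := @covered_bigcup bool (fun b => if b then Q' else fun=> R)
  (fun b => if b as b return mfam (if b then Q' else fun=> R) then mQ' else fun=> mR).
have [x bx] := gl Q'' mQ''.
have p t y : piece Q'' t (x, y) -> piece Q' t (x, y).
  by move=> [h nc]; split=> // c; apply: nc; exact: (cQ'' true).
have [y ps] := bx s (mem_head _ _).
have [_] := ps; apply; apply: (cQ'' false); exists 0%N => //; apply: AR; split; first exact: p.
split=> // t tl; have [|y' /p] := bx t; first by rewrite inE tl orbT.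
by exists y'.
Qed.

Let next l l' := size l' = (size l).*2 /\ forall i, (i < size l)%N ->
  splits (nth [::] l i) (nth [::] l' i.*2) (nth [::] l' i.*2.+1).

Lemma good_perm l l' : l =i l' -> good l -> good l'.
Proof.
by move=> ll gl Q mQ; have [x bx] := gl Q mQ; exists x => s; rewrite -ll => /bx.
Qed.

(** [r] accumulates the children of the nodes already split while the induction runs through [l]. *)
Lemma good_next l r : good (l ++ r) -> exists l', next l l' /\ good (l' ++ r).
Proof.
elim: l r => [|s l ih] r gl; first by exists [::].
have [s0 [s1 [sp]]] := good_split gl.
move=> /(@good_perm _ (l ++ [:: s0, s1 & r])) -/(_ _)/ih[].
  by move=> t; rewrite !inE !mem_cat !inE; do !case: (_ == _) => //=; rewrite ?orbT // orbA.
move=> l' [[sl nl] gl']; exists [:: s0, s1 & l']; split.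
  split; first by rewrite /= sl.
  move=> [|i] il; first exact: sp.
  exact: nl.
apply: good_perm gl' => t; rewrite !inE !mem_cat !inE.
by do !case: (_ == _) => //=; rewrite ?orbT.
Qed.

(** Splitting forever gives a Cantor scheme: the limit codes [br b] have distinct second
    coordinates, and the same first coordinate because each level has a common base point and first
    coordinates vary continuously. One section would thus contain a copy of [nat -> bool]. *)
Lemma not_good : (forall x, countable [set y | (g @` F) (x, y)]) -> ~ good [:: [::]].
Proof.
move=> cP g0.
have step (x : {l | good l}) : {y : {l | good l} | next (sval x) (sval y)}.
  apply: cid; case: x => l gl /=; have [|l' [nl]] := @good_next l [::].
    by rewrite cats0.
  by rewrite cats0 => gl'; exists (exist _ _ gl').
have [f [f0 fS]] := dependent_choice step (exist _ _ g0).
pose L n := sval (f n).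
have L0 : L 0%N = [:: [::]] by rewrite /L f0.
have LS n : next (L n) (L n.+1) by exact: fS.
have sL n : size (L n) = (2 ^ n)%N.
  elim: n => [|n ih]; first by rewrite L0.
  by have [-> _] := LS n; rewrite ih expnS mul2n.
(* Position in level [n] of the node on the branch [b]; the children of node [i] sit at [2i] and
   [2i+1]. *)
pose fix idx (b : nat -> bool) n := if n is k.+1 then (b k + (idx b k).*2)%N else 0%N.
have idxL b n : (idx b n < size (L n))%N.
  rewrite sL; elim: n => //= n ih; rewrite expnS mul2n -!addnn.
  by case: (b n); lia.
pose node b n := nth [::] (L n) (idx b n).
have nodeS b n : prefix (node b n) (node b n.+1) /\ (size (node b n) < size (node b n.+1))%N.
  have [_ /(_ _ (idxL b n))[]] := LS n.
  by rewrite /node /=; case: (b n).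
have sn b n : (n <= size (node b n))%N.
  by elim: n => // n ih; apply: leq_ltn_trans ih _; have [] := nodeS b n.
have /choice[br hbr] : forall b, exists a, forall n, cyl (node b n) a.
  by move=> b; apply: cyl_chain => n //; have [] := nodeS b n.
have wit n : exists x, forall b, exists a, [/\ F a, cyl (node b n) a & (g a).1 = x].
  have mQ0 : mfam (fun _ _ => set0) by [].
  have [x bx] := svalP (f n) _ mQ0.
  exists x => b; have [|y [[a [Fa sa] ga] _]] := bx (node b n); first exact: mem_nth.
  by exists a; rewrite ga.
have Fbr b : F (br b).
  apply: (bclosed_cyl cF (sn b) (hbr b)) => n; have [x hx] := wit n.
  by have [a [Fa sa _]] := hx b; exists a.
have agr b n a : cyl (node b n) a -> agree n (br b) a.
  move=> ha; apply: agreeW (sn b n) _; have := hbr b n; rewrite /cyl /= => e i.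
  by apply: cyl_mkseq_agree; rewrite e.
have same b b' : (g (br b)).1 = (g (br b')).1.
  apply: sepU => k.
  have [m hm] := lg (inl k) (Fbr b); have [m' hm'] := lg (inl k) (Fbr b').
  have [x hx] := wit (maxn m m').
  have [a [Fa sa ea]] := hx b; have [a' [Fa' sa' ea']] := hx b'.
  have /= -> := hm a Fa (agreeW (leq_maxl _ _) (agr _ _ _ sa)).
  have /= -> := hm' a' Fa' (agreeW (leq_maxr _ _) (agr _ _ _ sa')).
  by rewrite ea ea'.
have diff b b' n : (forall i, (i < n)%N -> b i = b' i) -> b n <> b' n -> 
    (g (br b)).2 <> (g (br b')).2.
  move=> bb' nbb'.
  have ei : idx b n = idx b' n.
    elim: n bb' {nbb'} => //= n ih bb'; rewrite bb' // ih // => i ni.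
    by apply: bb'; exact: ltnW.
  have sp : split_by (node b n.+1) (node b' n.+1) \/ split_by (node b' n.+1) (node b n.+1).
    have [_ /(_ _ (idxL b n))[_ _ _ _]] := LS n.
    rewrite /node /= -ei; move: nbb'; case: (b n); case: (b' n) => nb; rewrite /= ?add0n ?add1n;
      (try by case: nb); by case; auto.
  case: sp => -[k [h1 h2]] e.
    by apply: (h2 _ (Fbr b') (hbr b' _)); rewrite -e; exact: h1.
  by apply: (h2 _ (Fbr b) (hbr b _)); rewrite e; exact: h1.
have /countable_injP[c ic] := cP (g (br (fun=> false))).1.
pose h b := c (g (br b)).2.
have hin b : (g (br b)).2 \in [set y | (g @` F) ((g (br (fun=> false))).1, y)].
  by rewrite inE /=; exists (br b) => //; rewrite (same _ b); case: (g (br b)).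
have hinj b b' : h b = h b' -> b = b'.
  move=> /ic -/(_ (hin b) (hin b')) e; apply: contrapT => bb'.
  have ex : exists n, b n != b' n.
    apply: contrapT => hn; apply: bb'; apply/funext => n; apply/eqP.
    by apply: contrapT => /negP hh; apply: hn; exists n.
  case: (ex_minnP ex) => n /eqP nb mn; apply: (diff b b' n) nb e => i ni.
  by apply/eqP; apply: contraLR ni => /mn; rewrite -leqNgt.
(* Cantor's diagonal sequence, against the injection [h] into [nat]. *)
pose D n := `[< exists b, h b = n /\ b n = false >].
have [Dh|Dh] := boolP (D (h D)).
  move: (Dh) => /asboolP[b [/hinj -> ]]; by rewrite Dh.
by move/negP: (Dh); apply; apply/asboolP; exists D; split=> //; exact/negbTE.
Qed.

End Cover.

(** Failure of largeness at the root means that some countable family of graphs leaves nothing of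
    [P] uncovered. *)
Theorem lusin_novikov (P : set (X * X)) : measurable P ->
  (forall x, countable [set y | P (x, y)]) -> exists Q, mfam Q /\ P `<=` covered Q.
Proof.
move=> mP cP; have [F [g [cF lg eP]]] := analytic_measurable2 mP.
rewrite eP in cP.
have : ~ (forall Q, mfam Q -> [set x | forall s, s \in [:: [::]] ->
    exists y, ((g @` (F `&` cyl s)) `&` ~` covered Q) (x, y)] !=set0).
  exact: (not_good cF lg cP).
apply: contra_notP => hn Q mQ; apply: contrapT => h; apply: hn; exists Q; split=> //.
move=> [x y]; rewrite eP => -[a Fa ea]; apply: contrapT => nc; apply: h; exists x => s.
by rewrite inE => /eqP->; exists y; split=> //; exists a.
Qed.

End LusinNovikov.

(** * Standard Borel spaces *)

Section RationalRays.
Local Open Scope ring_scope.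
Context (R : realType).

Definition nth_rat (n : nat) : R := ratr (odflt 0 (unpickle n : option rat)).

Definition ray (n : nat) : set R := [set r | nth_rat n < r].

Lemma nth_rat_dense (x y : R) : x < y -> exists n, x < nth_rat n < y.
Proof.
move=> /rat_in_itvoo[q]; rewrite in_itv /= => h.
by exists (pickle q); rewrite /nth_rat pickleK.
Qed.

Lemma ray_separating : separating ray.
Proof.
move=> x y h; apply/eqP; rewrite eq_le !leNgt; apply/andP; split; apply/negP.
  by move=> /nth_rat_dense[n /andP[yn nx]]; have /h := nx; rewrite /ray /= ltNge (ltW yn).
by move=> /nth_rat_dense[n /andP[yn nx]]; have /h := nx; rewrite /ray /= ltNge (ltW yn).
Qed.

(* [a] codes a Dedekind cut: [a 0] and [a 1] bound it, and [a n.+2] tells whether the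
   n-th rational lies below the cut, with a larger rational below the cut as witness.
   The witnesses make the set of codes closed. *)
Let codes (a : nat -> nat) (r : R) :=
  [/\ nth_rat (a 0%N) < r, r <= nth_rat (a 1%N) &
   forall n, match a n.+2 return Prop with
               | 0 => r <= nth_rat n
               | m.+1 => nth_rat n < nth_rat m /\ nth_rat m < r
             end].

Let codes_ray a r n : codes a r -> (ray n r <-> a n.+2 <> 0%N).
Proof.
move=> [_ _ /(_ n)]; rewrite /ray /=; case: (a n.+2) => [h|m [h1 h2]].
  by split=> //; rewrite ltNge h.
by split=> // _; exact: lt_trans h2.
Qed.

Lemma analytic_realT : analytic ray [set: R].
Proof.
pose g a := xget 0 (codes a).
have gP a : (exists r, codes a r) -> codes a (g a) by move=> h; exact: (xgetPex 0 h).
exists [set a | exists r, codes a r], g; split.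
- move=> a ha.
  have hn N : exists b r, codes b r /\ agree N a b.
    by have [b [r cr] ab] := ha N; exists b, r.
  (* A limit [a] of codes still describes the rationals below a cut, and their supremum is the real
     that it codes. The witnesses make each of these rationals strictly smaller than the
     supremum. *)
  pose S := [set nth_rat n | n in [set n | a n.+2 <> 0%N]].
  have ubS : ubound S (nth_rat (a 1%N)).
    move=> _ [n /= an <-]; have [b [r [cr ab]]] := hn (n + 3)%N.
    have /(codes_ray n cr) : b n.+2 <> 0%N by rewrite -ab // addnC.
    case: cr => _; rewrite -ab ?addn3 // => rb _; rewrite /ray /= => /ltW /le_trans; exact.
  have S0 : S (nth_rat (a 0%N)).
    exists (a 0%N) => //=; have [b [r [cr ab]]] := hn (a 0%N + 3)%N.
    have := codes_ray (a 0%N) cr; rewrite -ab; last by rewrite addnC.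
    by move=> <-; case: cr; rewrite -ab // addn3.
  have hS : has_sup S by split; [exists (nth_rat (a 0%N))|exists (nth_rat (a 1%N))].
  have below n : a n.+2 <> 0%N -> nth_rat n < sup S.
    move=> an; have [b [r [cr ab]]] := hn (n + 3)%N.
    case: (cr) => _ _ /(_ n); rewrite -ab; last by rewrite addnC.
    case e : (a n.+2) an => [//|m] _ [nm mr]; apply: lt_le_trans nm _.
    apply: sup_upper_bound => //; exists m => //= am.
    have [b' [r' [cr' ab']]] := hn (n + m + 3)%N.
    case: (cr') => _ _ /(_ n); rewrite -ab'; last by lia.
    rewrite e => -[_ mr']; case: (cr') => _ _ /(_ m); rewrite -ab'; last by lia.
    by rewrite am leNgt mr'.
  have inS n : a n.+2 <> 0%N -> nth_rat n <= sup S by move=> /below/ltW.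
  exists (sup S); split.
  - by case: S0 => n an <-; exact: below.
  - by apply: ge_sup => //; exists (nth_rat (a 0%N)).
  - move=> n; case e : (a n.+2) => [|m].
      apply: ge_sup; first by exists (nth_rat (a 0%N)).
      move=> _ [k /= ak <-]; have [b [r [cr ab]]] := hn (n + k + 3)%N.
      have /(codes_ray k cr) kr : b k.+2 <> 0%N by rewrite -ab //; lia.
      case: (cr) => _ _ /(_ n); rewrite -ab ?e; last by lia.
      by apply: le_trans; exact: ltW.
    have [b [r [cr ab]]] := hn (n + m + 3)%N.
    case: (cr) => _ _ /(_ n); rewrite -ab ?e; last by lia.
    move=> [nm mr]; split=> //; apply: below.
    by rewrite ab; [apply/(codes_ray m cr)|lia].
- move=> a n /gP ca; exists n.+3 => b /gP cb ab.
  by rewrite (codes_ray n ca) (codes_ray n cb) ab.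
- apply/seteqP; split=> // r _.
  have /choice[w hw] n : exists k, match k return Prop with
      | 0 => r <= nth_rat n
      | m.+1 => nth_rat n < nth_rat m /\ nth_rat m < r
    end.
    have [h|h] := leP r (nth_rat n); first by exists 0%N.
    by have [m /andP[? ?]] := nth_rat_dense h; exists m.+1.
  have [|n0 /andP[_ h0]] := @nth_rat_dense (r - 1) r; first by rewrite ltrBlDr ltrDl.
  have [|n1 /andP[h1 _]] := @nth_rat_dense r (r + 1); first by rewrite ltrDl.
  pose a k := match k with 0 => n0 | 1 => n1 | n.+2 => w n end.
  have ca : codes a r by split => //; exact: ltW.
  have cg : codes a (g a) by apply: gP; exists r.
  exists a; first by exists r.
  by apply: ray_separating => n; rewrite (codes_ray n ca) (codes_ray n cg).
Qed.

(** Points are thus linearly ordered by the rays containing them; finite sets get a least element,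
    by which base points will be chosen. *)
Lemma ray_total (x y : R) : (forall n, ray n x -> ray n y) \/ (forall n, ray n y -> ray n x).
Proof.
have [xy|/ltW yx] := leP x y; [left|right] => n; rewrite /ray /= => /lt_le_trans; exact.
Qed.

Lemma measurable_ray n : measurable (ray n : set (measurableTypeR R)).
Proof.
rewrite RGenOInfty.measurableE; apply: sub_sigma_algebra.
by exists (nth_rat n); apply/seteqP; split=> r; rewrite /ray /= in_itv /= andbT.
Qed.

Lemma real_sigma_ind (Q : set (set R)) : sigma_algebra setT Q ->
  (forall n, Q (ray n)) -> forall A : set (measurableTypeR R), measurable A -> Q A.
Proof.
move=> sQ Qr A; rewrite RGenOInfty.measurableE; move: A.
apply: smallest_sub => // _ [x ->].
rewrite (_ : [set` _] = \bigcup_n (if x <= nth_rat n then ray n else set0)).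
  by case: sQ => Q0 _; apply=> n; case: ifP.
apply/seteqP; split=> r /=; rewrite in_itv /= andbT.
  move=> /nth_rat_dense[n /andP[xn nr]]; exists n => //.
  by rewrite (ltW xn).
move=> [n _]; case: ifP => // xn; rewrite /ray /=; exact: le_lt_trans.
Qed.

Lemma analytic_real (A : set (measurableTypeR R)) : measurable A -> analytic ray A.
Proof.
move=> mA; suff : bianalytic ray A by case.
apply: real_sigma_ind mA.
  apply: bianalytic_sigma; first exact: ray_separating.
    by apply: analytic0; exact: analytic_realT.
  exact: analytic_realT.
by move=> n; apply: bianalytic_U; exact: analytic_realT.
Qed.

End RationalRays.

Section StandardBorel.
Context d (X : measurableType d).
Let R := Rdefinitions.R.
Variable f : X -> measurableTypeR R.
Hypothesis fI : injective f.
Hypothesis mf : measurable_fun setT f.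
Hypothesis fX : measurable (range f).
Hypothesis fm : forall A : set X, measurable A -> measurable (f @` A).

Definition code_set (n : nat) : set X := f @^-1` (ray n).

Lemma code_separating : separating code_set.
Proof. by move=> x y h; apply: fI; apply: ray_separating. Qed.

Lemma measurable_code n : measurable (code_set n).
Proof. by rewrite -[code_set n]setTI; apply: mf => //; exact: measurable_ray. Qed.

Lemma analytic_measurable A : measurable A -> analytic code_set A.
Proof.
move=> /fm/analytic_real[F [g [cF lg e]]].
have /choice[h hh] : forall a, exists x, F a -> A x /\ f x = g a.
  move=> a; have [Fa|nFa] := pselect (F a); last by exists point.
  by have [x Ax e'] : (f @` A) (g a) by [rewrite e; exists a]; exists x.
exists F, h; split=> //.
- move=> a n Fa; have [m hm] := lg a n Fa; exists m => b Fb ab.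
  by rewrite /code_set /= (hh a Fa).2 (hh b Fb).2; exact: hm.
- apply/seteqP; split=> [x Ax|_ [a Fa <-]]; last exact: (hh a Fa).1.
  have [a Fa ga] : (g @` F) (f x) by rewrite -e; exists x.
  by exists a => //; apply: fI; rewrite (hh a Fa).2.
Qed.

Local Open Scope ring_scope.

(** [Q] dictates which rationals lie below a real, and the supremum of those rationals recovers it
    in a Borel way. Pulling back along [f], with [point] as default outside its range, turns each
    graph of the Lusin-Novikov cover into a total Borel map. *)
Lemma measurable_decode (Q : nat -> set X) : (forall n, measurable (Q n)) ->
  exists psi : X -> X, measurable_fun setT psi /\
    forall x y, (forall n, Q n x <-> code_set n y) -> psi x = y.
Proof.
move=> mQ.
pose S x : set R := [set nth_rat R n | n in [set n | Q n x]].
pose r x : measurableTypeR R := sup (S x).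
have hasE x : has_sup (S x) <-> (exists n, Q n x) /\
    exists m, forall n, Q n x -> nth_rat R n <= nth_rat R m.
  split=> [[[_ [n qn _]] [u hu]]|[[n qn] [m hm]]].
    split; first by exists n.
    have [|m /andP[um _]] := @nth_rat_dense R u (u + 1); first by rewrite ltrDl.
    by exists m => k qk; apply: le_trans (ltW um); apply: hu; exists k.
  split; first by exists (nth_rat R n); exists n.
  by exists (nth_rat R m) => _ [k qk <-]; exact: hm.
have mr : measurable_fun setT r.
  suff h : forall A : set (measurableTypeR R), measurable A -> measurable (r @^-1` A).
    by move=> _ A mA; rewrite setTI; exact: h.
  apply: (@real_sigma_ind R (fun A => measurable (r @^-1` A))).
    split=> [|A mA|A mA].
    - by rewrite preimage_set0.
    - by rewrite setTD preimage_setC; exact: measurableC.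
    - by rewrite preimage_bigcup; apply: bigcupT_measurable.
  move=> n; rewrite -/(mp (fun x => ray n (r x))).
  have mhas : mp (fun x => has_sup (S x)).
    apply: (mp_ext (fun x => iff_sym (hasE x))); apply: mp_and.
      by apply: mp_ex => k; exact: mQ.
    apply: mp_ex => m; apply: mp_all => k; apply: mp_imp; first exact: mQ.
    exact: mp_const.
  (* The second disjunct reflects the convention that [sup] is [0] on sets without a supremum. *)
  apply: (@mp_ext _ _ (fun x => (has_sup (S x) /\ exists k, Q k x /\ nth_rat R n < nth_rat R k)
       \/ (~ has_sup (S x) /\ nth_rat R n < 0))).
    move=> x; rewrite /ray /= /r; have [hs|nhs] := pselect (has_sup (S x)); last first.
      rewrite sup_out //; split; last by right.
      by case=> -[].
    split=> [[[_ [k [qk nk]]]|[]//]|h].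
      by apply: lt_le_trans nk _; apply: sup_upper_bound => //; exists k.
    left; split=> //; have := h; rewrite -subr_gt0 => h0.
    have [_ [k qk <-]] := sup_adherent h0 hs.
    by rewrite opprB addrC subrK; exists k.
  apply: mp_or; apply: mp_and => //.
  - by apply: mp_ex => k; apply: mp_and; [exact: mQ|exact: mp_const].
  - exact: mp_not.
  - exact: mp_const.
have /choice[psi hpsi] : forall x, exists y, if `[< range f (r x) >] then f y = r x else y = point.
  move=> x; case: asboolP => [[y _ e]|_]; [by exists y|by exists point].
exists psi; split.
  move=> _ A mA; rewrite setTI.
  apply: (@mp_ext _ _ (fun x => (f @` A) (r x) \/ (~ range f (r x) /\ A point))).
    move=> x; have := hpsi x; case: asboolP => [[y _ e]|nr] ep.
      split=> [[[z Az ez]|[]]|Ax]; last by left; exists (psi x).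
        by rewrite -ez in ep; move/fI : ep => ->.
      by move=> []; exists y.
    rewrite ep; split=> [[[z Az ez]|[]//]|]; last by right.
    by case: nr; exists z.
  apply: mp_or.
    by rewrite /mp -[X in measurable X]setTI; apply: mr => //; exact: fm.
  apply: mp_and; last exact: mp_const.
  by apply: mp_not; rewrite /mp -[X in measurable X]setTI; exact: mr.
move=> x y h; have e : r x = f y.
  have hs : has_sup (S x).
    split.
      have [|n /andP[_ nf]] := @nth_rat_dense R (f y - 1) (f y); first by rewrite ltrBlDr ltrDl.
      by exists (nth_rat R n); exists n => //=; apply/h.
    by exists (f y) => _ [n /= /h qn <-]; exact: ltW.
  apply/eqP; rewrite eq_le; apply/andP; split.
    by apply: ge_sup hs.1 _ => _ [n /= /h qn <-]; exact: ltW.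
  rewrite leNgt; apply/negP => /nth_rat_dense[n /andP[h1 h2]].
  have : nth_rat R n <= r x by apply: sup_upper_bound => //; exists n => //=; apply/h.
  by rewrite leNgt h1.
have := hpsi x; rewrite e; case: asboolP => [_ /fI//|[]]; by exists y.
Qed.

End StandardBorel.

Section Enumeration.
Context d (X : measurableType d).

Theorem countable_borel_equiv_enum (E : set (X * X)) :
  @standard_borel d X -> countable_borel_equiv E ->
  exists (U : nat -> set X) (e : nat -> X -> X),
    [/\ separating U, (forall x y, (forall n, U n x -> U n y) \/ (forall n, U n y -> U n x)),
        (forall n, measurable (U n)), (forall n, measurable_fun setT (e n)) &
        (forall x y, E (x, y) <-> exists n, y = e n x)].
Proof.
move=> [f [fI [mf [fX fm]]]] [[mE [Er _]] cE].
have mU := measurable_code mf.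
have sU := code_separating fI.
have Um := analytic_measurable fI fm.
have [Q [mQ EQ]] := lusin_novikov sU mU (Um _ measurableT) Um mE cE.
have /choice[psi hpsi] := fun m => measurable_decode fI fX fm (mQ m).
(* Falling back on [x] where [psi m] leaves the class keeps every [e m] inside it. *)
pose e m x := if `[< E (x, psi m x) >] then psi m x else x.
exists (code_set f), e; split=> //.
  by move=> x y; exact: ray_total.
  move=> m; have mE1 : mp (fun x => E (x, psi m x)).
    apply: (mp_pre (P := E)) mE; apply: measurable_fun_pair => //.
    by have [] := hpsi m.
  move=> _ A mA; rewrite setTI.
  apply: (@mp_ext _ _ (fun x => (E (x, psi m x) /\ A (psi m x)) \/ (~ E (x, psi m x) /\ A x))).
    by move=> x; rewrite /e /=; case: asboolP; tauto.
  apply: mp_or; apply: mp_and => //; last exact: mp_not.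
  by apply: (mp_pre (P := A)) mA; have [] := hpsi m.
move=> x y; split=> [Exy|[n ->]].
  have [m _ h] := EQ _ Exy; exists m; have ey := (hpsi m).2 x y h.
  by rewrite /e ey; case: asboolP.
by rewrite /e; case: asboolP.
Qed.

End Enumeration.

(** * Borel combinatorics of countable equivalence relations *)

Fixpoint cnt (P : nat -> Prop) (n : nat) : nat :=
  if n is m.+1 then (cnt P m + `[< P m >])%N else 0%N.

Lemma eq_cnt (P Q : nat -> Prop) n : (forall i, P i <-> Q i) -> cnt P n = cnt Q n.
Proof. by move=> PQ; elim: n => //= n ->; congr (_ + nat_of_bool _)%N; apply: asbool_equiv_eq. Qed.

Lemma cnt_none (P : nat -> Prop) n k :
  (forall i, (n <= i < n + k)%N -> ~ P i) -> cnt P (n + k)%N = cnt P n.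
Proof.
elim: k => [|k ih] h; first by rewrite addn0.
rewrite addnS /= ih; last by move=> i /andP[ni ik]; apply: h; rewrite ni ltnW // addnS.
by case: asboolP => [/h|]; [lia|rewrite addn0].
Qed.

Lemma cnt_unbounded (P : nat -> Prop) : (forall N, exists2 n, (N <= n)%N & P n) ->
  forall j, exists n, P n /\ cnt P n = j.
Proof.
move=> hP.
have next N : exists n, [/\ (N <= n)%N, P n & cnt P n = cnt P N].
  have ex : exists n, (N <= n)%N && `[< P n >].
    by have [n Nn Pn] := hP N; exists n; rewrite Nn; apply/asboolP.
  case: (ex_minnP ex) => n /andP[Nn /asboolP Pn] mn; exists n; split=> //.
  rewrite -(subnKC Nn); apply: cnt_none => i; rewrite subnKC // => /andP[Ni lin] Pi.
  by have := mn i; rewrite Ni leqNgt lin; move=> /(_ (introT (asboolP _) Pi)).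
elim=> [|j [n [Pn cn]]]; first by have [n [_ Pn cn]] := next 0%N; exists n.
have [m [_ Pm cm]] := next n.+1; exists m; split=> //; rewrite cm /= cn.
by case: asboolP => //; rewrite addn1.
Qed.

Section BorelCombinatorics.
Context d (X : measurableType d).
Variables (E : X -> X -> Prop) (U : nat -> set X) (e : nat -> X -> X).
Hypothesis sepU : separating U.
Hypothesis mU : forall n, measurable (U n).
Hypothesis me : forall n, measurable_fun setT (e n).
Hypothesis Ee : forall x y, E x y <-> exists n, y = e n x.
Hypothesis Erefl : forall x, E x x.
Hypothesis Esym : forall x y, E x y -> E y x.
Hypothesis Etrans : forall x y z, E x y -> E y z -> E x z.

Lemma E_e n x : E x (e n x).
Proof. by apply/Ee; exists n. Qed.

Definition mf (f : X -> X) := measurable_fun setT f.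

Lemma mf_e n f : mf f -> mf (fun x => e n (f x)).
Proof. by move=> hf; exact: (measurableT_comp (me n) hf). Qed.

Lemma mf_id : mf id.
Proof. exact: measurable_id. Qed.

#[local] Hint Resolve mf_id mf_e : core.

Lemma mp_U n f : mf f -> mp (fun x => U n (f x)).
Proof. by move=> hf; apply: (mp_pre hf); exact: mU. Qed.

Lemma mp_eq f g : mf f -> mf g -> mp (fun x => f x = g x).
Proof.
move=> hf hg; apply: (@mp_ext _ _ (fun x => forall n, U n (f x) <-> U n (g x))).
  by move=> x; split=> [|->//]; exact: sepU.
by apply: mp_all => n; apply: mp_iff; exact: mp_U.
Qed.

Lemma mp_exE f (P : X -> X -> Prop) : (forall n, mp (fun x => P x (e n (f x)))) ->
  mp (fun x => exists y, E (f x) y /\ P x y).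
Proof.
move=> h; apply: mp_ext (mp_ex h) => x; split=> [[n hn]|[y [/Ee[n ->] hn]]].
  by exists (e n (f x)); split=> //; exact: E_e.
by exists n.
Qed.

Lemma mp_allE f (P : X -> X -> Prop) : (forall n, mp (fun x => P x (e n (f x)))) ->
  mp (fun x => forall y, E (f x) y -> P x y).
Proof.
move=> h; apply: mp_ext (mp_all h) => x; split=> [hn y /Ee[n ->]//|hn n].
by apply: hn; exact: E_e.
Qed.

Definition mrel (R : X -> X -> Prop) := measurable [set p : X * X | R p.1 p.2].

Lemma mp_rel R f g : mrel R -> mf f -> mf g -> mp (fun x => R (f x) (g x)).
Proof.
by move=> mR hf hg; apply: (mp_pre (P := fun p => R p.1 p.2) (f := fun x => (f x, g x))) => //;
  exact: measurable_fun_pair.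
Qed.

(** A relation inside [E] is a countable union of pieces of the graphs of the [e n], so its
    Borelness reduces to that of predicates of one point. *)
Lemma mrel_build (R : X -> X -> Prop) : (forall x y, R x y -> E x y) ->
  (forall n, mp (fun x => R x (e n x))) -> mrel R.
Proof.
move=> RE h; apply: (@mp_ext _ _ (fun p : X * X =>
    exists n, R p.1 (e n p.1) /\ forall m, U m p.2 <-> U m (e n p.1))).
  move=> [x y] /=; split=> [[n [Rn /sepU ->]]//|Rxy].
  by have /Ee[n en] := RE _ _ Rxy; exists n; rewrite -en.
apply: mp_ex => n; apply: mp_and; first exact: (mp_pre (P := fun x => R x (e n x)) measurable_fst).
apply: mp_all => m; apply: mp_iff; first exact: (mp_pre measurable_snd (mU m)).
exact: (mp_pre (P := fun x => U m (e n x)) measurable_fst (mp_U m (me n))).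
Qed.

(** Expresses infiniteness by quantifiers over naturals and over the class only, as [mp_infinite]
    needs. *)
Lemma infinite_enum x (A : set X) : (forall y, A y -> E x y) ->
  (infinite_set A <-> forall N, exists y, A y /\ forall j, (j < N)%N -> y <> e j x).
Proof.
move=> AE; split=> [iA N|h fA].
  apply: contrapT => hn; apply: iA.
  apply: (@sub_finite_set _ _ [set e j x | j in `I_N]).
    move=> y Ay; apply: contrapT => ny; apply: hn; exists y; split=> // j jN yj.
    by apply: ny; exists j.
  by apply: finite_image; exact: finite_II.
have [N hN] : exists N, forall y, A y -> exists2 j, (j < N)%N & y = e j x.
  have /choice[i hi] : forall y, exists i, A y -> y = e i x.
    move=> y; have [Ay|nAy] := pselect (A y); last by exists 0%N.
    by have /Ee[i] := AE y Ay; exists i.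
  have /finite_seqP[S eS] : finite_set (i @` A) by exact: finite_image.
  exists (\max_(k <- S) k).+1 => y Ay; exists (i y); last exact: hi.
  rewrite ltnS; apply: (@leq_bigmax_seq _ _ (fun=> true) id) => //.
  suff : [set` S] (i y) by [].
  by rewrite -eS; exists y.
have [y [Ay ny]] := h N; have [j jN ej] := hN y Ay; exact: (ny j).
Qed.

(** * Disjoint Borel complete sections for relations with infinite classes *)

Section Partition.
Variables (D : X -> Prop) (F : X -> X -> Prop).
Hypothesis mFr : mrel F.
Hypothesis FE : forall x y, F x y -> E x y.
Hypothesis FD : forall x, F x x <-> D x.
Hypothesis Fsym : forall x y, F x y -> F y x.
Hypothesis Ftrans : forall x y z, F x y -> F y z -> F x z.
Hypothesis Finf : forall x, D x -> infinite_set [set y | F x y].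

Lemma mp_infinite f (P : X -> X -> Prop) : mf f ->
  (forall n, mp (fun x => P x (e n (f x)))) -> 
  mp (fun x => infinite_set [set y | E (f x) y /\ P x y]).
Proof.
move=> hf hP.
apply: (@mp_ext _ _ (fun x => forall N, exists y, E (f x) y /\ (P x y /\
   forall j, (j < N)%N -> y <> e j (f x)))).
  move=> x; rewrite (@infinite_enum (f x)); last by move=> y [].
  split=> h N; have [y] := h N; first by move=> [h1 [h2 h3]]; exists y.
  by move=> [[h1 h2] h3]; exists y.
apply: mp_all => N; apply: mp_exE => n; apply: mp_and => //.
apply: mp_all => j; apply: mp_imp; first exact: mp_const.
by apply: mp_not; apply: mp_eq; exact: mf_e.
Qed.

(* [pre n x y]: the codes of [y] and of the leftmost condensation point of the class of
   [x] agree below [n]. *)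
Fixpoint pre (n : nat) (x y : X) : Prop :=
  if n is m.+1 then pre m x y /\
    (U m y <-> infinite_set [set z | E x z /\ (F x z /\ (pre m x z /\ U m z))])
  else True.

Let tt n x := infinite_set [set z | E x z /\ (F x z /\ (pre n x z /\ U n z))].

Let mp_pre2 n f g : mf f -> mf g -> mp (fun x => pre n (f x) (g x)).
Proof.
elim: n f g => [|n ih] f g hf hg /=; first exact: mp_const.
apply: mp_and; first exact: ih.
apply: mp_iff; first exact: mp_U.
apply: mp_infinite => // m; apply: mp_and; first by apply: mp_rel => //; exact: mf_e.
apply: mp_and; first by apply: ih => //; exact: mf_e.
by apply: mp_U; exact: mf_e.
Qed.

Let pre_inv n x x' : F x x' -> pre n x = pre n x'.
Proof.
move=> xx'; elim: n => //= n ih; apply/funext => y; rewrite ih.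
have -> // : [set z | E x z /\ F x z /\ pre n x' z /\ U n z] =
  [set z | E x' z /\ F x' z /\ pre n x' z /\ U n z].
apply/seteqP; split=> z /= [_ [h1 h2]]; have h : F x z <-> F x' z.
- by split; apply: Ftrans => //; exact: Fsym.
- by move/h : h1 => h1; split=> //; exact: FE.
- by split; apply: Ftrans => //; exact: Fsym.
- by move/h : h1 => h1; split=> //; exact: FE.
Qed.

(** At each step the half kept is [U n] if it retains infinitely many points and its complement
    otherwise; in the second case only finitely many points are lost. *)
Let pre_infinite n x : D x -> infinite_set [set y | F x y /\ pre n x y].
Proof.
move=> Dx; elim: n => [|n ih] /=.
  have := Finf Dx; apply: sub_infinite_set => y Fy; by split.
have [t|nt] := pselect (tt n x).
  by apply: sub_infinite_set (t) => y [_ [Fy [py Uy]]]; split=> //; split=> //; split.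
move=> fN; apply: ih; apply: (@sub_finite_set _ _
  ([set y | F x y /\ pre n.+1 x y] `|` [set z | E x z /\ (F x z /\ (pre n x z /\ U n z))])).
  move=> y [Fy py]; have [Uy|nUy] := pselect (U n y).
    by right; split; [exact: FE|].
  by left; split=> //; split=> //; split=> [/nUy|/nt].
by rewrite finite_setU; split=> //; exact: contrapT nt.
Qed.

Let first_diff n x := pre n x x /\ ~ (U n x <-> tt n x).

Let first_diff_fun n m x : first_diff n x -> first_diff m x -> n = m.
Proof.
have pren n' m' : (n' < m')%N -> pre m' x x -> (U n' x <-> tt n' x).
  elim: m' => // m' ih; rewrite ltnS leq_eqVlt => /orP[/eqP->[]//|nm [/(ih nm)]//].
move=> [pn hn] [pm hm]; case: (ltngtP n m) => // [nm|mn]; exfalso.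
  exact: (hn (pren _ _ nm pm)).
exact: (hm (pren _ _ mn pn)).
Qed.

(** If no point left the codes of the condensation point from level [N] on, all points of the class
    agreeing with it up to [N] would coincide, as [U] separates points, although there are
    infinitely many. *)
Let first_diff_unbounded x N : D x -> exists2 n, (N <= n)%N & exists y, F x y /\ first_diff n y.
Proof.
move=> Dx; have iN := @pre_infinite N x Dx; apply: contrapT => hn.
have lim y : F x y -> pre N x y -> forall n, pre n x y.
  move=> Fy pN; have Nn k : pre (k + N)%N x y.
    elim: k => // k ih; split=> //; apply: contrapT => nU; apply: hn.
    exists (k + N)%N; first by rewrite leq_addl.
    exists y; split=> //; rewrite /first_diff -(pre_inv _ Fy); split=> //.
    move=> h; apply: nU; rewrite h /tt -(pre_inv _ Fy).
    have -> // : [set z | E x z /\ F x z /\ pre (k + N) x z /\ U (k + N)%N z] =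
      [set z | E y z /\ F y z /\ pre (k + N) x z /\ U (k + N)%N z].
    apply/seteqP; split=> z /= [_ [h1 h2]].
      have Fz : F y z by apply: Ftrans h1; exact: Fsym.
      by split=> //; exact: FE.
    have Fz : F x z by apply: Ftrans h1.
    by split=> //; exact: FE.
  move=> n; have := Nn n; elim: N {pN Nn iN hn} => [|N ih]; first by rewrite addn0.
  by rewrite addnS => -[/ih].
apply: iN; have [[y [Fy py]]|none] := pselect (exists y, F x y /\ pre N x y); last first.
  apply: (@sub_finite_set _ _ set0) => // y [Fy py]; apply: none; by exists y.
apply: (@sub_finite_set _ _ [set y]) => // z [Fz pz].
apply: sepU => n; have [_ ->] := lim z Fz pz n.+1; by have [_ ->] := lim y Fy py n.+1.
Qed.

Let hit x n := exists y, E x y /\ (F x y /\ first_diff n y).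

Let hit_inv x y n : F x y -> (hit x n <-> hit y n).
Proof.
move=> Fxy; split=> -[z [_ [Fz hz]]]; exists z.
  have Fyz : F y z by apply: Ftrans Fz; exact: Fsym.
  by split; [exact: FE|].
have Fxz : F x z by apply: Ftrans Fz.
by split; [exact: FE|].
Qed.

Let mp_first_diff n f : mf f -> mp (fun x => first_diff n (f x)).
Proof.
move=> hf; apply: mp_and; first exact: mp_pre2.
apply: mp_not; apply: mp_iff; first exact: mp_U.
apply: mp_infinite => // m; apply: mp_and; first by apply: mp_rel => //; exact: mf_e.
apply: mp_and; first by apply: mp_pre2 => //; exact: mf_e.
by apply: mp_U; exact: mf_e.
Qed.

Let mp_hit n : mp (fun x => hit x n).
Proof.
apply: (@mp_exE id) => m; apply: mp_and; last by apply: mp_first_diff; apply: mf_e.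
exact: (mp_rel mFr mf_id (me m)).
Qed.

(** A point enters section [j] if the level at which it departs from the condensation point has rank
    [j] among the levels at which some point of its class departs. Infinitely many levels occur, so
    every rank is attained. The condensation point itself, if it is in the class, enters no
    section. *)
Lemma partition_sections : exists S : nat -> X -> Prop,
  [/\ (forall j, mp (S j)), (forall j x, S j x -> D x),
      (forall i j x, S i x -> S j x -> i = j) &
      (forall j x, D x -> exists y, F x y /\ S j y)].
Proof.
exists (fun j x => D x /\ exists n, first_diff n x /\ cnt (hit x) n = j); split.
- move=> j; apply: mp_and.
    by apply: (mp_ext FD); apply: mp_rel => //; exact: mf_id.
  apply: mp_ex => n; apply: mp_and; first by apply: mp_first_diff; exact: mf_id.
  elim: n j => [|n ih] j /=; first exact: mp_const.
  apply: (@mp_ext _ _ (fun x => (hit x n /\ exists i, cnt (hit x) n = i /\ (i + 1)%N = j) \/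
    (~ hit x n /\ cnt (hit x) n = j))).
    move=> x; case: asboolP => h; split.
    + by move=> [[_ [i [-> ->]]]|[]].
    + by move=> hj; left; split=> //; exists (cnt (hit x) n).
    + by move=> [[//]|[_ ->]]; rewrite addn0.
    + by rewrite addn0; right.
  apply: mp_or; apply: mp_and => //; last exact: mp_not.
  by apply: mp_ex => i; apply: mp_and => //; exact: mp_const.
- by move=> j x [].
- by move=> i j x [_ [n [hn <-]]] [_ [m [hm <-]]]; rewrite (first_diff_fun hn hm).
- move=> j x Dx; have [|n [[y [_ [Fy hy]]] cn]] := @cnt_unbounded (hit x) _ j.
    move=> N; have [n Nn [y [Fy hy]]] := first_diff_unbounded N Dx.
    by exists n => //; exists y; split; [exact: FE|].
  exists y; split=> //; split; first by apply/FD; exact: Ftrans (Fsym Fy) Fy.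
  exists n; split=> //; rewrite -cn; apply: eq_cnt => i; apply: iff_sym; exact: hit_inv.
Qed.

End Partition.

(** * Maximal Borel matchings inside the classes *)

Section Greedy.
Variables (A B : X -> Prop).
Hypothesis mA : mp A.
Hypothesis mB : mp B.

(* At stage [s = (i, j)] match [a] with [e i a] whenever both are still unmatched and
   [e j] sends [e i a] back to [a]; the latter makes the stage injective. *)
Let stage (uA uB : X -> Prop) (ij : nat * nat) (a : X) :=
  [/\ A a, ~ uA a, B (e ij.1 a), ~ uB (e ij.1 a) & e ij.2 (e ij.1 a) = a].

Let dec (s : nat) : nat * nat := odflt (0%N, 0%N) (unpickle s).

Let Fixpoint used (s : nat) : (X -> Prop) * (X -> Prop) :=
  if s is s'.+1 then
    let u := used s' in
    ((fun a => u.1 a \/ stage u.1 u.2 (dec s') a),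
     (fun b => u.2 b \/ (stage u.1 u.2 (dec s') (e (dec s').2 b) /\
                          e (dec s').1 (e (dec s').2 b) = b)))
  else ((fun=> False), (fun=> False)).

Let st s a := stage (used s).1 (used s).2 (dec s) a.

Let used_mono s s' a : (s <= s')%N ->
  ((used s).1 a -> (used s').1 a) /\ ((used s).2 a -> (used s').2 a).
Proof.
move=> ss'; rewrite -(subnK ss'); elim: (s' - s)%N => // k [ih1 ih2]; rewrite addSn /=.
by split=> h; left; auto.
Qed.

Let mp_stage uA uB ij : mp uA -> mp uB -> mp (stage uA uB ij).
Proof.
move=> mAu mBu; apply: (@mp_ext _ _ (fun a => A a /\ ~ uA a /\ B (e ij.1 a) /\
  ~ uB (e ij.1 a) /\ e ij.2 (e ij.1 a) = a)).
  by move=> a; split=> [[? [? [? [? ?]]]]|[]].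
have m1 : mf (e ij.1) by exact: me.
apply: mp_and => //; apply: mp_and; first exact: mp_not.
apply: mp_and; first exact: (mp_pre (P := B)).
apply: mp_and; first by apply: mp_not; exact: (mp_pre (P := uB)).
by apply: mp_eq; [exact: mf_e|exact: mf_id].
Qed.

Let mp_used s : mp (used s).1 /\ mp (used s).2.
Proof.
elim: s => [|s [ih1 ih2]] /=; first by split; exact: mp_const.
have ms := @mp_stage _ _ (dec s) ih1 ih2.
split; apply: mp_or => //; apply: mp_and.
  exact: (mp_pre (P := stage _ _ _) (me _)).
by apply: mp_eq; [apply: mf_e; exact: me|exact: mf_id].
Qed.

(** For maximality, [a] and [b] in one class are carried to each other by some [e i] and [e j]. At
    the stage coding [(i, j)] they are matched unless one of them has been matched earlier. *)
Lemma greedy_matching : exists M : X -> X -> Prop,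
  [/\ mrel M, (forall a b, M a b -> [/\ E a b, A a & B b]),
     (forall a b b', M a b -> M a b' -> b = b'),
     (forall a a' b, M a b -> M a' b -> a = a') &
     (forall a b, E a b -> A a -> B b -> (exists b', M a b') \/ (exists a', M a' b))].
Proof.
pose M a b := exists s, st s a /\ b = e (dec s).1 a.
have ME a b : M a b -> [/\ E a b, A a & B b].
  by move=> [s [[Aa _ Bb _ _] ->]]; split=> //; exact: E_e.
have usedA s s' a : (s < s')%N -> st s a -> (used s').1 a.
  by move=> ss' h; have [h1 _] := used_mono a ss'; apply: h1; right.
have usedB s s' a : (s < s')%N -> st s a -> (used s').2 (e (dec s).1 a).
  move=> ss' h; have [_ h1] := used_mono (e (dec s).1 a) ss'; apply: h1; right.
  by case: (h) => _ _ _ _ ->.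
have fromA s a : (used s).1 a -> exists s', st s' a.
  by elim: s => //= s ih [|h]; [exact: ih|exists s].
have fromB s b : (used s).2 b ->
    exists s', st s' (e (dec s').2 b) /\ b = e (dec s').1 (e (dec s').2 b).
  by elim: s => //= s ih [|[h h']]; [exact: ih|exists s].
exists M; split=> //.
- apply: mrel_build => [a b /ME[]//|n]; apply: mp_ex => s; apply: mp_and.
    by apply: mp_stage; have [] := mp_used s.
  by apply: mp_eq; exact: me.
- move=> a b b' [s [hs ->]] [s' [hs' ->]]; case: (ltngtP s s') => [ss'|ss'|->//].
    by case: hs' => _ []; exact: usedA hs.
  by case: hs => _ []; exact: usedA hs'.
- move=> a a' b [s [hs bs]] [s' [hs' bs']]; case: (ltngtP s s') => [ss'|ss'|ess].
  + by case: hs' => _ _ _ []; rewrite -bs' bs; exact: usedB hs.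
  + by case: hs => _ _ _ []; rewrite -bs bs'; exact: usedB hs'.
  + case: hs => _ _ _ _ <-; case: hs' => _ _ _ _ <-.
    by rewrite -bs -bs' ess.
- move=> a b Eab Aa Bb.
  have [i bi] := (Ee _ _).1 Eab; have [j aj] := (Ee _ _).1 (Esym Eab).
  pose s := pickle (i, j); have ds : dec s = (i, j) by rewrite /dec /s pickleK.
  have [/fromA[s' hs']|nua] := pselect ((used s).1 a).
    by left; exists (e (dec s').1 a); exists s'.
  have [/fromB[s' [hs' eb]]|nub] := pselect ((used s).2 b).
    by right; exists (e (dec s').2 b); exists s'.
  left; exists b; exists s; rewrite ds; split=> //.
  by rewrite /st /stage ds /= -bi -aj.
Qed.

End Greedy.
Lemma mrel_E : mrel E.
Proof.
apply: mrel_build => // n; apply: mp_ext (mp_const _ True) => x; split=> // _; exact: E_e.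
Qed.

Lemma least (P : nat -> Prop) : (exists n, P n) -> exists n, P n /\ forall m, (m < n)%N -> ~ P m.
Proof.
move=> [n0 P0]; have ex : exists n, `[< P n >] by exists n0; apply/asboolP.
case: (ex_minnP ex) => n /asboolP Pn mn; exists n; split=> // m mn' /asboolP/mn.
by rewrite leqNgt mn'.
Qed.

Lemma least_unique (P : nat -> Prop) n m : P n -> P m ->
  (forall i, (i < n)%N -> ~ P i) -> (forall i, (i < m)%N -> ~ P i) -> n = m.
Proof. by move=> Pn Pm hn hm; case: (ltngtP n m) => // [/hm|/hn]. Qed.

(** * Representing the classes of countably many relations at once *)

Section Matching.
Variables (D : nat -> X -> Prop) (F : nat -> X -> X -> Prop).
Hypothesis mFk : forall k, mrel (F k).
Hypothesis FkE : forall k x y, F k x y -> E x y.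
Hypothesis FkD : forall k x, F k x x <-> D k x.
Hypothesis Fksym : forall k x y, F k x y -> F k y x.
Hypothesis Fktrans : forall k x y z, F k x y -> F k y z -> F k x z.
Hypothesis Fkinf : forall k x, D k x -> infinite_set [set y | F k x y].
Hypothesis Einf : forall x, infinite_set [set y | E x y].

(* The classes of [F k] cannot in general be represented at disjoint points of their own:
   the point [x] representing the class of [y] may lie anywhere in the [E]-class.  Fix
   disjoint complete sections [R k] for [E] and, for each [k], disjoint complete sections
   [S k j] for [F k].  On each [E]-class either some [S k j] injects into [R k], or [R k]
   injects into every [S k j]; in the latter case the class is paradoxical enough to be
   mapped onto countably many copies of itself. *)
Lemma class_matching : exists M : nat -> X -> X -> Prop,
  [/\ (forall k, mrel (M k)), (forall k x y, M k x y -> E x y /\ D k y),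
     (forall k k' x y y', M k x y -> M k' x y' -> k = k' /\ y = y') &
     (forall k y, D k y -> exists x y', M k x y' /\ F k y y')].
Proof.
have [R [mR _ Rdis Rmeet]] := @partition_sections (fun=> True) E mrel_E (fun _ _ => id)
  (fun x => conj (fun=> Logic.I) (fun=> Erefl x)) Esym Etrans (fun x _ => @Einf x).
have /choice[S hS] := fun k => partition_sections (mFk k) (@FkE k) (@FkD k) (@Fksym k)
  (@Fktrans k) (@Fkinf k).
have mS k j : mp (S k j) by have [] := hS k.
have Sdis k i j x : S k i x -> S k j x -> i = j by have [_ _ + _] := hS k; exact.
have Smeet k j x : D k x -> exists y, F k x y /\ S k j y by have [_ _ _] := hS k; exact.
have /choice[G hG] : forall kj : nat * nat, exists M : X -> X -> Prop,
  [/\ mrel M, (forall a b, M a b -> [/\ E a b, S kj.1 kj.2 a & R kj.1 b]),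
     (forall a b b', M a b -> M a b' -> b = b'),
     (forall a a' b, M a b -> M a' b -> a = a') &
     (forall a b, E a b -> S kj.1 kj.2 a -> R kj.1 b ->
        (exists b', M a b') \/ (exists a', M a' b))].
  by move=> [k j]; exact: greedy_matching.
have mG kj : mrel (G kj) by have [] := hG kj.
have GE kj a b : G kj a b -> [/\ E a b, S kj.1 kj.2 a & R kj.1 b].
  by have [_ + _ _ _] := hG kj; exact.
have Gfun kj a b b' : G kj a b -> G kj a b' -> b = b' by have [_ _ + _ _] := hG kj; exact.
have Ginj kj a a' b : G kj a b -> G kj a' b -> a = a' by have [_ _ _ + _] := hG kj; exact.
have Gmax kj a b : E a b -> S kj.1 kj.2 a -> R kj.1 b ->
    (exists b', G kj a b') \/ (exists a', G kj a' b).
  by have [_ _ _ _] := hG kj; exact.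
(* On the class of [x], [cov] says that the matching is total on [S k j], and [bad] that this fails
   for every [j]; both depend on the [E]-class alone. *)
pose cov k j x := forall a, E x a -> S k j a -> exists b, E a b /\ G (k, j) a b.
pose bad k x := ~ exists j, cov k j x.
have cov_inv k j x y : E x y -> cov k j x <-> cov k j y.
  by move=> Exy; split=> h a Ea; apply: h; apply: Etrans Ea => //; exact: Esym.
have bad_inv k x y : E x y -> bad k x <-> bad k y.
  by move=> Exy; split; apply: contra_not => -[j hj]; exists j; apply/(cov_inv _ _ _ _ Exy).
have mcov k j f : mf f -> mp (fun x => cov k j (f x)).
  move=> hf; apply: mp_allE => n; apply: mp_imp.
    by apply: (mp_pre (P := S k j)) => //; exact: mf_e.
  apply: (@mp_exE (fun x => e n (f x))) => m; apply: mp_rel => //.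
    exact: mf_e.
  by apply: mf_e; exact: mf_e.
have mbad k f : mf f -> mp (fun x => bad k (f x)).
  by move=> hf; apply: mp_not; apply: mp_ex => j; exact: mcov.
have mD k f : mf f -> mp (fun x => D k (f x)).
  by move=> hf; apply: (mp_ext (fun x => FkD k (f x))); exact: mp_rel.
(* With no bad index, a point of [R k] represents its partner in the first [S k j] that is totally
   matched. *)
pose M1 k x y := (~ exists k0, bad k0 x) /\ R k x /\
  exists j, (cov k j x /\ forall j', (j' < j)%N -> ~ cov k j' x) /\ G (k, j) y x.
(* For bad [k0], maximality matches every [r] in [R k0] with a point of each [S k0 j]. The pairs
   [(j, r)] are thus realised by distinct points [x]; when [j] codes [(k, i)], that [x] represents
   [e i r] at index [k]. *)
pose M2 k x y := exists k0, (bad k0 x /\ forall k', (k' < k0)%N -> ~ bad k' x) /\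
  exists j, exists r, E x r /\ (G (k0, j) x r /\
    exists i, unpickle j = Some (k, i) /\ y = e i r /\ D k y).
exists (fun k x y => M1 k x y \/ M2 k x y); split.
- move=> k; apply: mrel_build => [x y [|]|n].
  + by move=> [_ [_ [j [_ /GE[/Esym]]]]].
  + move=> [k0 [_ [j [r [Exr [_ [i [_ [-> _]]]]]]]]]; exact: Etrans Exr (E_e _ _).
  + apply: mp_or; last first.
      apply: mp_ex => k0; apply: mp_and.
        apply: mp_and; first exact: mbad.
        apply: mp_all => k'; apply: mp_imp; first exact: mp_const.
        by apply: mp_not; exact: mbad.
      apply: mp_ex => j; apply: (@mp_exE id) => m; apply: mp_and.
        by apply: (mp_rel (mG _) mf_id); exact: me.
      apply: mp_ex => i; apply: mp_and; first exact: mp_const.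
      apply: mp_and; last by apply: mD; exact: me.
      by apply: mp_eq; [exact: me|apply: mf_e; exact: me].
    apply: mp_and; first by apply: mp_not; apply: mp_ex => k0; exact: mbad.
    apply: mp_and => //; apply: mp_ex => j; apply: mp_and; last first.
      by apply: (mp_rel (mG _) _ mf_id); exact: me.
    apply: mp_and; first exact: mcov.
    by apply: mp_all => k'; apply: mp_imp; [exact: mp_const|apply: mp_not; exact: mcov].
- move=> k x y [[_ [_ [j [_ /GE[/Esym Exy Sy _]]]]]|].
    by split=> //; have [_ h _ _] := hS k; exact: h Sy.
  move=> [k0 [_ [j [r [Exr [_ [i [_ [-> Dk]]]]]]]]]; split=> //; exact: Etrans Exr (E_e _ _).
- move=> k k' x y y' [[nb [Rx [j [[cj lj] Gj]]]]|[k0 [[b0 l0] [j [r [_ [Gr [i [ji [-> _]]]]]]]]]].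
    move=> [[_ [Rx' [j' [[cj' lj'] Gj']]]]|[k0 [[b0 _] _]]]; last first.
      by case: nb; exists k0.
    have ek := Rdis _ _ _ Rx Rx'; rewrite -ek in cj' lj' Gj' *.
    have ej := least_unique cj cj' lj lj'; rewrite -ej in Gj'.
    by split=> //; exact: Gfun Gj Gj' || exact: Ginj Gj Gj'.
  move=> [[nb _]|[k1 [[b1 l1] [j' [r' [_ [Gr' [i' [ji' [-> _]]]]]]]]]].
    by case: nb; exists k0.
  have ek := least_unique b0 b1 l0 l1; rewrite -ek in Gr'.
  have [_ Sx _] := GE _ _ _ Gr; have [_ Sx' _] := GE _ _ _ Gr'.
  have ej := Sdis _ _ _ _ Sx Sx'; rewrite /= in ej; rewrite -ej in Gr' ji'.
  move: ji'; rewrite ji => -[-> ->]; by rewrite (Gfun _ _ _ _ Gr Gr').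
- move=> k y Dy; have [[k0 /(@ex_intro _ (fun k => bad k y))/least hb]|nb] :=
    pselect (exists k0, bad k0 y).
    have {k0 hb}[k0 [bk lk]] := hb.
    have [r [Eyr Rr]] := Rmeet k0 y Logic.I.
    have [i yi] := (Ee _ _).1 (Esym Eyr).
    pose j := pickle (k, i).
    have [a [Eya [Sa na]]] : exists a, E y a /\ (S k0 j a /\ ~ exists b, G (k0, j) a b).
      apply: contrapT => hn; apply: bk; exists j => a Eya Sa; apply: contrapT => hb.
      apply: hn; exists a; split=> //; split=> // -[b Gb]; apply: hb; exists b; split=> //.
      by have [] := GE _ _ _ Gb.
    have [//|[a' Ga]] := Gmax (k0, j) a r (Etrans (Esym Eya) Eyr) Sa Rr.
    have [Ea _ _] := GE _ _ _ Ga; have Eay : E y a' := Etrans Eyr (Esym Ea).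
    exists a', y; split; last exact/FkD.
    right; exists k0; split.
      split; first exact/(bad_inv _ _ _ Eay).
      by move=> k' /lk; apply: contra_not => /(bad_inv _ _ _ Eay).
    exists j, r; split=> //; split=> //; exists i; split=> //.
    by rewrite /j pickleK.
  have [j [cj lj]] : exists j, cov k j y /\ forall j', (j' < j)%N -> ~ cov k j' y.
    apply: least; apply: contrapT => h; apply: nb; by exists k.
  have [y' [Fy Sy]] := Smeet k j y Dy.
  have Eyy' := FkE Fy.
  have [b [Eb Gb]] := cj _ Eyy' Sy.
  have Eyb := Etrans Eyy' Eb.
  exists b, y'; split=> //; left; split.
    by apply: contra_not nb => -[k0 hk]; exists k0; apply/(bad_inv _ _ _ Eyb).
  split; first by have [] := GE _ _ _ Gb.
  exists j; split=> //; split; first exact/(cov_inv _ _ _ _ Eyb).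
  by move=> j' /lj; apply: contra_not => /(cov_inv _ _ _ _ Eyb).
Qed.

End Matching.
End BorelCombinatorics.

(** * Nested systems of sets *)

Section NestedSystem.
Context (X : Type) (Y : set X) (S : set (set X)).
Local Notation c A := (Y `\` A).
Hypothesis SY : forall A, S A -> A `<=` Y.
Hypothesis Sne : forall A, S A -> A !=set0.
Hypothesis Sc : forall A, S A -> S (c A).
Hypothesis Snest : forall A B, S A -> S B ->
  [\/ A `<=` B, B `<=` A, A `<=` c B | c A `<=` B].
Hypothesis Sdec : forall (A : nat -> set X) B, (forall n, S (A n)) -> S B ->
  (forall n, A n.+1 `<` A n) -> ~ forall n, B `<=` A n.
Hypothesis Sinc : forall (A : nat -> set X) B, (forall n, S (A n)) -> S B ->
  (forall n, A n `<` A n.+1) -> ~ forall n, A n `<=` B.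

Definition lts (A B : set X) := A `<=` B /\ A <> B.

Definition immediate (A B : set X) := lts A B /\ forall D, S D -> lts A D -> lts D B -> False.

(* [A] and [B] are incident to a common vertex of the structure tree, both pointing
   away from it. *)
Definition incident (A B : set X) := A = B \/ immediate A (c B).

Lemma ccK A : S A -> c (c A) = A.
Proof.
move=> SA; apply/seteqP; split=> x.
  by move=> [Yx nc]; apply: contrapT => nA; exact: nc.
by move=> Ax; split=> [|[_ /(_ Ax)]//]; exact: SY Ax.
Qed.

Lemma cS A B : A `<=` B -> c B `<=` c A.
Proof. by move=> AB x [Yx nB]; split=> // /AB. Qed.

Lemma cS' A B : S A -> S B -> c B `<=` c A -> A `<=` B.
Proof. by move=> SA SB /cS; rewrite !ccK. Qed.

Lemma c_inj A B : S A -> S B -> c A = c B -> A = B.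
Proof. by move=> SA SB e; rewrite -(ccK SA) e ccK. Qed.

Lemma cSl A B : S A -> S B -> A `<=` c B -> B `<=` c A.
Proof. by move=> SA SB /cS; rewrite ccK. Qed.

Lemma cSr A B : S A -> S B -> c A `<=` B -> c B `<=` A.
Proof. by move=> SA SB /cS; rewrite ccK. Qed.

Lemma ltsc A B : S A -> S B -> lts A B -> lts (c B) (c A).
Proof. by move=> SA SB [AB nAB]; split; [exact: cS|move=> /c_inj e; apply: nAB; rewrite e]. Qed.

Lemma immediatec A B : S A -> S B -> immediate A B -> immediate (c B) (c A).
Proof.
move=> SA SB [AB h]; split; first exact: ltsc.
move=> D SD BD DA; apply: (h (c D)); first exact: Sc.
  by have := ltsc SD (Sc SA) DA; rewrite ccK.
by have := ltsc (Sc SB) SD BD; rewrite ccK.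
Qed.

Lemma incident_sym A B : S A -> S B -> incident A B -> incident B A.
Proof.
move=> SA SB [->|h]; first by left.
by right; have := immediatec SA (Sc SB) h; rewrite ccK.
Qed.

Lemma not_sub_c A : S A -> ~ A `<=` c A.
Proof. by move=> /Sne[x Ax] /(_ x Ax)[]. Qed.

Lemma not_c_sub A : S A -> ~ c A `<=` A.
Proof. by move=> SA; rewrite -{2}(ccK SA); apply: not_sub_c; exact: Sc. Qed.

(** Nestedness is used twice: to see that [A] and [D] are equal or disjoint, and to compare with [B]
    a set [Z] strictly between [A] and [c D]. Every position of [Z] relative to [B] contradicts
    immediacy or nonemptiness. *)
Lemma incident_trans A B D : S A -> S B -> S D ->
  incident A B -> incident B D -> incident A D.
Proof.
move=> SA SB SD [->//|hAB] [<-|hBD]; first by right.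
have hBA := immediatec SA (Sc SB) hAB; rewrite ccK // in hBA.
have hDB := immediatec SB (Sc SD) hBD; rewrite ccK // in hDB.
have [[AcB nAcB] iAB] := hAB; have [[BcD nBcD] iBD] := hBD.
have [[DcB nDcB] iDB] := hDB; have [[BcA nBcA] iBA] := hBA.
have [->|nAD] := pselect (A = D); first by left.
right; have AcD : A `<=` c D.
  case: (Snest SA SD) => // [AD|DA|cAD].
  - by case: (iAB D).
  - by case: (iDB A) => //; split=> // e; apply: nAD.
  - case: (@not_sub_c B SB); apply: subset_trans BcA _; apply: subset_trans cAD _.
    exact: DcB.
split.
  split=> // e; apply: (@not_sub_c B SB); apply: subset_trans BcD _.
  by rewrite -e.
move=> Z SZ [AZ nAZ] [ZD nZD].
case: (Snest SZ SB) => [ZB|BZ|ZcB|cZB].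
- case: (@not_sub_c A SA); apply: subset_trans AZ _; apply: subset_trans ZB BcA.
- have [e|nBZ] := pselect (B = Z); last by case: (iBD Z).
  by case: (@not_sub_c A SA); apply: subset_trans AZ _; rewrite -e.
- have [e|nZcB] := pselect (Z = c B); last by case: (iAB Z).
  case: (@not_sub_c D SD); apply: subset_trans DcB _; rewrite -e; exact: ZD.
- case: (@not_sub_c D SD); apply: subset_trans (cSl SZ SD ZD) _.
  by apply: subset_trans cZB BcD.
Qed.

(** Without an immediate successor of [A] below [B], dependent choice would descend forever between
    them, against [Sdec]. *)
Lemma sup_immediate A B : S A -> S B -> lts A B -> exists D, [/\ S D, immediate A D & D `<=` B].
Proof.
move=> SA SB AB; apply: contrapT => hn.
have step (x : {D | [/\ S D, lts A D & D `<=` B]}) :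
    {y : {D | [/\ S D, lts A D & D `<=` B]} | lts (sval y) (sval x)}.
  apply: cid; case: x => D [SD AD DB] /=; apply: contrapT => h; apply: hn; exists D; split=> //.
  split=> // D' SD' AD' D'D; apply: h.
  by exists (exist _ D' (And3 SD' AD' (subset_trans D'D.1 DB))).
have [f [_ fS]] := dependent_choice step (exist _ B (And3 SB AB (@subset_refl _ B))).
apply: (@Sdec (fun n => sval (f n)) A) => // n.
- by case: (svalP (f n)).
- have [h1 h2] := fS n; split=> // h3; apply: h2; exact/seteqP.
- by case: (svalP (f n)) => _ [].
Qed.

Lemma inf_immediate A B : S A -> S B -> lts A B -> exists D, [/\ S D, immediate D B & A `<=` D].
Proof.
move=> SA SB AB; have [D [SD iD DB]] := sup_immediate (Sc SB) (Sc SA) (ltsc SA SB AB).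
exists (c D); split; first exact: Sc.
  by have := immediatec (Sc SB) SD iD; rewrite ccK.
exact: cSl.
Qed.

Lemma immediate_incident A D : S A -> S D -> immediate A D -> incident A (c D).
Proof. by move=> SA SD h; right; rewrite ccK. Qed.

(** Connectedness of the structure tree, phrased as an induction principle. From [A] towards a
    larger [B] one climbs by immediate successors [D'], each costing an incidence with [c D'] and a
    reversal of that edge. The climb ends by [Sinc], and nestedness reduces the other positions to
    inclusion. *)
Lemma incident_connected (R : set X -> set X -> Prop) :
  (forall A B, S A -> S B -> incident A B -> R A B) -> (forall A, S A -> R A (c A)) ->
  (forall A B, R A B -> R B A) -> (forall A B D, R A B -> R B D -> R A D) ->
  forall A B, S A -> S B -> R A B.
Proof.
move=> Radj Rc Rsym Rtrans.
have Rsub A B : S A -> S B -> A `<=` B -> R A B.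
  move=> SA SB AB; apply: contrapT => nR.
  have step (x : {D | [/\ S D, D `<=` B & ~ R D B]}) :
      {y : {D | [/\ S D, D `<=` B & ~ R D B]} | lts (sval x) (sval y)}.
    apply: cid; case: x => D [SD DB nRD] /=.
    have [e|nDB] := pselect (D = B).
      by case: nRD; rewrite e; apply: Radj => //; left.
    have [D' [SD' iD' D'B]] := sup_immediate SD SB (conj DB nDB).
    have nR' : ~ R D' B.
      move=> R'; apply: nRD; apply: (Rtrans _ D' _ _ R'); apply: (Rtrans _ (c D')).
        by apply: Radj => //; [exact: Sc|exact: immediate_incident].
      by apply: Rsym; exact: Rc.
    by exists (exist _ D' (And3 SD' D'B nR')); case: iD'.
  have [f [_ fS]] := dependent_choice step (exist _ A (And3 SA AB nR)).
  apply: (@Sinc (fun n => sval (f n)) B) => // n.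
  - by case: (svalP (f n)).
  - have [h1 h2] := fS n; split=> // h3; apply: h2; exact/seteqP.
  - by case: (svalP (f n)).
move=> A B SA SB; case: (Snest SA SB) => [AB|BA|AcB|cAB].
- exact: Rsub.
- by apply: Rsym; exact: Rsub.
- apply: (Rtrans _ (c B)); first by apply: Rsub => //; exact: Sc.
  by apply: Rsym; exact: Rc.
- by apply: (Rtrans _ (c A)); [exact: Rc|apply: Rsub => //; exact: Sc].
Qed.

(* [inside C A]: the vertex at which [A] starts lies on the [C]-side of the edge [C]. *)
Definition inside (C A : set X) := exists A', [/\ S A', incident A A' & c A' `<=` C].

Definition outside (C A : set X) := exists A', [/\ S A', incident A A' & C `<=` A'].

Lemma inside_incident C A B : S A -> S B -> incident A B -> inside C A -> inside C B.
Proof.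
move=> SA SB AB [A' [SA' aA h]]; exists A'; split=> //.
by apply: incident_trans aA => //; exact: incident_sym.
Qed.

Lemma inside_outside C A : S C -> S A -> inside C A -> outside C A -> False.
Proof.
move=> SC SA [A' [SA' aA' h']] [B [SB aB h]].
have A'B := subset_trans h' h.
have : incident A' B by apply: incident_trans aB => //; exact: incident_sym.
move=> [e|[[AB nAB] _]]; first by rewrite e in A'B; exact: (not_c_sub SB).
by apply: nAB; apply/seteqP; split=> //; exact: cSr.
Qed.

Lemma outside_self C : S C -> outside C C.
Proof. by move=> SC; exists C; split=> //; left. Qed.

Lemma inside_c C : S C -> inside C (c C).
Proof. by move=> SC; exists (c C); split; [exact: Sc|left|rewrite ccK]. Qed.

Lemma inside_above C A : S C -> S A -> lts A C -> inside C A /\ inside C (c A).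
Proof.
move=> SC SA AC; split; last first.
  by exists (c A); split; [exact: Sc|left|rewrite ccK//; case: AC].
have [D [SD iD DC]] := sup_immediate SA SC AC.
by exists (c D); split; [exact: Sc|exact: immediate_incident|rewrite ccK].
Qed.

Lemma outside_below C A : S C -> S A -> lts C A -> outside C A /\ outside C (c A).
Proof.
move=> SC SA CA; split; first by exists A; split=> //; [left|case: CA].
have [D [SD iD CD]] := inf_immediate SC SA CA.
by exists D; split=> //; right; exact: immediatec.
Qed.

(** Nestedness puts [A] or its complement strictly above or strictly below [C]; so only the edge [C]
    itself joins the two sides of [C]. *)
Lemma inside_c_iff C A : S C -> S A -> C <> A -> C <> c A -> inside C A <-> inside C (c A).
Proof.
move=> SC SA nA ncA; have ScA := Sc SA.
have nAC : A <> C by exact: nesym.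
have ncAC : c A <> C by exact: nesym.
case: (Snest SC SA) => [CA|AC|CcA|cCA].
- have [k1 k2] := outside_below SC SA (conj CA nA).
  by split=> h; exfalso; [exact: inside_outside h k1|exact: inside_outside h k2].
- by have [i1 i2] := inside_above SC SA (conj AC nAC).
- have [k1 k2] := outside_below SC ScA (conj CcA ncA); rewrite ccK // in k2.
  by split=> h; exfalso; [exact: inside_outside h k2|exact: inside_outside h k1].
- have [i1 i2] := inside_above SC ScA (conj (cSr SC SA cCA) ncAC); rewrite ccK // in i2.
Qed.

End NestedSystem.

(** * Reduced walks and walls *)

Section ReducedWalks.
Context d (X : measurableType d).
Variables (T EC : X -> X -> Prop).

(* A walk alternates freely between [T]-steps (label [true]) and nontrivial [EC]-steps
   (label [false]); [l] records the label and the source of the previous step. *)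
Fixpoint reduced (l : option (bool * X)) (u : X) (s : seq (bool * X)) : Prop :=
  if s is (b, v) :: s' then
    (if b then T u v /\ l <> Some (true, v)
     else EC u v /\ u <> v /\ (forall w, l <> Some (false, w))) /\
    reduced (Some (b, u)) v s'
  else True.

Definition target (u : X) (s : seq (bool * X)) := last u (unzip2 s).

Fixpoint last_step (l : option (bool * X)) (u : X) (s : seq (bool * X)) :=
  if s is (b, v) :: s' then last_step (Some (b, u)) v s' else l.

Lemma reduced_cat l u s t : reduced l u (s ++ t) <->
  reduced l u s /\ reduced (last_step l u s) (target u s) t.
Proof.
elim: s l u => [|[b v] s ih] l u /=; first by split=> [|[]].
by rewrite ih /target /=; tauto.
Qed.

Lemma target_cat u s t : target u (s ++ t) = target (target u s) t.
Proof. by rewrite /target /unzip2 map_cat last_cat. Qed.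

Lemma last_step_cat l u s t : last_step l u (s ++ t) = last_step (last_step l u s) (target u s) t.
Proof. by elim: s l u => [|[b v] s ih] l u //=; rewrite ih. Qed.

Hypothesis walls : forall a b, T a b -> exists s : X -> Prop,
  [/\ ~ (s a <-> s b), (forall u v, EC u v -> (s u <-> s v)) &
      forall u v, T u v -> ~ (s u <-> s v) -> (u = a /\ v = b) \/ (u = b /\ v = a)].

Lemma wall_crossed (s : X -> Prop) l u t : (forall u v, EC u v -> (s u <-> s v)) ->
  reduced l u t -> ~ (s u <-> s (target u t)) ->
  exists t1 y t2, [/\ t = t1 ++ (true, y) :: t2, T (target u t1) y,
    s u <-> s (target u t1) & ~ (s (target u t1) <-> s y)].
Proof.
move=> sEC; elim: t l u => [|[b v] t ih] l u /=; first by move=> _ [].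
move=> [hb ht] ns.
have [suv|nsuv] := pselect (s u <-> s v).
  have [|t1 [y [t2 [-> Ty s1 s2]]]] := ih _ _ ht; first by rewrite -suv.
  by exists ((b, v) :: t1), y, t2; split=> //; rewrite suv.
case: b hb {ht} ns => [[Tuv _] _|[/sEC//]].
by exists [::], v, t.
Qed.

(** A closed walk must recross the wall of its first [T]-step, and only the same edge, in the
    opposite direction, can do so. The stretch in between is a shorter reduced closed walk, nonempty
    because immediate backtracking is excluded; induction on the length concludes. An initial
    [EC]-step is harmless, as it crosses no wall. *)
Theorem reduced_not_closed l u t : reduced l u t -> t <> [::] -> target u t <> u.
Proof.
have [n] := ubnP (size t); elim: n l u t => // n ih l u t tn ht t0 cl.
have main l' a b r : (size r < n)%N -> T a b -> reduced l' a ((true, b) :: r) ->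
    (forall s : X -> Prop, (forall u v, EC u v -> (s u <-> s v)) ->
      s a <-> s (target b r)) -> False.
  move=> rn Tab [_ hr] ha.
  have [s [nab sEC suniq]] := walls Tab.
  have [|r1 [y [r2 [er Ty s1 s2]]]] := wall_crossed sEC hr.
    by rewrite -(ha s sEC) => h; apply: nab; rewrite h.
  move: (hr); rewrite er => /reduced_cat[hr1 [[_ ny] _]].
  case: (suniq _ _ Ty s2) => [[e1 _]|[e1 e2]]; first by apply: nab; rewrite s1 e1.
  case: r1 er hr1 ny e1 {Ty s1 s2} => [|p r1] er hr1 ny e1.
    by apply: ny; rewrite e2.
  apply: (ih _ _ _ _ hr1) => //; apply: leq_ltn_trans rn.
  by rewrite er size_cat leq_addr.
case: t tn ht t0 cl => // -[[] v] t /= tn ht _ cl.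
  case: (ht) => -[Tuv _] _; apply: (main l u v t) => // s _.
  by rewrite /target /= in cl *; rewrite cl.
case: ht => -[Euv [uv _]] ht.
case: t tn ht cl => [|[[] w] t] tn ht cl.
- by apply: uv; rewrite -cl.
- case: (ht) => -[Tvw _] _; apply: (main _ v w t _ Tvw ht).
    by move: tn => /=; lia.
  by move=> s sEC; rewrite /target /= in cl *; rewrite cl (sEC _ _ Euv).
- by case: ht => -[_ [_ /(_ u)]].
Qed.

Lemma reduced_weaken l u s : reduced l u s -> reduced None u s.
Proof. by case: s => // -[[] v] s /= [[h1 h2] h3]; split=> //; split=> //; case: h2. Qed.

Lemma conn_reduced u v : clos_refl_trans X T u v ->
  exists s, [/\ reduced None u s, all (fun p => p.1) s & target u s = v].
Proof.
move=> /clos_rt_rt1n_iff; elim=> [w|{}u w {}v Tuw _ [s [hs ts sv]]]; first by exists [::].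
case: s hs ts sv => [|[[] w'] s] //= hs ts sv; first by exists [:: (true, w)].
have [e|nw'] := pselect (w' = u).
  exists s; rewrite -e; split=> //; case: hs => _; exact: reduced_weaken.
exists [:: (true, w), (true, w') & s]; split=> //; case: hs => -[Tww' _] hs.
by split=> //; split=> //; split=> // -[/esym].
Qed.

Lemma reduced_sequence (q : nat -> X) n l m :
  (forall i, (m <= i < m + n)%N -> T (q i) (q i.+1)) ->
  (forall i, (m <= i)%N -> (i.+1 < m + n)%N -> q i <> q i.+2) ->
  ((0 < n)%N -> l <> Some (true, q m.+1)) ->
  reduced l (q m) [seq (true, q i.+1) | i <- iota m n].
Proof.
elim: n l m => // n ih l m hT hq hl /=; split.
  by split; [apply: hT; lia|exact: hl].
apply: ih => [i im|i im im'|n0 []]; [by apply: hT; lia|by apply: hq; lia|].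
by apply: hq; lia.
Qed.

Lemma target_sequence (q : nat -> X) n m :
  target (q m) [seq (true, q i.+1) | i <- iota m n] = q (m + n)%N.
Proof.
elim: n m => [|n ih] m; first by rewrite addn0.
by rewrite addnS -addSn -ih.
Qed.

Theorem walls_acyclic : (forall x, ~ T x x) -> acyclic [set p | T p.1 p.2].
Proof.
move=> Tirr n p n3 pinj hp.
(* Since [n] is at least 3, [q i] and [q i.+2] are distinct, so the cycle read modulo [n] is a
   reduced walk. *)
pose q i := p (i %% n)%N.
have n0 : (0 < n)%N by lia.
have qn : q n = q 0%N by rewrite /q modnn mod0n.
have qS i : q i.+1 = p ((i %% n).+1 %% n)%N.
  by rewrite /q -addn1 -[((i %% n).+1)%N]addn1 modnDml.
have := @reduced_not_closed None (q 0%N) [seq (true, q i.+1) | i <- iota 0 n].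
apply.
- apply: reduced_sequence => // i _.
    by rewrite qS; exact: (hp _ (ltn_pmod i n0)).
  move=> _ /pinj; rewrite !ltn_mod => /(_ n0 n0) /eqP.
  rewrite -[X in X == _ %[mod _]]addn0 -addn2 eqn_modDl => /eqP.
  by rewrite !modn_small //; lia.
- by case: (n) n0.
- by rewrite target_sequence add0n.
Qed.

(** Expanding each step along the closure of [T] into a reduced [T]-walk, nonempty as its ends
    differ, turns the alternating cycle into a closed reduced walk: the [EC]-steps never become
    adjacent. *)
Theorem walls_free (n : nat) (x : nat -> X) : (1 <= n)%N -> x (2 * n)%N = x 0%N ->
  (forall i, (i < 2 * n)%N -> x i <> x i.+1) ->
  (forall i, (i < 2 * n)%N -> ~~ odd i -> clos_refl_trans X T (x i) (x i.+1)) ->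
  (forall i, (i < 2 * n)%N -> odd i -> EC (x i) (x i.+1)) -> False.
Proof.
move=> n1 xc xne xT xC.
have seg s u : all (fun p : bool * X => p.1) s -> s <> [::] ->
    exists w, forall l, last_step l u s = Some (true, w).
  elim: s u => // -[[] v] s ih u //= sT _; case: s sT ih => [|p s] sT ih.
    by exists u.
  by have [//|//|w h] := ih v; exists w.
have W j : (j <= n)%N -> exists s, [/\ reduced None (x 0%N) s, target (x 0%N) s = x (2 * j)%N,
    (forall w, last_step None (x 0%N) s <> Some (true, w)) & (0 < j)%N -> s <> [::]].
  elim: j => [|j ih] jn; first by exists [::].
  have [s [hs ts ls _]] := ih (ltnW jn).
  have j2 : (2 * j < 2 * n)%N by lia.
  have j21 : ((2 * j).+1 < 2 * n)%N by lia.
  have o2 : ~~ odd (2 * j) by rewrite oddM.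
  have [t [ht tT et]] := conn_reduced (xT _ j2 o2).
  have t0 : t <> [::] by move=> t0; apply: (xne _ j2); rewrite -et t0.
  have [w hw] := seg t (x (2 * j)%N) tT t0.
  exists (s ++ t ++ [:: (false, x (2 * j).+2)]); split.
  - apply/reduced_cat; split=> //; rewrite ts; apply/reduced_cat; split.
      case: t ht tT t0 {et hw} => // -[[] v] t //= [[Tv _] ht] _ _; split=> //; split=> //.
    rewrite hw et /=; split=> //; split; first by apply: xC => //=; rewrite o2.
    by split; [exact: xne|].
  - by rewrite !target_cat /target /=; congr x; lia.
  - by move=> w'; rewrite !last_step_cat /=.
  - by move=> _; case: (s) => //; case: (t).
have [s [hs ts _ s0]] := W n (leqnn n).
by apply: (reduced_not_closed hs (s0 n1)); rewrite ts xc.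
Qed.

End ReducedWalks.

(** * The structure tree of a collection of cuts *)

Section Boundary.
Context d (X : measurableType d) (G : set (X * X)).
Hypothesis Gsym : forall x y, G (x, y) -> G (y, x).

Lemma conn_trans x y z : conn G x y -> conn G y z -> conn G x z.
Proof. exact: rt_trans. Qed.

Lemma conn_sym x y : conn G x y -> conn G y x.
Proof.
elim=> [a b /Gsym|a|a b c _ h1 _ h2]; [exact: rt_step|exact: rt_refl|].
exact: rt_trans h2 h1.
Qed.

Definition off_boundary (B : set (X * X)) (u v : X) :=
  G (u, v) /\ (~ B (u, v) /\ ~ B (v, u)).

(** Recovers a cut from its boundary alone, by walks that start at the tails of the boundary edges
    and avoid the boundary. Through this formula cuts enter Borel computations. *)
Definition inner_side (B : set (X * X)) : set X :=
  [set y | exists p, B p /\ clos_refl_trans X (off_boundary B) p.1 y].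

Lemma boundary_crossed A y b : conn G y b -> A y -> ~ A b ->
  exists p, bdry G A p /\ clos_refl_trans X (off_boundary (bdry G A)) p.1 y.
Proof.
move=> /clos_rt_rt1n_iff; elim=> // {}y v {}b yv _ ih Ay nAb.
have [Av|nAv] := pselect (A v).
  have [p [Bp pv]] := ih Av nAb; exists p; split=> //; apply: rt_trans pv _.
  apply: rt_step; split; first exact: Gsym.
  by split=> -[_ [_ [_]]].
exists (y, v); split; last exact: rt_refl.
by split=> //; split=> //; split=> //; exists y => //; exact: rt_step.
Qed.

Lemma inner_side_bdry A : is_cut G A -> inner_side (bdry G A) = A.
Proof.
move=> [[x0 Ax0] [iA [iA' _]]]; apply/seteqP; split=> y.
  move=> [p [[_ [Ap _]] /clos_rt_rtn1_iff h]]; elim: h => // u v [Guv [nB _]] _ Au.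
  apply: contrapT => nAv; apply: nB; split=> //; split=> //; split=> //.
  by exists u => //; exact: rt_step.
move=> Ay; have [b [[a Aa ab] nAb]] : cstar G A !=set0.
  by apply/set0P/negP => /eqP e; apply: iA'; rewrite e.
apply: (boundary_crossed _ Ay nAb); apply: conn_trans ab.
apply: conn_trans (Ax0 _ Aa); apply: conn_sym; exact: Ax0.
Qed.

End Boundary.

Lemma mp_tuple d (X : measurableType d) n (A : set ('I_n -> X * X)) (t : X -> 'I_n -> X * X) :
  tuple_measurable A -> (forall i, measurable_fun setT (fun x => t x i)) ->
  mp (fun x => A (t x)).
Proof.
move=> mA mt; move: A mA; apply: smallest_sub; last first.
  by move=> _ [i _ [B mB <-]]; exact: (mp_pre (mt i) mB).
split=> [|A hA|A hA].
- exact: measurable0.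
- by rewrite setTD; exact: mp_not hA.
- apply: mp_ext (mp_ex hA) => x; split=> [[k h]|[k _ h]]; by exists k.
Qed.

(** * Cuts of a class as a nested system, and their Borel coding *)

Section Cuts.
Context d (X : measurableType d).
Variables (E G : set (X * X)) (CC : set (set X)).
Variables (U : nat -> set X) (e : nat -> X -> X).
Hypothesis sepU : separating U.
Hypothesis mU : forall n, measurable (U n).
Hypothesis me : forall n, measurable_fun setT (e n).
Hypothesis Ee : forall x y, E (x, y) <-> exists n, y = e n x.
Hypothesis Erefl : forall x, E (x, x).
Hypothesis Esym : forall x y, E (x, y) -> E (y, x).
Hypothesis Etrans : forall x y z, E (x, y) -> E (y, z) -> E (x, z).
Hypothesis mG : measurable G.
Hypothesis Gsym : forall x y, G (x, y) -> G (y, x).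
Hypothesis Gconn : forall x y, E (x, y) <-> conn G x y.
Hypothesis CCcut : CC `<=` is_cut G.
Hypothesis CCb : borel_fin (bdry G @` CC).
Hypothesis CCdual : self_dual G CC.
Hypothesis CCnest : nested G CC.
Hypothesis CCchain : chain_vanishing G CC.

Definition cls (x : X) : set X := [set y | E (x, y)].
Definition cuts (x : X) : set (set X) := [set A | CC A /\ A `<=` cls x].
Local Notation c x A := (cls x `\` A).

Lemma cls_eq x y : E (x, y) -> cls x = cls y.
Proof.
by move=> xy; apply/seteqP; split=> z; apply: Etrans => //; exact: Esym.
Qed.

Lemma cuts_eq x y : E (x, y) -> cuts x = cuts y.
Proof. by move=> xy; rewrite /cuts (cls_eq xy). Qed.

Lemma cut_nonempty A : CC A -> A !=set0.
Proof.
by move=> /CCcut[_ [iA _]]; apply/set0P/negP => /eqP e0; apply: iA; rewrite e0.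
Qed.

Lemma cut_cls A x : CC A -> A x -> A `<=` cls x.
Proof.
move=> /CCcut[[z Az] _] Ax y Ay; apply: (Etrans (y := z)).
  by apply: Esym; apply/Gconn; exact: Az.
by apply/Gconn; exact: Az.
Qed.

Lemma cuts_in A x : CC A -> A x -> cuts x A.
Proof. by move=> cA Ax; split=> //; exact: cut_cls. Qed.

Lemma cstarE x A : A `<=` cls x -> A !=set0 -> cstar G A = c x A.
Proof.
move=> Ax [a Aa]; apply/seteqP; split=> y [h nA]; split=> //.
  by case: h => b Ab /Gconn by'; apply: Etrans by'; exact: Ax.
by exists a => //; apply/Gconn; apply: Etrans h; apply: Esym; exact: Ax.
Qed.

Lemma cuts_star x A : cuts x A -> cstar G A = c x A.
Proof. by move=> [cA Ax]; apply: cstarE => //; exact: cut_nonempty. Qed.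

Lemma cuts_sub x A : cuts x A -> A `<=` cls x. Proof. by case. Qed.

Lemma cuts_nonempty x A : cuts x A -> A !=set0. Proof. by move=> [/cut_nonempty]. Qed.

Lemma cuts_c x A : cuts x A -> cuts x (c x A).
Proof.
by move=> cA; split; [rewrite -(cuts_star cA); apply: CCdual; case: cA|move=> y []].
Qed.

Lemma cuts_same x A B : cuts x A -> cuts x B -> same_comp G A B.
Proof.
move=> cA cB; have [a Aa] := cuts_nonempty cA; have [b Bb] := cuts_nonempty cB.
exists a, b; split=> //; split=> //; apply/Gconn; apply: (Etrans (y := x)).
  by apply: Esym; exact: (cuts_sub cA).
exact: (cuts_sub cB).
Qed.

Lemma disjointP x (A B : set X) : A `<=` cls x -> (A `&` B = set0 <-> A `<=` c x B).
Proof.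
move=> Ax; split=> [e0 y Ay|h]; first split.
- exact: Ax.
- by move=> By; have : (A `&` B) y by []; rewrite e0.
- by apply/seteqP; split=> // y [/h[]].
Qed.

Lemma cuts_nest x A B : cuts x A -> cuts x B ->
  [\/ A `<=` B, B `<=` A, A `<=` c x B | c x A `<=` B].
Proof.
move=> cA cB; have sAB := cuts_same cA cB.
have ccA := ccK (@cuts_sub x) cA; have ccB := ccK (@cuts_sub x) cB.
have := CCnest (proj1 cA) (proj1 cB) sAB.
rewrite (cuts_star cA) (cuts_star cB).
have sA := cuts_sub cA; have sC : c x A `<=` cls x by move=> ? [].
case=> [/(disjointP _ sA) h|[/(disjointP _ sA) h|[/(disjointP _ sC) h|/(disjointP _ sC) h]]].
- exact: Or43.
- by rewrite ccB in h; exact: Or41.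
- by apply: Or42; exact: (cS' (@cuts_sub x) cB cA h).
- by rewrite ccB in h; exact: Or44.
Qed.

Lemma cuts_dec x (A : nat -> set X) B : (forall n, cuts x (A n)) -> cuts x B ->
  (forall n, A n.+1 `<` A n) -> ~ forall n, B `<=` A n.
Proof.
move=> cA cB dA BA; apply: (CCchain.1 A) => //; first by move=> n; case: (cA n).
exists B; split; first by case: cB.
by split=> //; exact: cuts_same cB (cA 0%N).
Qed.

Lemma cuts_inc x (A : nat -> set X) B : (forall n, cuts x (A n)) -> cuts x B ->
  (forall n, A n `<` A n.+1) -> ~ forall n, A n `<=` B.
Proof.
move=> cA cB iA AB; apply: (CCchain.2 A) => //; first by move=> n; case: (cA n).
have cB' := cuts_c cB; exists (c x B); split; first by case: cB'.
split; first exact: cuts_same cB' (cA 0%N).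
by move=> n; apply/seteqP; split=> // y [[_ nB] /AB].
Qed.

Definition adj (x : X) := incident (cls x) (cuts x).

(** Inside one class, [perp G A B] says that [A] lies strictly below the complement of [B]. The
    clause on [D] then forbids cuts strictly in between, which is immediacy in the abstract nested
    system. *)
Lemma cut_simE x A B : cuts x A -> cut_sim G CC A B <-> cuts x B /\ adj x A B.
Proof.
move=> cA; have sA := cuts_sub cA; split.
  move=> [_ [CB [[a [b [Aa [Bb ab]]]] h]]].
  have cB : cuts x B.
    split=> //; rewrite (_ : cls x = cls b); first exact: cut_cls.
    by apply: cls_eq; apply: Etrans (sA _ Aa) _; apply/Gconn.
  split=> //; case: h => [->|[[dAB nAB] nD]]; first by left.
  right; rewrite (cuts_star cB) in nAB; split.
    by split=> //; apply/(disjointP _ sA).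
  move=> D cD [AD nAD] [DB nDB]; apply: nD; exists D; split; first by case: cD.
  split; first by split=> // DA; apply: nAD; apply/seteqP.
  split; last by rewrite (cuts_star cB).
  by apply/(disjointP _ (cuts_sub cD)).
move=> [cB aAB]; split; first by case: cA.
split; first by case: cB.
split; first exact: cuts_same cA cB.
case: aAB => [->|[[AB nAB] h]]; [by left|right]; split.
  by split; [apply/(disjointP _ sA)|rewrite (cuts_star cB)].
move=> [D [CD [[AD nDA] [dD nD]]]].
have [a Aa] := cuts_nonempty cA.
have cD : cuts x D.
  split=> //; rewrite (_ : cls x = cls a); first by apply: cut_cls => //; exact: AD.
  by apply: cls_eq; exact: sA.
apply: (h D) => //; first by split=> // e0; apply: nDA; rewrite e0.
by split; [apply/(disjointP _ (cuts_sub cD))|rewrite -(cuts_star cB)].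
Qed.

Lemma sim_refl A : CC A -> cut_sim G CC A A.
Proof.
move=> CA; have [a Aa] := cut_nonempty CA; apply/(cut_simE _ (cuts_in CA Aa)).
by split; [exact: cuts_in|left].
Qed.

Lemma sim_in x A B : cuts x A -> cut_sim G CC A B -> cuts x B.
Proof. by move=> cA /(cut_simE _ cA)[]. Qed.

Lemma sim_sym A B : cut_sim G CC A B -> cut_sim G CC B A.
Proof.
move=> h; have CA := proj1 h; have [a Aa] := cut_nonempty CA; have cA := cuts_in CA Aa.
have [cB aAB] := (cut_simE B cA).1 h; apply/(cut_simE _ cB); split=> //.
exact: (incident_sym (@cuts_sub a) (@cuts_c a)).
Qed.

Lemma sim_trans A B D : cut_sim G CC A B -> cut_sim G CC B D -> cut_sim G CC A D.
Proof.
move=> h; have CA := proj1 h; have [a Aa] := cut_nonempty CA; have cA := cuts_in CA Aa.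
have [cB aAB] := (cut_simE B cA).1 h => /(cut_simE _ cB)[cD aBD].
apply/(cut_simE _ cA); split=> //.
exact: (incident_trans (@cuts_sub a) (@cuts_nonempty a) (@cuts_c a) (@cuts_nest a)) aBD.
Qed.

(** A code [k] names boundary edges by indices relative to a base point [x]. There are countably
    many codes, so quantifiers over the cuts of a class become countable, at the price that the name
    of a cut depends on the base point. *)
Definition tup (k : seq (nat * nat)) (x : X) (i : 'I_(size k)) : X * X :=
  (e (tnth (in_tuple k) i).1 x, e (tnth (in_tuple k) i).2 x).

Definition bd k x : set (X * X) := range (tup (k := k) x).

(** Injectivity matches the repetition-free tuples by which [borel_fin] tests a family of finite
    sets. *)
Definition valid k x := injective (tup (k := k) x) /\ (bdry G @` CC) (bd k x).

Definition cutof k x : set X := inner_side G (bd k x).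

Lemma E_en n x : E (x, e n x).
Proof. by apply/Ee; exists n. Qed.

Lemma valid_cut k x : valid k x -> bdry G (cutof k x) = bd k x /\ cuts x (cutof k x).
Proof.
move=> [_ [A CA eA]]; rewrite /cutof -eA inner_side_bdry //; last exact: CCcut.
split=> //; have [a Aa] := cut_nonempty CA.
have [b [[a' Aa' ab] nAb]] : cstar G A !=set0.
  by apply: cut_nonempty; exact: CCdual.
have [p [Bp _]] := boundary_crossed Gsym ab Aa' nAb.
have Ap : A p.1 by case: Bp => _ [].
move: Bp; rewrite eA => -[i _ ep]; split=> //.
rewrite (_ : cls x = cls p.1); first exact: cut_cls.
by apply: cls_eq; rewrite -ep; exact: E_en.
Qed.

Lemma inner_side_cls k x : cutof k x `<=` cls x.
Proof.
move=> y [_ [[i _ <-] /clos_rt_rtn1_iff h]]; elim: h => [|u v [Guv _] _]; first exact: E_en.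
by move=> /Etrans; apply; apply/Gconn; exact: rt_step.
Qed.

Lemma cut_code x A : cuts x A -> exists k, valid k x /\ cutof k x = A.
Proof.
move=> cA; have [CA Ax] := cA; have [_ [_ [_ /finite_seqP[s es]]]] := CCcut CA.
have /choice[ix hix] : forall y, exists n, cls x y -> e n x = y.
  move=> y; have [/Ee[n ->]|ny] := pselect (cls x y); first by exists n.
  by exists 0%N.
pose s' := undup s; pose k := [seq (ix p.1, ix p.2) | p <- s'].
have Bs p : bdry G A p -> p \in s' by rewrite es /= mem_undup.
have sB p : p \in s' -> bdry G A p by rewrite mem_undup es.
have sk : size k = size s' by rewrite size_map.
have hB p : bdry G A p -> e (ix p.1) x = p.1 /\ e (ix p.2) x = p.2.
  move=> [_ [Ap Ap2]]; split; apply: hix; first exact: Ax.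
  by move: Ap2; rewrite (cuts_star cA) => -[].
have tk (i : 'I_(size k)) : tup x i = nth (x, x) s' i.
  have si : (i < size s')%N by rewrite -sk.
  rewrite /tup (tnth_nth (0, 0)%N) /= (nth_map (x, x)) //=.
  have [-> ->] := hB _ (sB _ (mem_nth (x, x) si)); by case: (nth _ _ _).
have ek : bd k x = bdry G A.
  apply/seteqP; split=> [_ [i _ <-]|p Bp].
    by rewrite tk; apply: sB; apply: mem_nth; rewrite -sk.
  have ip : (index p s' < size k)%N by rewrite sk index_mem; exact: Bs.
  by exists (Ordinal ip) => //; rewrite tk /= nth_index //; exact: Bs.
exists k; split; last by rewrite /cutof ek inner_side_bdry //; exact: CCcut.
split; last by exists A.
move=> i j; rewrite !tk => /eqP; rewrite nth_uniq ?undup_uniq -?sk // => /eqP ij.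
exact: val_inj.
Qed.

Lemma mp_valid k : mp (valid k).
Proof.
have mt i : measurable_fun setT (fun x => tup (k := k) x i).
  by apply: measurable_fun_pair; exact: me.
have hb := CCb (n := size k).
exact: (mp_tuple hb mt).
Qed.

Lemma mp_bd k u v : mf u -> mf v -> mp (fun x => bd k x (u x, v x)).
Proof.
move=> mu mv; apply: (@mp_ext _ _ (fun x => exists i : 'I_(size k),
   e (tnth (in_tuple k) i).1 x = u x /\ e (tnth (in_tuple k) i).2 x = v x)).
  move=> x; split=> [[i [h1 h2]]|[i _ [h1 h2]]]; exists i => //.
  by rewrite /tup h1 h2.
by apply: mp_ex => i; apply: mp_and; apply: (mp_eq sepU mU) => //; exact: me.
Qed.

(** Since every step stays in a class, walks of length [n] are described by quantifiers over class
    points. The first argument of [h] allows walks that avoid a boundary depending on [x]. *)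
Lemma mp_clos (h : X -> X -> X -> Prop) : (forall x u v, h x u v -> E (u, v)) ->
  (forall f g, mf f -> mf g -> mp (fun x => h x (f x) (g x))) ->
  forall f g, mf f -> mf g -> mp (fun x => clos_refl_trans X (h x) (f x) (g x)).
Proof.
move=> hE mh.
pose fix walk (n : nat) (x u v : X) {struct n} : Prop := if n is m.+1 then exists w, E (u, w) /\ (h x u w /\ walk m x w v)
  else u = v.
have walkP x u v : clos_refl_trans X (h x) u v <-> exists n, walk n x u v.
  split=> [/clos_rt_rt1n_iff|[n]].
    elim=> [w|w w' w'' hw _ [n hn]]; first by exists 0%N.
    by exists n.+1, w'; split=> //; exact: hE hw.
  elim: n u => [u <-|n ih u [w [_ [uw /ih wv]]]]; first exact: rt_refl.
  by apply: rt_trans wv; exact: rt_step.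
move=> f g hf hg; apply: (mp_ext (fun x => iff_sym (walkP x (f x) (g x)))).
apply: mp_ex => n; elim: n f hf => [|n ih] f hf /=; first exact: (mp_eq sepU mU).
apply: (mp_exE (E := fun x y => E (x, y)) Ee) => m; apply: mp_and.
  by apply: mh => //; exact: (mf_e me).
by apply: ih; exact: (mf_e me).
Qed.

Lemma mp_E f g : mf f -> mf g -> mp (fun x => E (f x, g x)).
Proof.
move=> hf hg; apply: (mp_ext (P := fun x => exists n, g x = e n (f x))).
  by move=> x; apply: iff_sym; exact: Ee.
by apply: mp_ex => n; apply: (mp_eq sepU mU) => //; exact: (mf_e me).
Qed.

Lemma mp_G f g : mf f -> mf g -> mp (fun x => G (f x, g x)).
Proof. by move=> hf hg; apply: (mp_pre (P := G)) mG; exact: measurable_fun_pair. Qed.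

Lemma mp_cutof k f g : mf f -> mf g -> mp (fun x => cutof k (f x) (g x)).
Proof.
apply: mp_rel; apply: (mrel_build sepU mU me Ee).
  by move=> x y; exact: inner_side_cls.
move=> n; apply: (@mp_ext _ _ (fun x => exists i : 'I_(size k),
    clos_refl_trans X (off_boundary G (bd k x)) (e (tnth (in_tuple k) i).1 x) (e n x))).
  move=> x; split=> [[i h]|[_ [[i _ <-] h]]]; last by exists i.
  by exists (tup x i); split=> //; exists i.
apply: mp_ex => i; apply: mp_clos => //; try exact: me.
  by move=> x u v [Guv _]; apply/Gconn; exact: rt_step.
move=> u v hu hv; apply: mp_and; first exact: mp_G.
by apply: mp_and; apply: mp_not; exact: mp_bd.
Qed.

(* Borel assignments of a subset of the class of [x] to [x]. *)
Definition msetb (A : X -> set X) :=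
  (forall x, A x `<=` cls x) /\ forall g, mf g -> mp (fun x => A x (g x)).

Lemma msetb_cutof k f : mf f -> (forall x, E (x, f x)) -> msetb (fun x => cutof k (f x)).
Proof.
move=> hf Ef; split=> [x|g hg]; last exact: mp_cutof.
by rewrite (cls_eq (Ef x)); exact: inner_side_cls.
Qed.

Lemma mp_exP P : (forall n, mp (fun x => P x (e n x))) ->
  mp (fun x => exists y, E (x, y) /\ P x y).
Proof. by move=> h; apply: (mp_exE (E := fun x y => E (x, y)) Ee (f := id)). Qed.

Lemma mp_allP P : (forall n, mp (fun x => P x (e n x))) ->
  mp (fun x => forall y, E (x, y) -> P x y).
Proof. by move=> h; apply: (mp_allE (E := fun x y => E (x, y)) Ee (f := id)). Qed.

Lemma mp_subset A B : msetb A -> msetb B -> mp (fun x => A x `<=` B x).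
Proof.
move=> [Ax hA] [_ hB]; apply: (@mp_ext _ _ (fun x => forall y, E (x, y) -> A x y -> B x y)).
  by move=> x; split=> [h y Ay|h y _]; [apply: h => //; exact: Ax|exact: h].
by apply: mp_allP => n; apply: mp_imp; [apply: hA|apply: hB]; exact: me.
Qed.

Lemma mp_seteq A B : msetb A -> msetb B -> mp (fun x => A x = B x).
Proof.
move=> hA hB; apply: mp_ext (mp_and (mp_subset hA hB) (mp_subset hB hA)) => x.
by split=> [[h1 h2]|->//]; exact/seteqP.
Qed.

Lemma msetb_cstar A : msetb A -> msetb (fun x => cstar G (A x)).
Proof.
move=> [Ax hA]; split=> [x y [[z Az /Gconn zy] _]|g hg].
  by apply: Etrans zy; exact: Ax.
apply: mp_and; last by apply: mp_not; exact: hA.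
apply: (@mp_ext _ _ (fun x => exists y, E (x, y) /\ (A x y /\ E (y, g x)))).
  move=> x; split=> [[y [_ [Ay Ey]]]|[y Ay /Gconn Ey]]; exists y => //; first exact/Gconn.
  by split=> //; exact: Ax.
by apply: mp_exP => n; apply: mp_and; [apply: hA|apply: mp_E => //]; exact: me.
Qed.

Lemma mp_exC P : (forall k, mp (fun x => valid k x /\ P x (cutof k x))) ->
  mp (fun x => exists A, cuts x A /\ P x A).
Proof.
move=> h; apply: mp_ext (mp_ex h) => x; split=> [[k [/valid_cut[_ cA] hP]]|[A [cA PA]]].
  by exists (cutof k x).
by have [k [vk ek]] := cut_code cA; exists k; rewrite ek.
Qed.

Lemma mp_cuts A : msetb A -> mp (fun x => cuts x (A x)).
Proof.
move=> hA; apply: (@mp_ext _ _ (fun x => exists B, cuts x B /\ B = A x)).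
  by move=> x; split=> [[B [cB <-]]//|cA]; exists (A x).
apply: mp_exC => k; apply: mp_and; first exact: mp_valid.
by apply: mp_seteq => //; apply: msetb_cutof => //; exact: measurable_id.
Qed.

Lemma mp_sim A B : msetb A -> msetb B -> mp (fun x => cut_sim G CC (A x) (B x)).
Proof.
move=> hA hB.
have mperp D D' : msetb D -> msetb D' -> mp (fun x => perp G (D x) (D' x)).
  move=> hD hD'; apply: mp_and; last by apply: mp_not; apply: mp_seteq => //; exact: msetb_cstar.
  apply: (@mp_ext _ _ (fun x => forall y, E (x, y) -> D x y -> ~ D' x y)).
    move=> x; split=> [h|h y _ Dy Dy']; last by have : (D x `&` D' x) y by []; rewrite h.
    by apply/seteqP; split=> // y [Dy Dy']; apply: (h y) => //; case: hD => + _; apply.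
  apply: mp_allP => n; apply: mp_imp; first by case: hD => _; apply; exact: me.
  by apply: mp_not; case: hD' => _; apply; exact: me.
apply: (@mp_ext _ _ (fun x => cuts x (A x) /\ (cuts x (B x) /\ (A x = B x \/
  (perp G (A x) (B x) /\ ~ exists D, cuts x D /\ (A x `<=` D /\ (~ D `<=` A x /\
    perp G D (B x)))))))).
  move=> x; split.
    move=> [cA [cB h]]; split; first by case: cA.
    split; first by case: cB.
    split; first exact: cuts_same cA cB.
    case: h => [->|[h1 h2]]; [by left|right; split=> //].
    move=> [D [CD [[AD DA] hp]]]; apply: h2; exists D; split; last by [].
    have [a Aa] := cuts_nonempty cA; rewrite (_ : cuts x = cuts a); last first.
      by apply: cuts_eq; exact: (cuts_sub cA).
    by apply: cuts_in => //; exact: AD.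
  move=> [CA [CB [_ h]]]; split; first by split=> //; case: hA => + _; apply.
  split; first by split=> //; case: hB => + _; apply.
  case: h => [->|[h1 h2]]; [by left|right; split=> //].
  by move=> [D [[CD _] [AD [DA hp]]]]; apply: h2; exists D.
apply: mp_and; first exact: mp_cuts.
apply: mp_and; first exact: mp_cuts.
apply: mp_or; first exact: mp_seteq.
apply: mp_and; first exact: mperp.
apply: mp_not; apply: mp_exC => k.
have hk : msetb (cutof k) by apply: msetb_cutof => //; exact: measurable_id.
apply: mp_and; first exact: mp_valid.
apply: mp_and; first exact: mp_subset.
by apply: mp_and; [apply: mp_not; exact: mp_subset|exact: mperp].
Qed.

(** * Attaching a cut to every point *)

Hypothesis Utot : forall x y, (forall n, U n x -> U n y) \/ (forall n, U n y -> U n x).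
Hypothesis CCcomplete : G_complete G CC.

Definition mpt (g : X -> X) := mf g /\ forall x, E (x, g x).

Lemma mpt_id : mpt id. Proof. by split=> [|x]; [exact: measurable_id|exact: Erefl]. Qed.

Lemma mpt_e n g : mpt g -> mpt (fun x => e n (g x)).
Proof.
move=> [mg Eg]; split=> [|x]; first exact: (mf_e me).
by apply: Etrans (Eg x) _; exact: E_en.
Qed.

Lemma mpt_en n : mpt (e n). Proof. exact: (@mpt_e n id mpt_id). Qed.

Definition code_of (n : nat) : seq (nat * nat) := odflt [::] (unpickle n).
Definition vl n := valid (code_of n).
Definition ct n := cutof (code_of n).

Lemma cut_ct x A : cuts x A -> exists n, vl n x /\ ct n x = A.
Proof.
by move=> /cut_code[k hk]; exists (pickle k); rewrite /vl /ct /code_of pickleK.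
Qed.

Lemma vl_cut n x : vl n x -> cuts x (ct n x).
Proof. by move=> /valid_cut[]. Qed.

Lemma msetb_ct n g : mpt g -> msetb (fun x => ct n (g x)).
Proof. by move=> [mg Eg]; exact: msetb_cutof. Qed.

Lemma mp_vl n g : mpt g -> mp (fun x => vl n (g x)).
Proof. by move=> [mg _]; exact: (mp_pre mg (mp_valid _)). Qed.

Lemma class_infinite x : infinite_set (cls x).
Proof.
have [C [CCC Cx]] := CCcomplete x; have [_ [iC _]] := CCcut CCC.
by apply: sub_infinite_set iC => y /Cx h; apply/Gconn.
Qed.

Lemma cuts_exist x : exists A, cuts x A.
Proof.
have [C [CCC Cx]] := CCcomplete x; exists C; split=> // y /Cx h; exact/Gconn.
Qed.

(* The vertex of [A] read off from base points: those [z] for which the [n]-th code,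
   interpreted at [z], gives a cut at this vertex. *)
Definition fiber n A : set X := [set z | vl n z /\ cut_sim G CC (ct n z) A].

Definition finite_fiber n A := fiber n A !=set0 /\ finite_set (fiber n A).

(** A finite nonempty fiber has a least point for the order given by [Utot], hence yields a base
    point that depends only on the vertex. *)
Definition selectable A := exists n, finite_fiber n A.

Lemma fiber_sim n A B : cut_sim G CC A B -> fiber n A = fiber n B.
Proof.
move=> AB; apply/seteqP; split=> z [vz h]; split=> //; apply: sim_trans h _ => //.
exact: sim_sym.
Qed.

Lemma finite_fiber_sim n A B : cut_sim G CC A B -> finite_fiber n A <-> finite_fiber n B.
Proof. by move=> AB; rewrite /finite_fiber (fiber_sim n AB). Qed.

Lemma selectable_sim A B : cut_sim G CC A B -> selectable A -> selectable B.
Proof. by move=> AB [n h]; exists n; apply/(finite_fiber_sim _ AB). Qed.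

Lemma fiber_cls n A x z : A `<=` cls x -> fiber n A z -> E (x, z).
Proof.
move=> Ax [vz h]; have [_ Az] := sim_in (vl_cut vz) h.
have [a Aa] := cut_nonempty (proj1 (proj2 h)).
by apply: Etrans (Ax _ Aa) _; apply: Esym; exact: Az.
Qed.

Lemma mp_fiber n A g : msetb A -> mpt g -> mp (fun x => fiber n (A x) (g x)).
Proof.
move=> hA hg; apply: mp_and; first exact: mp_vl.
by apply: mp_sim => //; exact: msetb_ct.
Qed.

Lemma mp_finite_fiber n A : msetb A -> mp (fun x => finite_fiber n (A x)).
Proof.
move=> hA; apply: mp_and.
  apply: (@mp_ext _ _ (fun x => exists y, E (x, y) /\ fiber n (A x) y)).
    move=> x; split=> [[y [_ h]]|[y h]]; exists y => //; split=> //.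
    by apply: fiber_cls h; case: hA.
  by apply: mp_exP => m; apply: mp_fiber => //; exact: mpt_en.
apply: (@mp_ext _ _ (fun x => ~ infinite_set [set y | E (x, y) /\ fiber n (A x) y])).
  move=> x; rewrite (_ : [set y | E (x, y) /\ _] = fiber n (A x)).
    by split=> [/contrapT|h].
  apply/seteqP; split=> y; first by case.
  by move=> h; split=> //; apply: fiber_cls h; case: hA.
apply: mp_not; apply: (mp_infinite sepU mU me (E := fun x y => E (x, y)) Ee (f := id)).
  exact: measurable_id.
by move=> m; apply: mp_fiber => //; exact: mpt_en.
Qed.

Lemma mp_selectable A : msetb A -> mp (fun x => selectable (A x)).
Proof. by move=> hA; apply: mp_ex => n; exact: mp_finite_fiber. Qed.

(** At a vertex that is not selectable, every nonempty fiber is infinite. The fibers of code [n] at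
    such vertices are the classes of [F n], and [class_matching] represents them all, for every [n],
    by points each serving a single fiber; [pi x] is the cut named at the represented point. *)
Lemma vertex_map : exists pi : X -> set X, [/\ (forall x, cuts x (pi x)),
  (forall h g, mf h -> mf g -> mp (fun x => pi (h x) (g x))),
  (forall S, borel_fin S -> mp (fun x => S (bdry G (pi x)))) &
  (forall A, CC A -> ~ selectable A -> exists x, cut_sim G CC (pi x) A)].
Proof.
pose D n x := vl n x /\ ~ selectable (ct n x).
pose F n x y := D n x /\ D n y /\ cut_sim G CC (ct n x) (ct n y).
have mct n : msetb (ct n) by exact: (@msetb_ct n id mpt_id).
have mD n g : mpt g -> mp (fun x => D n (g x)).
  move=> hg; apply: mp_and; first exact: mp_vl.
  by apply: mp_not; apply: mp_selectable; exact: msetb_ct.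
have FE n x y : F n x y -> E (x, y).
  move=> [[vx _] [[vy _] s]]; apply: (fiber_cls (n := n)); last first.
    by split; [exact: vy|apply: sim_sym; exact: s].
  by apply: cuts_sub; exact: vl_cut.
have FD n x : F n x x <-> D n x.
  split=> [[]//|Dx]; split=> //; split=> //; apply: sim_refl.
  by have [vx _] := Dx; have [] := vl_cut vx.
have Fsym n x y : F n x y -> F n y x by move=> [h1 [h2 h3]]; split=> //; split=> //; exact: sim_sym.
have Ftrans n x y z : F n x y -> F n y z -> F n x z.
  by move=> [h1 [_ h3]] [_ [h4 h5]]; split=> //; split=> //; exact: sim_trans h3 h5.
have mF n : mrel (F n).
  apply: (mrel_build sepU mU me Ee (FE n)) => m.
  apply: mp_and; first by apply: (mD n id); exact: mpt_id.
  apply: mp_and; first by apply: mD; exact: mpt_en.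
  by apply: mp_sim => //; apply: msetb_ct; exact: mpt_en.
have Finf n x : D n x -> infinite_set [set y | F n x y].
  move=> Dx; have [vx nsel] := Dx => fin; apply: (nsel); exists n; split.
    exists x; split=> //; apply: sim_refl; by have [] := vl_cut vx.
  apply: sub_finite_set fin => y [vy s]; split=> //; split; last exact: sim_sym.
  by split=> //; apply: contra_not nsel => hs; exact: selectable_sim s hs.
have [M [mM ME Mfun Msurj]] := class_matching sepU mU me (E := fun x y => E (x, y)) Ee
  Erefl Esym Etrans mF FE FD Fsym Ftrans Finf class_infinite.
(* Points that represent nothing still need a value: the first valid code read at the point
   itself. *)
pose dflt n x := vl n x /\ forall m, (m < n)%N -> ~ vl m x.
pose Pm n x y := M n x y \/ ((~ exists m y', E (x, y') /\ M m x y') /\ (y = x /\ dflt n x)).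
have Pex x : exists ny : nat * X, Pm ny.1 x ny.2.
  have [[m [y' [_ h]]]|h] := pselect (exists m y', E (x, y') /\ M m x y').
    by exists (m, y'); left.
  have [A cA] := cuts_exist x; have [n [vn _]] := cut_ct cA.
  have [k [vk lk]] : exists k, vl k x /\ forall m, (m < k)%N -> ~ vl m x.
    by apply: least; exists n.
  by exists (k, x); right.
have Pfun n n' x y y' : Pm n x y -> Pm n' x y' -> n = n' /\ y = y'.
  move=> [h|[h1 [-> [h2 h3]]]] [h'|[h1' [-> [h2' h3']]]].
  - exact: Mfun h h'.
  - by case: h1'; exists n, y; have [] := ME _ _ _ h.
  - by case: h1; exists n', y'; have [] := ME _ _ _ h'.
  - by split=> //; exact: least_unique h2 h2' h3 h3'.
have PE n x y : Pm n x y -> E (x, y) /\ vl n y.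
  by move=> [/ME[? []]|[_ [-> [? _]]]].
have mP n g h : mf g -> mf h -> mp (fun x => Pm n (g x) (h x)).
  move=> hg hh; apply: mp_or; first exact: mp_rel.
  apply: mp_and.
    apply: (mp_pre (P := fun x => ~ exists m y', E (x, y') /\ M m x y') hg).
    apply: mp_not; apply: mp_ex => m; apply: mp_exP => k.
    by apply: (mp_rel (mM m)); [exact: measurable_id|exact: me].
  apply: mp_and; first exact: (mp_eq sepU mU).
  apply: mp_and; first exact: (mp_pre (P := fun x => vl n x) hg (mp_valid _)).
  apply: mp_all => m; apply: mp_imp; first exact: mp_const.
  by apply: mp_not; exact: (mp_pre (P := fun x => vl m x) hg (mp_valid _)).
have /choice[ny hny] := Pex.
have nyP n x : (ny x).1 = n <-> exists y, E (x, y) /\ Pm n x y.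
  split=> [<-|[y [_ h]]]; last by have [] := Pfun _ _ _ _ _ (hny x) h.
  by exists (ny x).2; split; [case: (PE _ _ _ (hny x))|].
have mny n g : mf g -> mp (fun x => (ny (g x)).1 = n).
  move=> hg; apply: (mp_pre (P := fun x => (ny x).1 = n) hg).
  apply: (mp_ext (fun x => iff_sym (nyP n x))).
  by apply: mp_exP => m; apply: mP; [exact: measurable_id|exact: me].
have mny2 : mf (fun x => (ny x).2).
  move=> _ A mA; rewrite setTI.
  apply: (@mp_ext _ _ (fun x => exists n y, E (x, y) /\ (Pm n x y /\ A y))).
    move=> x; split=> [[n [y [_ [h Ay]]]]|h].
      by have [_ ey] := Pfun _ _ _ _ _ (hny x) h; rewrite /= ey.
    by exists (ny x).1, (ny x).2; split; [case: (PE _ _ _ (hny x))|].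
  apply: mp_ex => n; apply: mp_exP => m; apply: mp_and.
    by apply: mP; [exact: measurable_id|exact: me].
  exact: (mp_pre (P := A) (me m)).
exists (fun x => ct (ny x).1 (ny x).2); split.
- move=> x; have [Exy vy] := PE _ _ _ (hny x).
  by rewrite (cuts_eq Exy); exact: vl_cut.
- move=> h g hh hg.
  apply: (@mp_ext _ _ (fun x => exists n, (ny (h x)).1 = n /\ ct n (ny (h x)).2 (g x))).
    by move=> x; split=> [[n [->]]|hx]; last by exists (ny (h x)).1.
  apply: mp_ex => n; apply: mp_and; first exact: mny.
  by apply: mp_cutof => //; exact: (measurableT_comp mny2 hh).
- move=> S bS.
  apply: (@mp_ext _ _ (fun x => exists n, (ny x).1 = n /\ (vl n (ny x).2 /\ S (bd (code_of n) (ny x).2)))).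
    move=> x; have [_ vy] := PE _ _ _ (hny x); have [eb _] := valid_cut vy.
    rewrite /ct eb; split=> [[n [-> []]]//|h]; by exists (ny x).1.
  apply: mp_ex => n; apply: mp_and; first by apply: (mny n id); exact: measurable_id.
  apply: (mp_pre (P := fun z => vl n z /\ S (bd (code_of n) z)) mny2).
  apply: (@mp_ext _ _ (fun z => vl n z /\ (injective (tup (k := code_of n) z) /\
    S (bd (code_of n) z)))).
    by move=> z; split=> [[h1 [h2 h3]]|[h1 h2]]; split=> //; split=> //; case: h1.
  apply: mp_and; first exact: mp_valid.
  have mt i : measurable_fun setT (fun x => tup (k := code_of n) x i).
    by apply: measurable_fun_pair; exact: me.
  have hb := bS (size (code_of n)).
  exact: (mp_tuple hb mt).
- move=> A CA nsel; have [a Aa] := cut_nonempty CA.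
  have [n [vn en]] := cut_ct (cuts_in CA Aa).
  have Da : D n a by split=> //; rewrite en.
  have [x [y [h [_ [_ s]]]]] := Msurj n a Da; exists x.
  have [e1 e2] := Pfun _ _ _ _ _ (hny x) (or_introl h).
  by rewrite e1 e2 -en; exact: sim_sym.
Qed.

(** * Contracting the vertices outside the range of [pi] and lifting the remaining edges *)

Section Treeing.
Variable pi : X -> set X.
Hypothesis pi_cuts : forall x, cuts x (pi x).
Hypothesis mpi : forall h g, mf h -> mf g -> mp (fun x => pi (h x) (g x)).
Hypothesis pi_onto : forall A, CC A -> ~ selectable A -> exists x, cut_sim G CC (pi x) A.

Local Notation sim := (cut_sim G CC).
Local Notation star := (cstar G).

Lemma msetb_pi g : mpt g -> msetb (fun x => pi (g x)).
Proof.
move=> [mg Eg]; split=> [x|h hh]; last exact: mpi.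
by rewrite (cls_eq (Eg x)); apply: cuts_sub; exact: pi_cuts.
Qed.

Lemma sim_cls A B x : sim A B -> A `<=` cls x -> B `<=` cls x.
Proof. by move=> AB Ax; have [] : cuts x B by apply: sim_in (AB); split=> //; case: AB. Qed.

Lemma CC_star A : CC A -> CC (star A). Proof. exact: CCdual. Qed.

Lemma CC_in A : CC A -> exists x, cuts x A.
Proof. by move=> CA; have [a Aa] := cut_nonempty CA; exists a; exact: cuts_in. Qed.

Lemma starK A : CC A -> star (star A) = A.
Proof.
move=> /CC_in[x cA]; rewrite (cuts_star cA) (cuts_star (cuts_c cA)).
by rewrite (ccK (@cuts_sub x) cA).
Qed.

(** Distance at most [n] in the structure tree from the vertex of [A] to the range of [pi]; passing
    from [B] to [star B] moves to the other end of an edge. *)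
Fixpoint reach n A : Prop :=
  if n is m.+1 then reach m A \/ exists B, sim A B /\ reach m (star B)
  else exists x, sim (pi x) A.

Lemma reach_sim n A B : sim A B -> reach n A -> reach n B.
Proof.
elim: n A B => [|n ih] A B AB /=; first by move=> [x h]; exists x; exact: sim_trans AB.
move=> [/(ih _ _ AB)|[D [AD rD]]]; [by left|right; exists D; split=> //].
by apply: sim_trans AD; exact: sim_sym.
Qed.

Lemma reach_mono n m A : (n <= m)%N -> reach n A -> reach m A.
Proof.
move=> nm; rewrite -(subnK nm); elim: (m - n)%N => // k ih h; rewrite addSn /=.
by left; exact: ih.
Qed.

(** The canonical base point of a selectable vertex: the least point of its first finite nonempty
    fiber. *)
Definition seat A z := exists n, (finite_fiber n A /\ forall m, (m < n)%N -> ~ finite_fiber m A) /\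
  (fiber n A z /\ forall w, fiber n A w -> forall k, U k z -> U k w).

Lemma seat_sim A B z : sim A B -> seat A z -> seat B z.
Proof.
move=> AB [n [[h1 h2] h3]]; exists n; rewrite -(fiber_sim n AB); split=> //; split.
  exact/(finite_fiber_sim _ AB).
by move=> m /h2; apply: contra_not => /(finite_fiber_sim _ AB).
Qed.

Lemma seat_unique A z w : seat A z -> seat A w -> z = w.
Proof.
move=> [n [[h1 h2] [fz lz]]] [m [[h1' h2'] [fw lw]]].
have enm := least_unique h1 h1' h2 h2'; rewrite -enm in fw lw.
by apply: sepU => k; split; [exact: lz|exact: lw].
Qed.

Lemma finite_least (B : set X) : finite_set B -> B !=set0 ->
  exists z, B z /\ forall w, B w -> forall k, U k z -> U k w.
Proof.
move=> /finite_seqP[s ->]; elim: s => [[]//|a s ih _].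
have [s0|s0] := pselect (s = [::]).
  exists a; split; first by rewrite /= mem_head.
  by move=> w /=; rewrite s0 inE => /eqP->.
have [|z [zs lz]] := ih; first by case: s s0 {ih} => // b s _; exists b; rewrite /= mem_head.
have [az|za] := Utot a z.
  exists a; split; first by rewrite /= mem_head.
  by move=> w /=; rewrite inE => /orP[/eqP->//|/lz h] k /az/h.
exists z; split; first by rewrite /= inE zs orbT.
by move=> w /=; rewrite inE => /orP[/eqP->//|/lz].
Qed.

Lemma seat_exists A : selectable A -> exists z, seat A z.
Proof.
move=> /least[n [[f0 ff] hn]]; have [z [fz lz]] := finite_least ff f0.
by exists z, n.
Qed.

Lemma seat_fiber A z : seat A z -> exists n, fiber n A z.
Proof. by move=> [n [_ [h _]]]; exists n. Qed.

Lemma seat_cls A x z : A `<=` cls x -> seat A z -> E (x, z).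
Proof. by move=> Ax /seat_fiber[n]; exact: fiber_cls. Qed.

Definition cand m A z l := vl l z /\ (sim A (ct l z) /\ reach m (star (ct l z))).

(* [parent P]: the vertex of [P] is not of the form [pi x], and [P] is the edge chosen
   there, by means of the seat of the vertex, as the first step towards the range of [pi]. *)
Definition parent P := exists m z, seat P z /\ exists l, ~ reach m P /\
  (cand m P z l /\ ((forall l', (l' < l)%N -> ~ cand m P z l') /\ P = ct l z)).

Lemma cand_sim m A B z l : sim A B -> cand m A z l -> cand m B z l.
Proof.
by move=> AB [h1 [h2 h3]]; split=> //; split=> //; apply: sim_trans h2; exact: sim_sym.
Qed.

Lemma parent_CC P : parent P -> CC P.
Proof. by move=> [m [z [_ [l [_ [[_ [[]]]]]]]]]. Qed.

Lemma parent_not_reach0 P : parent P -> ~ reach 0 P.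
Proof. by move=> [m [z [_ [l [nr _]]]]] /(reach_mono (leq0n m)). Qed.

(** The three choices in [parent] are forced: [m.+1] is the exact distance of the vertex from the
    range of [pi], the seat depends on the vertex alone, and the code is least. *)
Lemma parent_unique P P' : sim P P' -> parent P -> parent P' -> P = P'.
Proof.
move=> PP'; have P'P := sim_sym PP'.
move=> [m [z [sz [l [nr [cl [ll ->]]]]]]] [m' [z' [sz' [l' [nr' [cl' [ll' ->]]]]]]].
have ez : z = z' by apply: seat_unique sz _; exact: seat_sim sz'.
have up k Q w i : cand k Q w i -> reach k.+1 Q by move=> [_ [h1 h2]]; right; exists (ct i w).
have mm : (m' <= m)%N.
  rewrite leqNgt; apply/negP => mm'; apply: nr'; apply: reach_mono mm' _.
  by apply: reach_sim PP' _; exact: up cl.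
have mm' : (m <= m')%N.
  rewrite leqNgt; apply/negP => mm2; apply: nr; apply: reach_mono mm2 _.
  by apply: reach_sim P'P _; exact: up cl'.
have em : m = m' by apply/eqP; rewrite eqn_leq mm mm'.
rewrite -ez -em in cl' ll' *.
suff -> : l = l' by [].
apply: (least_unique (P := cand m P z)) => //; first exact: cand_sim cl'.
by move=> i /ll'; apply: contra_not; exact: cand_sim.
Qed.

Lemma parent_exists m A : CC A -> reach m.+1 A -> ~ reach m A ->
  exists P, [/\ parent P, sim A P & reach m (star P)].
Proof.
move=> CA [//|[B [AB rB]]] nr.
have [z sz] : exists z, seat A z.
  apply: seat_exists; apply: contrapT => /(pi_onto CA)[x hx]; apply: nr.
  by apply: (reach_mono (leq0n m)); exists x.
have [x cA] := CC_in CA; have Exz := seat_cls (cuts_sub cA) sz.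
have cB : cuts z B by rewrite -(cuts_eq Exz); exact: sim_in AB.
have [l0 [vl0 el0]] := cut_ct cB.
have [l [hl ll]] : exists l, cand m A z l /\ forall l', (l' < l)%N -> ~ cand m A z l'.
  by apply: least; exists l0; split=> //; rewrite el0.
have [_ [s r]] := hl; exists (ct l z); split=> //.
exists m, z; split; first exact: seat_sim sz.
exists l; split; first by move=> /(reach_sim (sim_sym s)).
split; first exact: cand_sim hl.
by split=> // l' /ll; apply: contra_not; apply: cand_sim; exact: sim_sym.
Qed.

Fixpoint anch n A x : Prop :=
  if n is m.+1 then exists P, parent P /\ (sim A P /\ anch m (star P) x) else sim (pi x) A.

(* The cell of the vertex of [A] contains the vertex of [pi x]. *)
Definition anchor A x := exists n, anch n A x.

Lemma anch_sim n A B x : sim A B -> anch n A x -> anch n B x.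
Proof.
case: n => [|n] AB /=; first by move=> h; exact: sim_trans AB.
by move=> [P [pP [AP h]]]; exists P; split=> //; split=> //; apply: sim_trans AP; exact: sim_sym.
Qed.

Lemma anchor_sim A B x : sim A B -> anchor A x -> anchor B x.
Proof. by move=> AB [n h]; exists n; exact: anch_sim AB h. Qed.

Lemma anchor_pi x : anchor (pi x) x.
Proof. by exists 0%N; apply: sim_refl; have [] := pi_cuts x. Qed.

(** Parent edges are unique and start only outside the range of [pi], so the path from a vertex is
    forced and stops exactly when it first meets that range. *)
Lemma anch_unique n m A x y : anch n A x -> anch m A y -> sim (pi x) (pi y).
Proof.
elim: n m A => [|n ih] [|m] A /=.
- by move=> h1 h2; apply: sim_trans h1 _; exact: sim_sym.
- move=> h [P [/parent_not_reach0 nP [AP _]]]; case: nP; exists x; exact: sim_trans AP.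
- move=> [P [/parent_not_reach0 nP [AP _]]] h; case: nP; exists y; exact: sim_trans AP.
- move=> [P [pP [AP h]]] [P' [pP' [AP' h']]].
  have eP : P = P' by apply: parent_unique => //; apply: sim_trans AP'; exact: sim_sym.
  by rewrite -eP in h'; exact: ih h h'.
Qed.

Lemma anchor_unique A x y : anchor A x -> anchor A y -> sim (pi x) (pi y).
Proof. by move=> [n h] [m h']; exact: anch_unique h h'. Qed.

Lemma anch_cls n A x z : A `<=` cls z -> anch n A x -> E (z, x).
Proof.
elim: n A => [|n ih] A Az /=.
  move=> h; have [_ pz] : cuts z (pi x).
    by apply: (sim_in (A := A)); [split=> //; case: h => _ []|exact: sim_sym].
  have [_ px] := pi_cuts x; have [a pa] := cut_nonempty (proj1 h).
  by apply: Etrans (pz _ pa) _; apply: Esym; exact: px.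
move=> [P [pP [AP h]]]; apply: ih h.
have cP : cuts z P by split; [exact: parent_CC|exact: sim_cls AP Az].
by rewrite (cuts_star cP) => y [].
Qed.

Lemma anchor_cls A x z : A `<=` cls z -> anchor A x -> E (z, x).
Proof. by move=> Az [n]; exact: anch_cls. Qed.

Lemma sim_of_adj x A B : cuts x A -> cuts x B -> adj x A B -> sim A B.
Proof. by move=> cA cB aAB; apply/(cut_simE _ cA). Qed.

Lemma structure_tree_connected x (R : set X -> set X -> Prop) :
  (forall A B, cuts x A -> cuts x B -> sim A B -> R A B) ->
  (forall A, cuts x A -> R A (star A)) ->
  (forall A B, R A B -> R B A) -> (forall A B D, R A B -> R B D -> R A D) ->
  forall A B, cuts x A -> cuts x B -> R A B.
Proof.
move=> h1 h2; apply: (incident_connected (@cuts_sub x) (@cuts_c x) (@cuts_nest x)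
  (@cuts_dec x) (@cuts_inc x)).
  by move=> A B cA cB h; apply: h1 => //; exact: sim_of_adj cA cB h.
by move=> A cA; rewrite -(cuts_star cA); exact: h2.
Qed.

Lemma reach_exists A : CC A -> exists n, reach n A.
Proof.
move=> CA; have [x cA] := CC_in CA.
have : (exists n, reach n (pi x)) <-> exists n, reach n A.
  apply: (structure_tree_connected (x := x)
    (R := fun A B => (exists n, reach n A) <-> exists n, reach n B)) => //.
  - move=> B D _ _ BD; split=> -[n h]; exists n; first exact: reach_sim h.
    by apply: reach_sim h; exact: sim_sym.
  - move=> B [CB _]; split=> -[n h]; exists n.+1; right.
      by exists (star B); split; [apply: sim_refl; exact: CC_star|rewrite starK].
    by exists B; split=> //; exact: sim_refl.
  - by move=> B D ->.
  - by move=> B D F ->.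
move=> <-; exists 0%N, x; apply: sim_refl; by have [] := pi_cuts x.
Qed.

Lemma anchor_exists A : CC A -> exists x, anchor A x.
Proof.
move=> CA; have [n rn] := reach_exists CA; elim: n A CA rn => [|n ih] A CA.
  by move=> [x h]; exists x, 0%N.
have [rn _|nr r] := pselect (reach n A); first exact: ih.
have [P [pP AP rP]] := parent_exists CA r nr.
have [|x [m h]] := ih (star P) _ rP; first by apply: CC_star; exact: parent_CC.
by exists x, m.+1, P.
Qed.

Lemma anchor_parent P x : parent P -> anchor (star P) x -> anchor P x.
Proof.
move=> pP [n h]; exists n.+1, P; split=> //; split=> //.
by apply: sim_refl; exact: parent_CC.
Qed.

Lemma bdry_star C u v : CC C -> bdry G (star C) (u, v) <-> bdry G C (v, u).
Proof.
by move=> CC1; rewrite /bdry /= starK //; split=> -[/Gsym h1 [h2 h3]].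
Qed.

Lemma bdry_nonempty C : CC C -> bdry G C !=set0.
Proof.
move=> CC1; have [b [[a Aa ab] nAb]] := cut_nonempty (CC_star CC1).
by have [p [Bp _]] := boundary_crossed Gsym ab Aa nAb; exists p.
Qed.

(* The least endpoint of the boundary belongs to exactly one of [C] and its complement,
   hence selects one orientation of each edge of the structure tree. *)
Definition basept C z := C z /\ ((exists w, E (z, w) /\ bdry G C (z, w)) /\
  forall u, E (z, u) -> forall v, E (z, v) -> bdry G C (u, v) ->
    (forall k, U k z -> U k u) /\ (forall k, U k z -> U k v)).

Lemma bdry_cls C u v z : CC C -> bdry G C (u, v) -> C z \/ star C z -> E (z, u) /\ E (z, v).
Proof.
move=> CC1 [Guv [/= Cu Cv]] Cz; have cC := cuts_in CC1 Cu.
have Euz : E (u, z).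
  case: Cz => [Cz|]; first exact: (cuts_sub cC).
  by rewrite (cuts_star cC) => -[].
split; first exact: Esym.
apply: Etrans (Esym Euz) _; apply/Gconn; exact: rt_step.
Qed.

Lemma basept_le C z w : CC C -> basept C z -> basept C w \/ basept (star C) w ->
  forall k, U k z -> U k w.
Proof.
move=> CC1 [Cz [_ lz]] [] [Cw [[v [_ bw]] _]].
  by have [Ez Ev] := bdry_cls CC1 bw (or_introl Cz); have [] := lz _ Ez _ Ev bw.
have {}bw : bdry G C (v, w) by apply/bdry_star.
by have [Ez Ev] := bdry_cls CC1 bw (or_introl Cz); have [] := lz _ Ez _ Ev bw.
Qed.

Lemma basept_unique C z w : CC C -> basept C z -> basept C w -> z = w.
Proof.
move=> CC1 bz bw; apply: sepU => k.
by split; [exact: (basept_le CC1 bz (or_introl bw))|exact: (basept_le CC1 bw (or_introl bz))].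
Qed.

Lemma basept_star C z w : CC C -> basept C z -> basept (star C) w -> False.
Proof.
move=> CC1 bz bw; have ezw : z = w.
  apply: sepU => k; split; first exact: (basept_le CC1 bz (or_intror bw)).
  by apply: (basept_le (CC_star CC1) bw); right; rewrite starK.
by case: bw => -[_ []]; rewrite -ezw; case: bz.
Qed.

Lemma basept_exists C : CC C -> (exists z, basept C z) \/ (exists z, basept (star C) z).
Proof.
move=> CC1; have [_ [_ [_ fb]]] := CCcut CC1.
pose B := [set p.1 | p in bdry G C] `|` [set p.2 | p in bdry G C].
have fB : finite_set B by rewrite finite_setU; split; exact: finite_image.
have [p0 Bp0] := bdry_nonempty CC1.
have [|z [Bz lz]] := finite_least fB; first by exists p0.1; left; exists p0.
have lz' u v : bdry G C (u, v) -> (forall k, U k z -> U k u) /\ (forall k, U k z -> U k v).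
  by move=> b; split; apply: lz; [left|right]; exists (u, v).
case: Bz => -[[u v] b /= euv]; move: (b) => [Guv [/= Cu Cv]]; [left|right]; exists z;
  rewrite -euv in lz' *.
  split=> //; split; last by move=> ? _ ? _; exact: lz'.
  by exists v; split=> //; have [] := bdry_cls CC1 b (or_introl Cu).
split=> //; split; last by move=> a _ a' _ /bdry_star - /(_ CC1)/lz'[].
exists u; split; last exact/bdry_star.
by have [] := bdry_cls CC1 b (or_intror Cv).
Qed.

Definition first_anchor C q x := exists i, x = e i q /\
  (anchor C (e i q) /\ forall i', (i' < i)%N -> ~ anchor C (e i' q)).

Lemma first_anchor_unique C q x y : first_anchor C q x -> first_anchor C q y -> x = y.
Proof.
move=> [i [-> [h1 h2]]] [j [-> [h1' h2']]]; congr (e _ q).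
exact: (least_unique (P := fun i => anchor C (e i q))).
Qed.

Lemma first_anchor_anchor C q x : first_anchor C q x -> anchor C x.
Proof. by move=> [i [-> []]]. Qed.

Lemma first_anchor_exists C q : cuts q C -> exists x, first_anchor C q x.
Proof.
move=> cC; have [x hx] := anchor_exists (proj1 cC).
have /Ee[i0 ei0] := anchor_cls (cuts_sub cC) hx.
have [i [h1 h2]] : exists i, anchor C (e i q) /\ forall i', (i' < i)%N -> ~ anchor C (e i' q).
  by apply: least; exists i0; rewrite -ei0.
by exists (e i q), i.
Qed.

(** The base point [q] fixes both an orientation of the edge and an enumeration of the class, so
    that an uncontracted edge yields exactly one pair: the first points, seen from [q], anchored at
    its two ends. *)
Definition edge C x y := (~ parent C /\ ~ parent (star C)) /\
  exists q, E (x, q) /\ (basept C q /\ (first_anchor C q x /\ first_anchor (star C) q y)).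

Definition tree_edge x y := exists C, cuts x C /\ edge C x y.

Definition treeing x y := tree_edge x y \/ tree_edge y x.

Lemma edge_exists C q : cuts q C -> basept C q -> ~ parent C -> ~ parent (star C) ->
  exists x y, tree_edge x y /\ (anchor C x /\ anchor (star C) y).
Proof.
move=> cC bq n1 n2; have [x fx] := first_anchor_exists cC.
have cC' : cuts q (star C) by rewrite (cuts_star cC); exact: cuts_c.
have [y fy] := first_anchor_exists cC'.
have Eqx := anchor_cls (cuts_sub cC) (first_anchor_anchor fx).
exists x, y; split; last by split; [exact: first_anchor_anchor fx|exact: first_anchor_anchor fy].
exists C; split; first by rewrite -(cuts_eq Eqx).
by split=> //; exists q; split=> //; exact: Esym.
Qed.

Lemma edge_unique C x y x' y' : CC C -> edge C x y -> edge C x' y' -> x = x' /\ y = y'.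
Proof.
move=> CC1 [_ [q [_ [bq [h1 h2]]]]] [_ [q' [_ [bq' [h1' h2']]]]].
have eqq : q = q' by exact: basept_unique CC1 bq bq'.
by rewrite -eqq in h1' h2'; split; [exact: first_anchor_unique h1 h1'|exact: first_anchor_unique h2 h2'].
Qed.

Lemma edge_star C x y x' y' : CC C -> edge C x y -> edge (star C) x' y' -> False.
Proof. by move=> CC1 [_ [q [_ [bq _]]]] [_ [q' [_ [bq' _]]]]; exact: basept_star CC1 bq bq'. Qed.

Lemma edge_anchor C x y : edge C x y -> anchor C x /\ anchor (star C) y.
Proof. by move=> [_ [q [_ [_ [/first_anchor_anchor h /first_anchor_anchor]]]]]. Qed.

Lemma tree_edge_E x y : tree_edge x y -> E (x, y).
Proof.
move=> [C [cC /edge_anchor[_ /anchor_cls]]]; apply.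
by rewrite (cuts_star cC) => z [].
Qed.

Lemma treeing_E x y : treeing x y -> E (x, y).
Proof. by move=> [/tree_edge_E|/tree_edge_E/Esym]. Qed.

Local Notation ins z := (inside (cls z) (cuts z)).

Lemma inside_sim z C A B : cuts z C -> cuts z A -> sim A B -> ins z C A <-> ins z C B.
Proof.
move=> cC cA AB; have [cB aAB] := (cut_simE B cA).1 AB.
have aBA : adj z B A by exact: (incident_sym (@cuts_sub z) (@cuts_c z)).
by split; apply: (inside_incident (@cuts_sub z) (@cuts_nonempty z) (@cuts_c z) (@cuts_nest z)).
Qed.

(** The path from the vertex of [A] to its anchor uses only parent edges. Since [C] is not one of
    them in either direction, the path never crosses [C]. *)
Lemma inside_anchor z C A x : cuts z C -> ~ parent C -> ~ parent (star C) ->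
  cuts z A -> anchor A x -> ins z C A <-> ins z C (pi x).
Proof.
move=> cC n1 n2 + [n]; elim: n A => [|n ih] A cA /=.
  by move=> h; apply: inside_sim => //; exact: sim_sym.
move=> [P [pP [AP h]]].
have cP : cuts z P by exact: sim_in AP.
have cP' : cuts z (star P) by rewrite (cuts_star cP); exact: cuts_c.
rewrite (inside_sim cC cA AP) -(ih _ cP' h) (cuts_star cP).
apply: (inside_c_iff (@cuts_sub z) (@cuts_nonempty z) (@cuts_c z) (@cuts_nest z)
  (@cuts_dec z)) => //.
  by move=> eCP; apply: n1; rewrite eCP.
move=> eCP; apply: n2; rewrite eCP -(cuts_star cP) starK //; exact: parent_CC.
Qed.

Definition wall C z w := E (z, w) /\ ins z C (pi w).

Lemma wall_sim C z u v : cuts z C -> sim (pi u) (pi v) -> wall C z u <-> wall C z v.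
Proof.
move=> cC; have main a b : sim (pi a) (pi b) -> wall C z a -> wall C z b.
  move=> h [Eza ia]; have ca : cuts z (pi a) by rewrite (cuts_eq Eza).
  split; last by apply/(inside_sim cC ca h).
  have [_ pb] := sim_in ca h; have [_ pb'] := pi_cuts b.
  have [y py] := cut_nonempty (proj1 (proj2 h)).
  by apply: Etrans (pb _ py) _; apply: Esym; exact: pb'.
by move=> h; split; apply: main => //; exact: sim_sym.
Qed.

Lemma wall_separates C x y : cuts x C -> edge C x y -> ~ (wall C x x <-> wall C x y).
Proof.
move=> cC ed; have [n1 n2] := proj1 ed; have [ax ay] := edge_anchor ed.
have cC' : cuts x (star C) by rewrite (cuts_star cC); exact: cuts_c.
have Exy : E (x, y) by exact: anchor_cls (cuts_sub cC') ay.
have iy : ins x C (pi y).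
  apply/(inside_anchor cC n1 n2 cC' ay); rewrite (cuts_star cC).
  exact: (inside_c (@cuts_sub x) (@cuts_c x)).
have nx : ~ ins x C (pi x).
  move=> /(inside_anchor cC n1 n2 cC ax) i.
  apply: (inside_outside (@cuts_sub x) (@cuts_nonempty x) (@cuts_c x) (@cuts_nest x) cC cC i).
  exact: outside_self.
by move=> h; apply: nx; apply: proj2 (h.2 _).
Qed.

(** The two ends of [D] lie on the same side of [C] by [inside_c_iff], and passing from them to
    their anchors does not change sides. *)
Lemma wall_other C z D x y : cuts z C -> ~ parent C -> ~ parent (star C) ->
  cuts x D -> edge D x y -> C <> D -> C <> star D -> wall C z x <-> wall C z y.
Proof.
move=> cC n1 n2 cD ed nCD nCD'; have [ax ay] := edge_anchor ed.
have Exy : E (x, y) by apply: tree_edge_E; exists D.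
have [Ezx|nEzx] := pselect (E (z, x)); last first.
  split=> -[Ez _]; first by [].
  by case: nEzx; apply: Etrans Ez _; exact: Esym.
have Ezy := Etrans Ezx Exy.
have {}cD : cuts z D by rewrite (cuts_eq Ezx).
have cD' : cuts z (star D) by rewrite (cuts_star cD); exact: cuts_c.
suff : ins z C (pi x) <-> ins z C (pi y) by move=> h; split=> -[_ /h].
rewrite -(inside_anchor cC n1 n2 cD ax) -(inside_anchor cC n1 n2 cD' ay) (cuts_star cD).
apply: (inside_c_iff (@cuts_sub z) (@cuts_nonempty z) (@cuts_c z) (@cuts_nest z)
  (@cuts_dec z)) => //.
by rewrite -(cuts_star cD).
Qed.

(** Every pair lifted from [C] is the pair [(a, b)], none is lifted from [star C] because only one
    orientation has a base point, and pairs lifted from other edges do not cross the wall. *)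
Lemma tree_edge_wall a b : tree_edge a b -> exists s : X -> Prop,
  [/\ ~ (s a <-> s b), (forall u v, sim (pi u) (pi v) -> (s u <-> s v)) &
      forall u v, treeing u v -> ~ (s u <-> s v) -> (u = a /\ v = b) \/ (u = b /\ v = a)].
Proof.
move=> [C [cC ed]]; have [n1 n2] := proj1 ed; exists (wall C a).
have key u v : tree_edge u v -> ~ (wall C a u <-> wall C a v) -> u = a /\ v = b.
  move=> [D [cD edD]] nw.
  have [eCD|nCD] := pselect (C = D).
    rewrite -eCD in edD; exact: edge_unique (proj1 cC) edD ed.
  have [eCD|nCD'] := pselect (C = star D).
    by rewrite eCD in ed; case: (edge_star (proj1 cD) edD ed).
  by case: nw; exact: wall_other cD edD nCD nCD'.
split.
- exact: wall_separates.
- by move=> u v; exact: wall_sim.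
- move=> u v [tuv|tvu] nw; first by left; exact: key.
  by right; have [-> ->] := key _ _ tvu (fun h => nw (iff_sym h)).
Qed.

Lemma treeing_wall a b : treeing a b -> exists s : X -> Prop,
  [/\ ~ (s a <-> s b), (forall u v, sim (pi u) (pi v) -> (s u <-> s v)) &
      forall u v, treeing u v -> ~ (s u <-> s v) -> (u = a /\ v = b) \/ (u = b /\ v = a)].
Proof.
move=> [|] /tree_edge_wall[s [h1 h2 h3]]; exists s; split=> //.
- by move=> h; apply: h1; apply: iff_sym.
- by move=> u v tuv /(h3 _ _ tuv)[]; [right|left].
Qed.

Lemma treeing_irrefl x : ~ treeing x x.
Proof. by move=> /treeing_wall[s [h _ _]]; apply: h. Qed.

Lemma treeing_generates (F : X -> X -> Prop) : (forall x, F x x) ->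
  (forall x y, F x y -> F y x) -> (forall x y z, F x y -> F y z -> F x z) ->
  (forall x y, treeing x y -> F x y) -> (forall x y, sim (pi x) (pi y) -> F x y) ->
  forall x y, E (x, y) -> F x y.
Proof.
move=> Frefl Fsym Ftrans Ft Fs x y Exy.
(* Relates vertices through all points anchored at them, so that [F] spreads along the structure
   tree: a contracted edge stays within one cell, and any other edge is bridged by its lifted
   pair. *)
pose R A B := (cuts x A /\ cuts x B) /\ forall u v, anchor A u -> anchor B v -> F u v.
have cstar A : cuts x A -> cuts x (star A) by move=> cA; rewrite (cuts_star cA); exact: cuts_c.
have Rsym A B : R A B -> R B A.
  by move=> [[cA cB] h]; split=> // u v hu hv; apply: Fsym; exact: h.
have Rbase A : cuts x A -> (exists z, basept A z) -> R A (star A).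
  move=> cA [q bq]; split; first by split=> //; exact: cstar.
  have [pA|nA] := pselect (parent A).
    by move=> u v hu /(anchor_parent pA) hv; apply: Fs; exact: anchor_unique hu hv.
  have [pA|nA'] := pselect (parent (star A)).
    move=> u v; rewrite -{1}(starK (proj1 cA)) => /(anchor_parent pA) hu hv.
    by apply: Fs; exact: anchor_unique hu hv.
  have cq : cuts q A by apply: cuts_in; [case: cA|case: bq].
  have [a [b [tab [ha hb]]]] := edge_exists cq bq nA nA'.
  move=> u v hu hv; apply: (Ftrans _ a); first by apply: Fs; exact: anchor_unique hu ha.
  apply: (Ftrans _ b); first by apply: Ft; left.
  by apply: Fs; exact: anchor_unique hb hv.
have [_ Rxy] : R (pi x) (pi y).
  apply: (structure_tree_connected (x := x)) => //.
  - move=> A B cA cB AB; split=> // u v /(anchor_sim AB) hu hv.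
    by apply: Fs; exact: anchor_unique hu hv.
  - move=> A cA; have [/(Rbase _ cA)//|] := basept_exists (proj1 cA).
    move=> /(Rbase _ (cstar _ cA)); rewrite starK; [exact: Rsym|by case: cA].
  - move=> A B D [[cA cB] h] [[_ cD] h']; split=> // u v hu hv.
    have [w hw] := anchor_exists (proj1 cB).
    by apply: (Ftrans _ w); [exact: h|exact: h'].
  - by rewrite (cuts_eq Exy).
by apply: Rxy; exact: anchor_pi.
Qed.

(** * Borelness of the treeing and of the pulled-back relation *)

Lemma mp_reach n A : msetb A -> mp (fun x => reach n (A x)).
Proof.
elim: n A => [|n ih] A hA /=.
  apply: (@mp_ext _ _ (fun x => exists y, E (x, y) /\ sim (pi y) (A x))).
    move=> x; split=> [[y [_ h]]|[y h]]; exists y => //; split=> //.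
    have [_ Ay] := sim_in (pi_cuts y) h; have [a Aa] := cut_nonempty (proj1 (proj2 h)).
    by apply: Etrans (hA.1 _ _ Aa) _; apply: Esym; exact: Ay.
  by apply: mp_exP => m; apply: mp_sim => //; apply: msetb_pi; exact: mpt_en.
apply: mp_or; first exact: ih.
apply: (@mp_ext _ _ (fun x => exists B, cuts x B /\ (sim (A x) B /\ reach n (star B)))).
  move=> x; split=> [[B [_ h]]|[B [h r]]]; exists B => //; split=> //.
  by apply: sim_in (h); split; [case: h|exact: hA.1].
apply: mp_exC => k; have hk : msetb (cutof k).
  by apply: msetb_cutof => //; exact: measurable_id.
apply: mp_and; first exact: mp_valid.
by apply: mp_and; [exact: mp_sim|apply: ih; exact: msetb_cstar].
Qed.

Lemma mp_Uset k g : mpt g -> mp (fun x => U k (g x)).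
Proof. by move=> [mg _]; exact: mp_U. Qed.

Lemma mp_seat A g : msetb A -> mpt g -> mp (fun x => seat (A x) (g x)).
Proof.
move=> hA hg; apply: mp_ex => n; apply: mp_and.
  apply: mp_and; first exact: mp_finite_fiber.
  apply: mp_all => m; apply: mp_imp; first exact: mp_const.
  by apply: mp_not; exact: mp_finite_fiber.
apply: mp_and; first exact: mp_fiber.
apply: (@mp_ext _ _ (fun x => forall y, E (x, y) -> fiber n (A x) y ->
    forall k, U k (g x) -> U k y)).
  move=> x; split=> [h y Fy|h y _]; last exact: h.
  by apply: h => //; apply: fiber_cls Fy; exact: hA.1.
apply: mp_allP => m; apply: mp_imp; first by apply: mp_fiber => //; exact: mpt_en.
apply: mp_all => k; apply: mp_imp; first exact: mp_Uset.
by apply: mp_Uset; exact: mpt_en.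
Qed.

Lemma mp_cand m A g l : msetb A -> mpt g -> mp (fun x => cand m (A x) (g x) l).
Proof.
move=> hA hg; have hl := msetb_ct l hg; apply: mp_and; first exact: mp_vl.
by apply: mp_and; [exact: mp_sim|apply: mp_reach; exact: msetb_cstar].
Qed.

Lemma mp_parent A : msetb A -> mp (fun x => parent (A x)).
Proof.
move=> hA; apply: mp_ex => m.
(* A seat lies in the class of its vertex, which makes the quantifier over [z] countable. *)
apply: (@mp_ext _ _ (fun x => exists z, E (x, z) /\ (seat (A x) z /\ exists l,
   ~ reach m (A x) /\ (cand m (A x) z l /\ ((forall l', (l' < l)%N -> ~ cand m (A x) z l') /\
   A x = ct l z))))).
  move=> x; split=> [[z [_ h]]|[z h]]; exists z => //; split=> //.
  by apply: (seat_cls (A := A x)); [exact: hA.1|case: h].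
apply: mp_exP => n; have hn := mpt_en n.
apply: mp_and; first exact: mp_seat.
apply: mp_ex => l; apply: mp_and; first by apply: mp_not; exact: mp_reach.
apply: mp_and; first exact: mp_cand.
apply: mp_and; last by apply: mp_seteq => //; exact: msetb_ct.
apply: mp_all => l'; apply: mp_imp; first exact: mp_const.
by apply: mp_not; exact: mp_cand.
Qed.

Lemma mp_anch n A g : msetb A -> mpt g -> mp (fun x => anch n (A x) (g x)).
Proof.
move=> + hg; elim: n A => [|n ih] A hA /=; first by apply: mp_sim => //; exact: msetb_pi.
apply: (@mp_ext _ _ (fun x => exists P, cuts x P /\ (parent P /\ (sim (A x) P /\
    anch n (star P) (g x))))).
  move=> x; split=> [[P [_ h]]|[P [pP [AP h]]]]; exists P => //; split=> //.
  by apply: sim_in (AP); split; [case: AP|exact: hA.1].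
apply: mp_exC => k; have hk : msetb (cutof k).
  by apply: msetb_cutof => //; exact: measurable_id.
apply: mp_and; first exact: mp_valid.
apply: mp_and; first exact: mp_parent.
by apply: mp_and; [exact: mp_sim|apply: ih; exact: msetb_cstar].
Qed.

Lemma mp_anchor A g : msetb A -> mpt g -> mp (fun x => anchor (A x) (g x)).
Proof. by move=> hA hg; apply: mp_ex => n; exact: mp_anch. Qed.

Lemma mp_mem A g : msetb A -> mpt g -> mp (fun x => A x (g x)).
Proof. by move=> [_ hA] [mg _]; exact: hA. Qed.

Lemma mp_bdry A g h : msetb A -> mpt g -> mpt h -> mp (fun x => bdry G (A x) (g x, h x)).
Proof.
move=> hA hg hh; apply: mp_and; first by apply: mp_G; [case: hg|case: hh].
by apply: mp_and; [exact: (mp_mem hA hg)|exact: (mp_mem (msetb_cstar hA) hh)].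
Qed.

Lemma mp_basept A g : msetb A -> mpt g -> mp (fun x => basept (A x) (g x)).
Proof.
move=> hA hg; have [mg Eg] := hg; apply: mp_and; first exact: mp_mem.
apply: mp_and.
  apply: (mp_exE (E := fun x y => E (x, y)) Ee (f := g)) => n.
  by apply: mp_bdry => //; exact: mpt_e.
apply: (mp_allE (E := fun x y => E (x, y)) Ee (f := g)) => n.
apply: (mp_allE (E := fun x y => E (x, y)) Ee (f := g)) => m.
have hn := mpt_e n hg; have hm := mpt_e m hg.
apply: mp_imp; first exact: mp_bdry.
by apply: mp_and; apply: mp_all => k; apply: mp_imp; exact: mp_Uset.
Qed.

Lemma mp_first_anchor A q g : msetb A -> mpt q -> mpt g ->
  mp (fun x => first_anchor (A x) (q x) (g x)).
Proof.
move=> hA hq hg; apply: mp_ex => i; apply: mp_and.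
  by apply: (mp_eq sepU mU); [case: hg|case: (mpt_e i hq)].
apply: mp_and; first by apply: mp_anchor => //; exact: mpt_e.
apply: mp_all => j; apply: mp_imp; first exact: mp_const.
by apply: mp_not; apply: mp_anchor => //; exact: mpt_e.
Qed.

Lemma mrel_tree_edge : mrel tree_edge.
Proof.
apply: (mrel_build sepU mU me Ee tree_edge_E) => n; apply: mp_exC => k.
have hk : msetb (cutof k) by apply: msetb_cutof => //; exact: measurable_id.
have hk' := msetb_cstar hk; have hn := mpt_en n.
apply: mp_and; first exact: mp_valid.
apply: mp_and; first by apply: mp_and; apply: mp_not; exact: mp_parent.
apply: mp_exP => m; have hm := mpt_en m.
apply: mp_and; first exact: mp_basept.
apply: mp_and; last exact: mp_first_anchor.
by apply: (@mp_first_anchor _ _ id) => //; exact: mpt_id.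
Qed.

Lemma mrel_treeing : mrel treeing.
Proof.
apply: (mrel_build sepU mU me Ee treeing_E) => n; apply: mp_or.
  by apply: (mp_rel mrel_tree_edge); [exact: measurable_id|exact: me].
by apply: (mp_rel mrel_tree_edge); [exact: me|exact: measurable_id].
Qed.

Lemma mrel_conn_treeing : mrel (clos_refl_trans X treeing).
Proof.
apply: (mrel_build sepU mU me Ee).
  move=> x y; elim=> [u v /treeing_E//|u|u v w _ h1 _ h2]; first exact: Erefl.
  exact: Etrans h1 h2.
move=> n; apply: (mp_clos (h := fun=> treeing)).
- by move=> _; exact: treeing_E.
- by move=> f g; exact: mp_rel mrel_treeing.
- exact: measurable_id.
- exact: me.
Qed.

Lemma mrel_sim_pi : mrel (fun x y => sim (pi x) (pi y)).
Proof.
apply: (mrel_build sepU mU me Ee).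
  move=> x y h; have [_ py] := sim_in (pi_cuts x) h; have [_ py'] := pi_cuts y.
  have [a pa] := cut_nonempty (proj1 (proj2 h)).
  by apply: Etrans (py _ pa) _; apply: Esym; exact: py'.
move=> n; apply: mp_sim; last by apply: msetb_pi; exact: mpt_en.
exact: (msetb_pi mpt_id).
Qed.

End Treeing.

Theorem structure_tree_decomposition : exists ET EC : set (X * X),
  borel_equiv ET /\ treeable ET /\ ET `<=` E /\
  borel_equiv EC /\ EC `<=` E /\ borel_reducible_to_sim G CC EC /\
  free_product E ET EC.
Proof.
have [pi [pi_cuts mpi mS pi_onto]] := vertex_map.
pose T := treeing pi; pose EC : set (X * X) := [set p | cut_sim G CC (pi p.1) (pi p.2)].
pose ET : set (X * X) := [set p | clos_refl_trans X T p.1 p.2].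
have TE := treeing_E pi_cuts.
have Tsym x y : T x y -> T y x by case; [right|left].
have ETsym x y : clos_refl_trans X T x y -> clos_refl_trans X T y x.
  elim=> [a b /Tsym|a|a b c _ h1 _ h2]; [exact: rt_step|exact: rt_refl|].
  exact: rt_trans h2 h1.
have ETE x y : clos_refl_trans X T x y -> E (x, y).
  by elim=> [a b /TE//|a|a b c _ h1 _]; [exact: Erefl|exact: Etrans h1].
have simE x y : cut_sim G CC (pi x) (pi y) -> E (x, y).
  move=> h; have [_ py] := sim_in (pi_cuts x) h; have [_ py'] := pi_cuts y.
  have [a pa] := cut_nonempty (proj1 (proj2 h)).
  by apply: Etrans (py _ pa) _; apply: Esym; exact: py'.
have sim0 x : cut_sim G CC (pi x) (pi x) by apply: sim_refl; have [] := pi_cuts x.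
have hw := treeing_wall pi_cuts.
exists ET, EC; split.
  split; first exact: mrel_conn_treeing.
  split; first by move=> x; exact: rt_refl.
  by split=> [x y|x y z]; [exact: ETsym|exact: rt_trans].
split.
  exists [set p | T p.1 p.2]; split; last first.
    by apply: (walls_acyclic hw) => x; exact: treeing_irrefl.
  split; first exact: mrel_treeing.
  by split=> [x|]; [exact: treeing_irrefl|split=> // x y; exact: Tsym].
split; first by move=> [x y]; exact: ETE.
split.
  split; first exact: mrel_sim_pi.
  split; first exact: sim0.
  by split=> [x y|x y z]; [exact: sim_sym|exact: sim_trans].
split; first by move=> [x y]; exact: simE.
split.
  exists pi; split; first by move=> x; have [] := pi_cuts x.
  by split=> [S bS|x y//]; exact: mS.
split.
  split; first by split.
  split; first by move=> [x y] [/ETE|/simE].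
  move=> F [Fr [Fs Ft]] RF [x y]; apply: (treeing_generates pi_cuts pi_onto
    (F := fun x y => F (x, y))) => //.
  - by move=> a b Tab; apply: RF; left; exact: rt_step.
  - by move=> a b ab; apply: RF; right.
move=> [n [x [n1 [xc [xne [xT xC]]]]]].
exact: (walls_free hw n1 xc xne xT xC).
Qed.

End Cuts.

Theorem mainTheorem3 (d : measure_display) (X : measurableType d)
    (E G : set (X * X)) (CC : set (set X)) :
  @standard_borel d X ->
  countable_borel_equiv E ->
  borel_graphing E G ->
  multi_ended G ->
  borel_cut_collection G CC ->
  G_complete G CC -> self_dual G CC -> nested G CC -> chain_vanishing G CC ->
  exists ET EC : set (X * X),
    borel_equiv ET /\ treeable ET /\ ET `<=` E /\
    borel_equiv EC /\ EC `<=` E /\ borel_reducible_to_sim G CC EC /\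
    free_product E ET EC.
Proof.
move=> sb cbe [mG [_ [Gsym Gconn]]] _ [CCcut CCb] complete dual nest chain.
have [U [e [sepU Utot mU me Ee]]] := countable_borel_equiv_enum sb cbe.
have [[_ [Er [Es Et]]] _] := cbe.
exact: (structure_tree_decomposition sepU mU me Ee Er Es Et mG Gsym Gconn CCcut CCb
  dual nest chain Utot complete).
Qed.
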